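(* Let $d\ge3$, let $I\subset\mathbb{R}$ be a compact interval and let $\gamma:I\to\mathbb{R}^d$ be a $C^\infty$ immersed curve. Suppose that $2\le K\le d$ and that, for some $t_0\in I$, the vectors $\gamma'(t_0),\dots,\gamma^{(K)}(t_0)$ are linearly independent. Then for suitable $\chi\in C_0^\infty$ supported in the interior of $I$ there are $c>0$ and $R_0\ge1$ so that the following lower bounds hold for $R>R_0$. (i) If $2\le K\le d-1$ then $$G_q(R)\ge cR^{-\sigma_K(q)},\quad 2<q<q_K;$$ moreover $$G_q(R)\ge cR^{-\sigma_K(q)}\log^{1/q}(R),\quad q\in\{q_k: k=2,\dots,K-1\}.$$ (ii) If $K=d$ then $$G_q(R)\ge cR^{-\sigma_d(q)},\quad 2<q\le\infty,$$ $$G_q(R)\ge cR^{-\sigma_d(q)}\log^{1/q}(R),\quad q\in\{q_k: k=2,\dots,d-1\}.$$ (iii) If $2\le K\le d-1$ and, in addition, $\gamma^{(K+1)}\equiv0$, then $$G_q(R)\ge cR^{-\sigma_K(q)},\quad 2<q\le\infty,$$ $$G_q(R)\ge cR^{-\sigma_K(q)}\log^{1/q}(R),\quad q\in\{q_k: k=2,\dots,K\}.$$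
   Context: For $\gamma$ and $\chi$ let $\widehat\mu(\xi)=\int e^{-i\langle\xi,\gamma(t)\rangle}\chi(t)\,dt$ for $\xi\in\mathbb{R}^d$, the Fourier transform of the measure $\mu$ given by $\langle\mu,f\rangle=\int f(\gamma(t))\chi(t)\,dt$. Put $$G_q(R)=\Big(\int_{S^{d-1}}|\widehat\mu(R\omega)|^q\,d\omega\Big)^{1/q},$$ where $d\omega$ is the rotation invariant measure on $S^{d-1}$ induced by Lebesgue measure in $\mathbb{R}^d$, and $G_\infty(R)=\max_{\omega\in S^{d-1}}|\widehat\mu(R\omega)|$ (so $G_q(R)$ depends on $\chi$). For integers $k\ge1$ set $q_k=\frac{k^2+k+2}{2}$ (so $q_1=2$, $q_2=4$, $q_3=7$, $q_4=11$). For $1\le q\le\infty$ define $$\sigma_K(q)\equiv\sigma_K^d(q)=\begin{cases}\displaystyle\min_{k=2,\dots,d}\Big\{\frac1k+\frac{k^2-k-2}{2kq}\Big\}, & K=d,\\[2mm] \displaystyle\min\Big\{\frac Kq,\ \min_{k=2,\dots,K}\Big(\frac1k+\frac{k^2-k-2}{2kq}\Big)\Big\}, & 2\le K<d,\end{cases}$$ with $1/q=0$ when $q=\infty$. *)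

(* Defs.v *)
From HB Require Import structures.
From mathcomp Require Import all_boot all_order all_algebra.
From mathcomp Require Import complex.
From mathcomp Require Import all_classical all_reals all_analysis.
From mathcomp Require Import measurable_realfun.

Set Implicit Arguments.
Unset Strict Implicit.
Unset Printing Implicit Defensive.

Import Order.TTheory GRing.Theory Num.Theory.
Import numFieldNormedType.Exports.

Local Open Scope classical_set_scope.
Local Open Scope ring_scope.
Local Open Scope complex_scope.

(* Points of R^n are n-tuples: MathComp-Analysis equips tuples, but not row
   vectors, with the product (i.e. Borel) sigma-algebra. *)

Section euclidean_space.
Context {R : realType} {n : nat}.
Implicit Types x y : n.-tuple R.

Definition dotp x y : R := \sum_(i < n) tnth x i * tnth y i.

Definition enorm x : R := Num.sqrt (dotp x x).

Definition escale (r : R) x : n.-tuple R := [tuple r * tnth x i | i < n].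

Definition unitize x : n.-tuple R := escale (enorm x)^-1 x.

Lemma measurable_enorm : measurable_fun [set: n.-tuple R] enorm.
Proof.
apply: (@measurableT_comp _ _ _ _ _ _ (@Num.sqrt R)).
  by apply: continuous_measurable_fun; exact: sqrt_continuous.
by apply: measurable_sum => i; apply: measurable_funM; exact: measurable_tnth.
Qed.

Lemma measurable_unitize : measurable_fun [set: n.-tuple R] unitize.
Proof.
apply/measurable_fun_tnthP => i.
rewrite (_ : _ \o _ = (fun x => powR (enorm x) (-1) * tnth x i)).
  apply: measurable_funM; last exact: measurable_tnth.
  apply: (@measurableT_comp _ _ _ _ _ _ (@powR R ^~ (-1))) => //.
  exact: measurable_enorm.
apply/funext => x /=.
by rewrite tnth_mktuple powRN powRr1 // sqrtr_ge0.
Qed.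

End euclidean_space.

Definition usphere (R : realType) (n : nat) : set (n.-tuple R) :=
  [set x | enorm x = 1].

Definition unit_ball0 (R : realType) (n : nat) : set (n.-tuple R) :=
  [set x | 0 < enorm x <= 1].

Lemma measurable_unit_ball0 (R : realType) (n : nat) :
  measurable (@unit_ball0 R n).
Proof.
have -> : @unit_ball0 R n = setT `&` enorm @^-1` `]0, 1].
  by rewrite setTI; apply/seteqP; split => x /=; rewrite /unit_ball0 /= in_itv.
by apply: measurable_enorm => //; exact: measurable_itv.
Qed.

Section lebesgue_cons.
Local Open Scope ereal_scope.
Context {R : realType} {n : nat}.

Definition tuple_cons (p : R * n.-tuple R) : n.+1.-tuple R :=
  [tuple of p.1 :: p.2].

Lemma measurable_tuple_cons : measurable_fun [set: R * n.-tuple R] tuple_cons.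
Proof. exact: measurable_cons. Qed.

Variable m : {sigma_finite_measure set (n.-tuple R) -> \bar R}.

Definition lebesgue_cons : set (n.+1.-tuple R) -> \bar R :=
  pushforward (lebesgue_measure \x m) tuple_cons.

Let mpreim (A : set (n.+1.-tuple R)) :
  measurable A -> measurable (tuple_cons @^-1` A).
Proof. by move=> mA; rewrite -[X in measurable X]setTI; exact: measurable_tuple_cons. Qed.

Let lebesgue_cons0 : lebesgue_cons set0 = 0.
Proof. by rewrite /lebesgue_cons /pushforward preimage_set0 measure0. Qed.

Let lebesgue_cons_ge0 A : 0 <= lebesgue_cons A.
Proof. by rewrite /lebesgue_cons /pushforward; exact: measure_ge0. Qed.

Let lebesgue_cons_sigma_additive : semi_sigma_additive lebesgue_cons.
Proof.
move=> F mF tF mUF; rewrite /lebesgue_cons /pushforward preimage_bigcup.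
apply: measure_semi_sigma_additive.
- by move=> k; exact: mpreim.
- apply/trivIsetP => /= i j _ _ ij; rewrite -preimage_setI.
  by move/trivIsetP : tF => /(_ _ _ _ _ ij) ->//; rewrite preimage_set0.
- by rewrite -preimage_bigcup; exact: mpreim.
Qed.

HB.instance Definition _ := isMeasure.Build _ _ _ lebesgue_cons
  lebesgue_cons0 lebesgue_cons_ge0 lebesgue_cons_sigma_additive.

Let lebesgue_cons_sigma_finite : sigma_finite setT lebesgue_cons.
Proof.
(* The library's SigmaFiniteMeasure instance on \x only fires for
   subprobabilities. *)
have [F [FT Foo]] : exists F : (set (R * n.-tuple R))^nat,
    setT = \bigcup_k F k /\
    forall k, measurable (F k) /\ (lebesgue_measure \x m) (F k) < +oo.
  have /sigma_finiteP[A [AT Ah Aoo]] := sigma_finiteT (@lebesgue_measure R).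
  have /sigma_finiteP[B [BT Bh Boo]] := sigma_finiteT m.
  exists (fun k => A k `*` B k); split.
    rewrite -setXTT AT BT predeqE => -[x y]; split.
      move=> [/= [i _ Aix] [j _ Bjy]]; exists (maxn i j) => //; split.
      - by move: x Aix; exact/subsetPset/Ah/leq_maxl.
      - by move: y Bjy; exact/subsetPset/Bh/leq_maxr.
    by move=> [i _ []/= ? ?]; split; exists i.
  move=> k; have [? ?] := Aoo k; have [? ?] := Boo k.
  split; first exact: measurableX.
  by rewrite product_measure1E// lte_mul_pinfty// ge0_fin_numE.
pose u (x : n.+1.-tuple R) := (thead x, [tuple of behead x]).
have uK p : u (tuple_cons p) = p.
  by case: p => p1 p2; rewrite /u theadE; congr pair; exact: val_inj.
have mu : measurable_fun setT u.
  apply: measurable_fun_pair; first exact: measurable_tnth.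
  exact: measurable_behead.
exists (fun k => u @^-1` F k).
  by rewrite -preimage_bigcup -FT preimage_setT.
move=> k; have [mFk Fkoo] := Foo k; split.
  by rewrite -[X in measurable X]setTI; exact: mu.
rewrite /lebesgue_cons /pushforward.
rewrite (_ : tuple_cons @^-1` _ = F k)//.
by apply/seteqP; split => p; rewrite /= uK.
Qed.

HB.instance Definition _ := Measure_isSigmaFinite.Build _ _ _ lebesgue_cons
  lebesgue_cons_sigma_finite.

End lebesgue_cons.

Fixpoint lebesgue_tuple (R : realType) (n : nat) :
    {sigma_finite_measure set (n.-tuple R) -> \bar R} :=
  match n with
  | 0 => @dirac _ _ [tuple] R
  | k.+1 => lebesgue_cons (lebesgue_tuple R k)
  end.

(* Surface measure of S^(n-1), as a Borel measure on R^n carried by the sphere: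
   n times the Lebesgue measure of the truncated cone
   {x | 0 < |x| <= 1, x / |x| \in A} over A (polar coordinates). *)
Section sphere_measure.
Local Open Scope ereal_scope.
Context (R : realType) (n : nat).

Definition sphere_measure (A : set (n.-tuple R)) : \bar R :=
  n%:R%:E * lebesgue_tuple R n (unitize @^-1` A `&` @unit_ball0 R n).

Let mcone (A : set (n.-tuple R)) :
  measurable A -> measurable (unitize @^-1` A `&` @unit_ball0 R n).
Proof.
move=> mA; apply: measurableI; last exact: measurable_unit_ball0.
by rewrite -[X in measurable X]setTI; exact: measurable_unitize.
Qed.

Let sphere_measure0 : sphere_measure set0 = 0.
Proof. by rewrite /sphere_measure preimage_set0 set0I measure0 mule0. Qed.

Let sphere_measure_ge0 A : 0 <= sphere_measure A.
Proof. by rewrite /sphere_measure mule_ge0// lee_fin ler0n. Qed.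

Let sphere_measure_sigma_additive : semi_sigma_additive sphere_measure.
Proof.
move=> F mF tF mUF; rewrite [X in X @ _ --> _](_ : _ = (fun k => n%:R%:E *
    \sum_(0 <= i < k) lebesgue_tuple R n (unitize @^-1` F i `&` @unit_ball0 R n))).
  apply: cvgeZl => //; rewrite preimage_bigcup setI_bigcupl.
  apply: measure_semi_sigma_additive.
  - by move=> k; exact: mcone.
  - apply/trivIsetP => i j _ _ ij; rewrite setIACA -preimage_setI.
    by move/trivIsetP : tF => /(_ _ _ _ _ ij) ->//; rewrite preimage_set0 set0I.
  - by rewrite -setI_bigcupl -preimage_bigcup; exact: mcone.
by apply/funext => k; rewrite ge0_sume_distrr.
Qed.

HB.instance Definition _ := isMeasure.Build _ _ _ sphere_measure
  sphere_measure0 sphere_measure_ge0 sphere_measure_sigma_additive.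

End sphere_measure.

Section smoothness.
Context {R : realType}.

(* Derivative at t relative to A: one-sided at the endpoints when A is a compact
   interval. *)
Definition diff_quotient (f : R -> R) (t s : R) : R := (f s - f t) / (s - t).

Definition derive_within (A : set R) (f : R -> R) (t : R) : R :=
  lim (diff_quotient f t @ within A t^').

Definition deriven_within (A : set R) (k : nat) (f : R -> R) : R -> R :=
  iter k (derive_within A) f.

Definition smooth_within (A : set R) (f : R -> R) : Prop :=
  forall (k : nat) (t : R), A t ->
    cvg (diff_quotient (deriven_within A k f) t @ within A t^').

Definition smooth (f : R -> R) : Prop :=
  forall (k : nat) (t : R), derivable (derive1n k f) t 1.

Definition supp (f : R -> R) : set R := closure [set t | f t != 0].

Definition curve_deriven (n : nat) (A : set R) (k : nat)
    (gamma : R -> n.-tuple R) (t : R) : 'rV[R]_n :=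
  \row_i deriven_within A k (fun s => tnth (gamma s) i) t.

Definition smooth_curve (n : nat) (A : set R) (gamma : R -> n.-tuple R) : Prop :=
  forall i : 'I_n, smooth_within A (fun s => tnth (gamma s) i).

Definition immersed_curve (n : nat) (A : set R) (gamma : R -> n.-tuple R) : Prop :=
  smooth_curve A gamma /\ forall t, A t -> curve_deriven A 1 gamma t != 0.

End smoothness.

Section fourier.
Context {R : realType}.

Definition expiN (x : R) : R[i] := cos x -i* sin x.

Definition Cintegral (A : set R) (f : R -> R[i]) : R[i] :=
  (\int[lebesgue_measure]_(t in A) complex.Re (f t))
  +i* (\int[lebesgue_measure]_(t in A) complex.Im (f t)).

Definition mu_hat (n : nat) (A : set R) (gamma : R -> n.-tuple R) (chi : R -> R)
    (xi : n.-tuple R) : R[i] :=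
  Cintegral A (fun t => expiN (dotp xi (gamma t)) * (chi t)%:C).

Definition Gq (n : nat) (A : set R) (gamma : R -> n.-tuple R) (chi : R -> R)
    (q : \bar R) (r : R) : \bar R :=
  let F (w : n.-tuple R) := Normc.normc (mu_hat A gamma chi (escale r w)) in
  match q with
  | p%:E => poweR (\int[@sphere_measure R n]_(w in @usphere R n)
                     (powR (F w) p)%:E)%E p^-1
  | _ => ereal_sup [set (F w)%:E | w in @usphere R n]
  end.

End fourier.

Section exponents.
Context {R : realType}.

Definition q_ (k : nat) : R := (k%:R ^+ 2 + k%:R + 2) / 2.

Definition sigma_term (q : \bar R) (k : nat) : R :=
  1 / k%:R + (k%:R ^+ 2 - k%:R - 2) / (2 * k%:R) * fine (q^-1)%E.

(* The unit of the iterated minimum is one of the terms, so this is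
   min_{k=2..K} for K >= 2. *)
Definition min_sigma_term (K : nat) (q : \bar R) : R :=
  \big[Num.min/sigma_term q 2]_(2 <= k < K.+1) sigma_term q k.

Definition sigma (d K : nat) (q : \bar R) : R :=
  if K == d then min_sigma_term d q
  else Num.min (K%:R * fine (q^-1)%E) (min_sigma_term K q).

End exponents.

(* Main.v *)
(* Directions are averaged rather than estimated one by one.  For [x] near a
   suitable center put [y_j = <x, gamma^(j)(tau)>].  On the slab
   [|y_j| <= 2 / (R h^j)] for [0 < j < k], [y_k ~ 1 / (R h^k)], the phase
   [R <x / |x|, gamma(t) - gamma(tau)>] is nearly constant for [|t - tau| <~ h].
   Move [x] by [s e / (R h)], [|s| <= 1], where [<e, gamma'(tau)> = 1] and [e] is
   orthogonal to the next derivatives, and average against the Fejer weight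
   [1 - |s|]: the times [|t - tau| <~ h] then contribute at least [c h], while two
   integrations by parts in [s] make all the other times negligible.  Jensen's
   inequality and translation invariance turn this into
   [int_slab |mu_hat|^q >= (c h)^q |slab|].  The slabs at about [1 / h] points
   [tau], spaced by [C h], are disjoint, so the scale [h] contributes
   [c h^(q - q_k) R^(-k)] in total.  The scale [h ~ R^(-1/k)] gives the [k]-th term
   of [sigma].  At [q = q_k] the 4-adic scales between [R^(-1/k)] and
   [R^(-1/(k+1))] contribute equally, and when [y_(k+1) ~ 1] their slabs are
   disjoint too: this is the logarithm.  If [gamma^(K+1) = 0], a vector orthogonal
   to all the derivatives allows every scale from [R^(-1/K)] up to a constant, which
   gives the exponent [K/q] and the logarithm at [q_K]. *)
Require Import Defs.
From HB Require Import structures.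
From mathcomp Require Import all_boot all_order all_algebra.
From mathcomp Require Import complex ring lra.
From mathcomp Require Import all_classical all_reals all_analysis.
From mathcomp Require Import measurable_realfun.

Set Implicit Arguments.
Unset Strict Implicit.
Unset Printing Implicit Defensive.

Import Order.TTheory GRing.Theory Num.Theory.
Import numFieldNormedType.Exports.

Local Open Scope classical_set_scope.
Local Open Scope ring_scope.

(** * One-dimensional oscillatory integrals *)

(** The estimates live in the unit ball rather than on the sphere: the integrand depends on
    [x / |x|] only, Lebesgue measure is translation invariant, and a segment in [x] projects to an
    arc of a great circle. The price is the phase [(phi + s xi) / |x + s e|] instead of a linear
    one; this is why [|x|^2 >= m] and a small step are imposed throughout. Each half of the average
    in [s] has a boundary term of size [1 / xi]; the two are opposite, and what remains is
    [O(1 / xi^2)] with [xi] of size [(t - tau) / h], hence summable over times and small against the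
    main contribution [c h]. The exponent [q_k] is [1 + (1 + ... + k)]: a slab has volume about
    [prod_j 1 / (R h^j)], there are about [1 / h] slabs, and each carries [h^q]. A scale is
    admissible when [y_k <~ 1] and [y_(k+1) <~ 1 / (R h^(k+1))]. The first condition gives the lower
    end [R^(-1/k)], where the boundedness of [y_(k+1)] suffices; the second gives the upper end
    [R^(-1/(k+1))]. One [chi] is fixed before [k], [q] and [R], so finitely many bounds can be
    merged by taking minima of their constants. *)

Section derivative_rules.
Context {R : realType}.
Implicit Types (f g : R -> R) (x k df dg : R).

(** The existential lets the tactic [der] compute a derivative in whatever shape it produces; [ring]
    or [field] then matches it with the expected one. *)
Lemma der_eq f x df : (exists2 df', is_derive x 1 f df' & df' = df) ->
  is_derive x 1 f df.
Proof. by move=> [? ? <-]. Qed.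

Lemma der_cst k x : is_derive x 1 (fun=> k) 0.
Proof. exact: is_derive_cst. Qed.

Lemma der_id x : is_derive x 1 (fun y : R => y) 1.
Proof. exact: is_derive_id. Qed.

Lemma der_add f g x df dg : is_derive x 1 f df -> is_derive x 1 g dg ->
  is_derive x 1 (fun y => f y + g y) (df + dg).
Proof. by move=> ? ?; exact: is_deriveD. Qed.

Lemma der_opp f x df : is_derive x 1 f df ->
  is_derive x 1 (fun y => - f y) (- df).
Proof. by move=> ?; exact: is_deriveN. Qed.

Lemma der_mul f g x df dg : is_derive x 1 f df -> is_derive x 1 g dg ->
  is_derive x 1 (fun y => f y * g y) (f x * dg + g x * df).
Proof. by move=> ? ?; exact: is_deriveM. Qed.

Lemma der_exp f x df n : is_derive x 1 f df ->
  is_derive x 1 (fun y => f y ^+ n) (n%:R * f x ^+ n.-1 * df).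
Proof.
move=> fx; elim: n => [|n IH].
  by rewrite !mul0r; apply: der_cst.
have -> : (fun y => f y ^+ n.+1) = fun y => f y * f y ^+ n.
  by apply/funext => y; rewrite exprS.
apply: der_eq; eexists; first exact: (der_mul fx IH).
case: n {IH} => [|n]; first by rewrite !expr0; ring.
by rewrite -[n.+2%:R]natr1 /= exprS; ring.
Qed.

Lemma der_inv f x df : f x != 0 -> is_derive x 1 f df ->
  is_derive x 1 (fun y => (f y)^-1) (- df / f x ^+ 2).
Proof.
move=> fx0 fx; have := is_deriveV fx0 fx.
by rewrite /GRing.scale/= mulNr mulrC mulNr.
Qed.

Lemma der_comp (h : R -> R) f x dh df : is_derive (f x) 1 h dh ->
  is_derive x 1 f df -> is_derive x 1 (fun y => h (f y)) (dh * df).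
Proof. by move=> ? ?; exact: is_derive1_comp. Qed.

End derivative_rules.

Ltac der := lazymatch goal with
 | H : is_derive _ _ ?f _ |- is_derive _ _ ?f _ => exact H
 | |- is_derive _ _ (fun y => y) _ => exact: der_id
 | |- is_derive _ _ (fun _ => ?k) _ => exact: der_cst
 | |- is_derive _ _ (fun y => @?f y + @?g y) _ => eapply (@der_add _ f g); der
 | |- is_derive _ _ (fun y => - @?f y) _ => eapply (@der_opp _ f); der
 | |- is_derive _ _ (fun y => @?f y * @?g y) _ => eapply (@der_mul _ f g); der
 | |- is_derive _ _ (fun y => @?f y ^+ ?n) _ => eapply (@der_exp _ f); der
 | |- is_derive _ _ (fun y => (@?f y)^-1) _ => eapply (@der_inv _ f); [|der]
 | |- is_derive _ _ (fun y => cos (@?f y)) _ => eapply (@der_comp _ cos f); [exact: is_derive_cos|der]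
 | |- is_derive _ _ (fun y => sin (@?f y)) _ => eapply (@der_comp _ sin f); [exact: is_derive_sin|der]
 | H : is_derive _ _ ?f _ |- is_derive _ _ (fun y => ?f y) _ => exact H
 | _ => idtac
 end.
Section oscillation.
Context {R : realType}.
Implicit Types (a b s x : R) (f g p r : R -> R).

Lemma derive_continuous f x df : is_derive x 1 f df -> {for x, continuous f}.
Proof. by move=> fx; apply/differentiable_continuous/derivable1_diffP. Qed.

Lemma ivl_ball a b x : a < x < b -> \forall y \near x, a < y < b.
Proof.
move=> /andP[ax xb]; near=> y; apply/andP; split; near: y.
- exact: lt_nbhsr.
- exact: lt_nbhsl.
Unshelve. all: by end_near. Qed.

Lemma derive_continuous_within f df a b :
  (forall x, a <= x <= b -> is_derive x 1 f (df x)) ->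
  {within `[a, b], continuous f}.
Proof.
move=> fd; apply: continuous_in_subspaceT => x.
by rewrite inE/= in_itv/= => /fd; exact: derive_continuous.
Qed.

(** The mean value theorem is applied to [G - H], where [G] is the primitive of [f]. Comparing
    primitives avoids integrating [h], whose measurability would otherwise have to be
    established. *)
Lemma Rintegral_approx f (H h : R -> R) a b (e : R) : a < b ->
  {within `[a, b], continuous f} ->
  (forall x, a <= x <= b -> is_derive x 1 H (h x)) ->
  (forall x, a <= x <= b -> `|f x - h x| <= e) ->
  `|\int[lebesgue_measure]_(x in `[a, b]) f x - (H b - H a)| <= e * (b - a).
Proof.
move=> ab cf Hh fh.
have intf : lebesgue_measure.-integrable `[a, b] (EFin \o f).
  by apply: continuous_compact_integrable => //; exact: segment_compact.
pose G x := (\int[lebesgue_measure]_(t in `[a, x]) f t)%R.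
have cG : {within `[a, b], continuous G}.
  exact: parameterized_integral_continuous (ltW ab) intf.
have dG x : x \in `]a, b[ -> is_derive x 1 G (f x).
  move=> xab; have := xab; rewrite in_itv/= => /andP[ax xb].
  have cfx : {for x, continuous f}.
    by move: xab; apply/within_continuous_continuous.
  have [dG G'] := continuous_FTC1_closed xb intf ax cfx.
  by rewrite -G' derive1E; exact: derivableP.
have [||c cab] := @MVT R (G - H) (f - h) a b ab.
- move=> x xab; apply: is_deriveB; first exact: dG.
  by apply: Hh; move: xab; rewrite in_itv/= => /andP[? ?]; rewrite !ltW.
- move=> x; apply: continuousB; first exact: cG.
  exact: (derive_continuous_within Hh).
have Ga : G a = 0 by rewrite /G set_itv1 Rintegral_set1.
rewrite !fctE Ga sub0r opprK => E.
rewrite (_ : _ - _ = (f c - h c) * (b - a)); last by rewrite -E /G; ring.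
rewrite normrM (gtr0_norm (_ : 0 < b - a)) ?subr_gt0//.
rewrite ler_wpM2r ?subr_ge0 ?(ltW ab)// fh//.
by move: cab; rewrite in_itv/= => /andP[? ?]; rewrite !ltW.
Qed.

Lemma Rintegral_FTC f (H : R -> R) a b : a < b ->
  {within `[a, b], continuous f} ->
  (forall x, a <= x <= b -> is_derive x 1 H (f x)) ->
  \int[lebesgue_measure]_(x in `[a, b]) f x = H b - H a.
Proof.
move=> ab cf Hf; apply/eqP; rewrite -subr_eq0 -normr_le0.
rewrite -[leRHS](mul0r (b - a)); apply: (Rintegral_approx ab cf Hf) => x _.
by rewrite subrr normr0.
Qed.

Lemma continuous_within_cos p (p' : R -> R) a b :
  (forall x, a <= x <= b -> is_derive x 1 p (p' x)) ->
  {within `[a, b], continuous (fun s => (1 - s) * cos (p s))}.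
Proof.
move=> dp; apply: (@derive_continuous_within _
  (fun s => - cos (p s) - (1 - s) * (sin (p s) * p' s))) => s sab.
have ds := dp _ sab.
by apply: der_eq; eexists; [der|ring].
Qed.

(* Two integrations by parts against [1 - s], the boundary term of order
   [1 / p'] at [0] being kept: it cancels between [p s] and [p (- s)]. *)
Lemma oscillation_bound p (p' : R -> R) r (r' r'' : R -> R) (rho : R) :
  (forall s, 0 <= s <= 1 -> is_derive s 1 p (p' s)) ->
  (forall s, 0 <= s <= 1 -> is_derive s 1 r (r' s)) ->
  (forall s, 0 <= s <= 1 -> is_derive s 1 r' (r'' s)) ->
  (forall s, 0 <= s <= 1 -> r s * p' s = 1) ->
  (forall s, 0 <= s <= 1 -> [/\ `|r s| <= rho, `|r' s| <= rho & `|r'' s| <= rho]) ->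
  `|\int[lebesgue_measure]_(s in `[0, 1]) ((1 - s) * cos (p s)) + r 0 * sin (p 0)|
    <= 8 * rho ^+ 2.
Proof.
move=> dp dr dr' rp rb.
pose q s := (1 - s) * r' s - r s.
(* With [r = 1 / p'], this is the primitive produced by two integrations by parts. Its derivative is
   [(1 - s) * cos (p s)] plus terms quadratic in [r] and its derivatives. *)
pose H s := (1 - s) * r s * sin (p s) + q s * r s * cos (p s).
pose q' s := (1 - s) * r'' s - 2 * r' s.
pose h s := (1 - s) * cos (p s) + (q' s * r s + q s * r' s) * cos (p s).
have H' s : 0 <= s <= 1 -> is_derive s 1 H (h s).
  move=> s01; have := dp _ s01; have := dr _ s01; have := dr' _ s01 => d1 d2 d3.
  have dq : is_derive s 1 q (q' s).
    by apply: der_eq; eexists; [rewrite /q; der|rewrite /q'; ring].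
  apply: der_eq; eexists; [rewrite /H; der|].
  have rp1 := rp _ s01.
  have rpc : r s * p' s * sin (p s) = sin (p s) by rewrite rp1 mul1r.
  have rpcc : r s * p' s * cos (p s) = cos (p s) by rewrite rp1 mul1r.
  rewrite /h /q' /q.
  transitivity ((1 - s) * (r s * p' s * cos (p s)) +
    ((1 - s) * r' s - r s) * (sin (p s) - r s * p' s * sin (p s)) +
    (((1 - s) * r'' s - 2 * r' s) * r s + ((1 - s) * r' s - r s) * r' s) * cos (p s)).
    by ring.
  by rewrite rpc rpcc; ring.
have rho0 : 0 <= rho.
  have [|r0 _ _] := rb 0; first by rewrite lexx ler01.
  exact: le_trans r0.
have M (x y : R) : `|x| <= rho -> `|y| <= rho -> `|x * y| <= rho ^+ 2.
  by move=> *; rewrite normrM expr2 ler_pM.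
have S2 (k x y : R) : `|k| <= 1 -> `|x| <= y -> `|k * x| <= y.
  by move=> k1 xy; rewrite normrM (le_trans _ xy)// ler_piMl.
have C (k x y : R) : `|x| <= y -> `|x * cos k| <= y.
  by move=> xy; rewrite mulrC; apply: S2 => //; rewrite ler_norml cos_geN1 cos_le1.
have := @Rintegral_approx (fun s => (1 - s) * cos (p s)) H h 0 1 (5 * rho ^+ 2)
  ltr01 (continuous_within_cos dp) H'.
have E s : 0 <= s <= 1 -> `|(1 - s) * cos (p s) - h s| <= 5 * rho ^+ 2.
  move=> s01; rewrite /h opprD addrA subrr sub0r normrN.
  apply: C; have [r0 r1 r2] := rb _ s01.
  have s1 : `|1 - s| <= 1 by rewrite ler_norml; lra.
  rewrite /q' /q (_ : _ + _ = (1 - s) * (r'' s * r s) - 3 * (r' s * r s)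
    + (1 - s) * (r' s * r' s)); last by ring.
  have /ler_normlP[? ?] := S2 _ _ _ s1 (M _ _ r2 r0).
  have /ler_normlP[? ?] := S2 _ _ _ s1 (M _ _ r1 r1).
  have /ler_normlP[? ?] := M _ _ r1 r0.
  by rewrite ler_norml; lra.
move=> /(_ E); rewrite subr0 mulr1.
set I := (\int[_]_(_ in _) _)%R.
(* The three boundary products are at most [rho ^+ 2] each; with the 5 of the remainder they make up
   the constant 8. *)
have -> : H 1 - H 0 = - (r 1 * r 1 * cos (p 1)) - r 0 * sin (p 0)
   - (r' 0 * r 0 * cos (p 0) - r 0 * r 0 * cos (p 0)).
  by rewrite /H /q subrr subr0; ring.
have [|r0 r1 r2] := rb 0; first by rewrite lexx ler01.
have [|r3 _ _] := rb 1; first by rewrite lexx ler01.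
have /ler_normlP[? ?] := C (p 1) _ _ (M _ _ r3 r3).
have /ler_normlP[? ?] := C (p 0) _ _ (M _ _ r0 r0).
have /ler_normlP[? ?] := C (p 0) _ _ (M _ _ r1 r0).
by move=> /ler_normlP[? ?]; rewrite ler_norml; lra.
Qed.


Lemma normr_sin_le x : `|sin x| <= `|x|.
Proof.
wlog x0 : x / 0 <= x => [H|].
  have [/H//|/ltW x0] := leP 0 x.
  by rewrite -(normrN (sin x)) -sinN -(normrN x); apply: H; rewrite oppr_ge0.
have [|c _] := @MVT_segment R sin cos 0 x x0.
- by apply: continuous_subspaceT; exact: continuous_sin.
- rewrite sin0 !subr0 => ->; rewrite normrM ler_piMl//.
  by rewrite ler_norml cos_geN1 cos_le1.
Qed.

Lemma cos_ge x : 1 - x ^+ 2 / 2 <= cos x.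
Proof.
have -> : cos x = 1 - 2 * sin (x / 2) ^+ 2.
  by rewrite [in LHS](splitr x) cosD -!expr2 cos2sin2; ring.
have : sin (x / 2) ^+ 2 <= (x / 2) ^+ 2.
  rewrite -[leLHS]real_normK ?num_real// -[leRHS]real_normK ?num_real//.
  by rewrite lerXn2r ?nnegrE// normr_sin_le.
rewrite exprMn (_ : 2^-1 ^+ 2 = 4^-1 :> R); last by field.
lra.
Qed.

Lemma cosB_le x y : `|cos x - cos y| <= `|x - y|.
Proof.
wlog xy : x y / y <= x => [H|].
  have [/H//|/ltW xy] := leP y x.
  by rewrite distrC (distrC x); exact: H.
have [|c _] := @MVT_segment R cos (fun x => - sin x) y x xy.
- by apply: continuous_subspaceT; exact: continuous_cos.
- move=> ->; rewrite normrM ler_piMl// normrN.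
  by rewrite ler_norml sin_geN1 sin_le1.
Qed.

Lemma linear_phase_integral (xi : R) : xi != 0 ->
  \int[lebesgue_measure]_(s in `[0, 1]) ((1 - s) * cos (xi * s))
  = (1 - cos xi) / xi ^+ 2.
Proof.
move=> xi0.
have dp (s : R) : 0 <= s <= 1 -> is_derive s 1 (fun s => xi * s) xi.
  by move=> _; apply: der_eq; eexists; [der|ring].
pose H s := (1 - s) * sin (xi * s) / xi - cos (xi * s) / xi ^+ 2.
have dH s : 0 <= s <= 1 -> is_derive s 1 H ((1 - s) * cos (xi * s)).
  by move=> s01; apply: der_eq; eexists; [rewrite /H; der|field].
rewrite (Rintegral_FTC ltr01 (continuous_within_cos dp) dH) /H.
by rewrite subrr !mul0r mulr0 mulr1 sin0 cos0; field.
Qed.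

End oscillation.

(** * Phases along great circles *)

Section great_circle.
Context {R : realType}.
Implicit Types (A b c n phi xi s : R).

(** With [A = |x|^2], [b = <x, e>] and [c = |e|^2] this is [|x + s e|^2]. Accordingly [arc_phase] is
    a linear phase divided by the norm, as seen by the normalized point. *)
Definition quad A b c s : R := A + 2 * b * s + c * (s * s).

Definition arc_phase A b c phi xi s : R := (phi + s * xi) / Num.sqrt (quad A b c s).

Lemma quadN A b c s : quad A b c (- s) = quad A (- b) c s.
Proof. by rewrite /quad; ring. Qed.

Lemma arc_phaseN A b c phi xi s :
  arc_phase A b c phi xi (- s) = arc_phase A (- b) c phi (- xi) s.
Proof. by rewrite /arc_phase quadN; congr (_ / _); ring. Qed.

Lemma is_derive_quad A b c s : is_derive s 1 (quad A b c) (2 * (b + c * s)).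
Proof. by apply: der_eq; eexists; [rewrite /quad; der|ring]. Qed.

Lemma is_derive_sqrt_quad A b c s : 0 < quad A b c s ->
  is_derive s 1 (fun s => Num.sqrt (quad A b c s))
    ((b + c * s) / Num.sqrt (quad A b c s)).
Proof.
move=> D0; have dq := is_derive_quad A b c s.
apply: der_eq; eexists.
  apply: (@der_comp _ Num.sqrt (quad A b c)) => //.
  exact: (is_derive1_sqrt D0).
by rewrite /=; field; rewrite gt_eqF// sqrtr_gt0.
Qed.

(* The derivative of the phase along a great circle is [m / D^(3/2)], with [m]
   affine in [s]. *)
Lemma is_derive_arc_phase A b c phi xi s : 0 < quad A b c s ->
  is_derive s 1 (arc_phase A b c phi xi)
   ((xi * quad A b c s - (phi + s * xi) * (b + c * s))
     / (quad A b c s * Num.sqrt (quad A b c s))).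
Proof.
move=> D0; have dq := is_derive_sqrt_quad D0.
have S0 : Num.sqrt (quad A b c s) != 0 by rewrite gt_eqF// sqrtr_gt0.
have SS : Num.sqrt (quad A b c s) ^+ 2 = quad A b c s by rewrite sqr_sqrtr ?ltW.
apply: der_eq; eexists; [rewrite /arc_phase; der; exact: S0|].
move: SS S0; set S := Num.sqrt _; set D := quad A b c s => SS S0.
by rewrite -SS; field; rewrite S0.
Qed.

(** The smallness conditions keep the affine numerator [m] of the phase derivative above
    [mu = |xi| n / 2], and its slope below [mu / 2]. Hence [1 / p'] and its first two derivatives
    are at most [2 / mu], and [oscillation_bound] gives [8 * (2 / mu)^2 = 128 / (xi^2 n^2)]. *)
Lemma arc_oscillation_half A b c n phi xi : 0 < n <= 1 -> xi != 0 ->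
  (forall s, 0 <= s <= 1 -> n <= quad A b c s <= 1) ->
  0 <= c -> `|b| + c <= n / 8 -> `|phi| * (`|b| + c) <= `|xi| * n / 8 ->
  `|\int[lebesgue_measure]_(s in `[0, 1]) ((1 - s) * cos (arc_phase A b c phi xi s))
    + A * Num.sqrt A / (xi * A - phi * b) * sin (phi / Num.sqrt A)|
    <= 128 / (xi ^+ 2 * n ^+ 2).
Proof.
move=> /andP[n0 n1] xi0 nD c0 bc phibc.
pose D := quad A b c; pose m s := xi * D s - (phi + s * xi) * (b + c * s).
pose m' := xi * b - phi * c; pose S s := Num.sqrt (D s).
(* The reciprocal of the phase derivative; [r'] and [r''] are its derivatives, simplified by
   [S^2 = D] and by the fact that [m] is affine. *)
pose r s := D s * S s / m s.
pose r' s := 3 * S s * (b + c * s) / m s - D s * S s * m' / (m s * m s).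
pose r'' s := 3 * ((b + c * s) * ((b + c * s) / S s) + S s * c) / m s
  - 6 * S s * (b + c * s) * m' / m s ^+ 2 + 2 * D s * S s * m' ^+ 2 / m s ^+ 3.
have D0 s : 0 <= s <= 1 -> 0 < D s.
  by move=> /nD /andP[+ _]; exact: lt_le_trans.
have S0 s : 0 <= s <= 1 -> 0 < S s by move=> /D0; rewrite sqrtr_gt0.
have SS s : 0 <= s <= 1 -> S s ^+ 2 = D s by move=> /D0/ltW D1; rewrite sqr_sqrtr.
pose mu := `|xi| * n / 2.
have mu0 : 0 < mu by rewrite /mu divr_gt0// mulr_gt0// normr_gt0.
have d1 s : 0 <= s <= 1 -> `|b + c * s| <= `|b| + c.
  move=> /andP[s0 s1]; rewrite (le_trans (ler_normD _ _))// lerD2l.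
  by rewrite normrM (ger0_norm c0) ger0_norm// ler_piMr.
have m_ge s : 0 <= s <= 1 -> mu <= `|m s|.
  move=> s01; have /andP[s0 s1] := s01; have /andP[Dn _] := nD _ s01.
  rewrite /m (le_trans _ (lerB_dist _ _))// normrM (gtr0_norm (D0 _ s01)).
  have : `|xi| * n <= `|xi| * D s by rewrite ler_wpM2l.
  have : `|(phi + s * xi) * (b + c * s)| <= `|phi| * (`|b| + c) + `|xi| * (n / 8).
    rewrite normrM (le_trans (ler_wpM2r _ (ler_normD _ _)))// mulrDl lerD//.
      by rewrite ler_wpM2l// d1.
    rewrite ler_pM//; last by rewrite (le_trans (d1 _ s01)).
    by rewrite normrM (ger0_norm s0) ler_piMl.
  have : 0 <= `|xi| * n by rewrite mulr_ge0// ltW.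
  by rewrite /mu; lra.
have m0 s : 0 <= s <= 1 -> m s != 0.
  by move=> /m_ge ms; rewrite -normr_gt0 (lt_le_trans mu0).
have m'_le : `|m'| <= mu / 2.
  rewrite /m' (le_trans (ler_normB _ _))// !normrM (ger0_norm c0).
  have : `|xi| * `|b| <= `|xi| * (n / 8).
    by rewrite ler_wpM2l//; lra.
  have : `|phi| * c <= `|phi| * (`|b| + c) by rewrite ler_wpM2l// lerDr.
  by rewrite /mu; lra.
have dD s : is_derive s 1 D (2 * (b + c * s)) := is_derive_quad A b c s.
have dm s : is_derive s 1 m m'.
  by have := dD s => ?; apply: der_eq; eexists; [rewrite /m; der|rewrite /m'; ring].
have dS s : 0 <= s <= 1 -> is_derive s 1 S ((b + c * s) / S s).
  by move=> /D0; exact: is_derive_sqrt_quad.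
have dr s : 0 <= s <= 1 -> is_derive s 1 r (r' s).
  move=> s01; have := dS _ s01; have := dD s; have := dm s => ? ? ?.
  apply: der_eq; eexists; [rewrite /r; der; exact: m0|].
  rewrite /r' -(SS _ s01).
  by field; rewrite m0// gt_eqF// S0.
have dr' s : 0 <= s <= 1 -> is_derive s 1 r' (r'' s).
  move=> s01; have := dS _ s01; have := dD s; have := dm s => ? ? ?.
  apply: der_eq; eexists.
    by rewrite /r'; der; rewrite ?mulf_neq0 ?m0.
  rewrite /r'' -(SS _ s01).
  by field; rewrite m0// gt_eqF// S0.
have := @oscillation_bound R (arc_phase A b c phi xi) (fun s => m s / (D s * S s))
  r r' r'' (2 / mu) _ dr dr' _ _.
rewrite /r /m /S /D /quad/= !(mulr0, mul0r, addr0, expr0n)/= /arc_phase /quad.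
rewrite !(mulr0, mul0r, addr0, expr0n)/=.
rewrite (_ : 8 * _ = 128 / (xi ^+ 2 * n ^+ 2)); last first.
  rewrite /mu !exprMn exprVn !exprMn real_normK ?num_real//.
  by field; rewrite xi0 gt_eqF.
apply.
- by move=> s s01; apply: is_derive_arc_phase; exact: D0.
- move=> s s01; have := m0 _ s01; have := S0 _ s01; have := D0 _ s01.
  rewrite /m /S /D /quad => D1 S1 m1.
  by field; rewrite ?m1 ?(gt_eqF S1) ?(gt_eqF D1).
- move=> s s01; rewrite -/(D s) -/(S s) -/(m s) -/(r s).
  have /andP[Dn D1] := nD _ s01; have ms0 := m0 _ s01.
  have Ds := D0 _ s01; have Ss := S0 _ s01.
  have S1 : S s <= 1 by rewrite -sqrtr1 ler_wsqrtr.
  have DS : S s ^+ 2 = D s by exact: SS.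
  have mV : `|(m s)^-1| <= mu^-1.
    by rewrite normfV lef_pV2 ?posrE// ?m_ge// normr_gt0.
  have mm : `|m' / m s| <= 1 / 2.
    rewrite normrM (le_trans (ler_pM _ _ m'_le mV))//.
    by rewrite (_ : mu / 2 / mu = 1 / 2)//; field; rewrite gt_eqF.
  have d2 := le_trans (d1 _ s01) bc.
  have n8 : n / 8 <= 1 / 8 by lra.
  have e1 : `|D s * S s| <= 1.
    by rewrite normrM mulr_ile1// gtr0_norm.
  have e2 : `|S s * (b + c * s)| <= 1 / 8.
    rewrite normrM (gtr0_norm Ss) -[leRHS]mul1r ler_pM ?(ltW Ss)//.
    exact: le_trans d2 n8.
  have e3 : `|(b + c * s) * ((b + c * s) / S s) + S s * c| <= 1 / 4.
    rewrite (le_trans (ler_normD _ _))//.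
    have : `|S s * c| <= 1 / 8.
      rewrite normrM (gtr0_norm Ss) (ger0_norm c0) -[leRHS]mul1r.
      rewrite ler_pM ?(ltW Ss)//; move: bc (normr_ge0 b); lra.
    have : `|(b + c * s) * ((b + c * s) / S s)| <= 1 / 8 * 1.
      rewrite normrM ler_pM//; first exact: le_trans n8.
      rewrite normrM normfV (gtr0_norm Ss) ler_pdivrMr// mul1r (le_trans d2)//.
      apply: (@le_trans _ _ (D s)); first by apply: le_trans Dn; lra.
      by rewrite -DS expr2 ler_piMl// ltW.
    lra.
  have K (x y : R) : `|x| <= y -> `|x * (m s)^-1| <= y * mu^-1.
    by move=> xy; rewrite normrM ler_pM.
  have mm2 : `|(m' / m s) ^+ 2| <= 1 / 4.
    rewrite normrX (_ : 1 / 4 = (1 / 2) ^+ 2); last by field.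
    by rewrite lerXn2r ?nnegrE.
  have mu1 : 0 < mu^-1 by rewrite invr_gt0.
  have P (x y u v : R) : `|x| <= u -> `|y| <= v -> `|x * y| <= u * v.
    by move=> *; rewrite normrM ler_pM.
  split.
  + by rewrite (le_trans (K _ _ e1))// ler_pM2r// ler1n.
  + rewrite /r' (_ : _ - _ = (3 * (S s * (b + c * s)) - D s * S s * (m' / m s)) / m s).
      apply: K; have /ler_normlP[? ?] := e2; have /ler_normlP[? ?] := P _ _ _ _ e1 mm.
      by rewrite ler_norml; lra.
    by field.
  + rewrite /r'' (_ : _ + _ = (3 * ((b + c * s) * ((b + c * s) / S s) + S s * c)
      - 6 * (S s * (b + c * s) * (m' / m s)) + 2 * (D s * S s * (m' / m s) ^+ 2)) / m s).
      apply: K; have /ler_normlP[? ?] := e3; have /ler_normlP[? ?] := P _ _ _ _ e2 mm.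
      have /ler_normlP[? ?] := P _ _ _ _ e1 mm2.
      by rewrite ler_norml; lra.
    by field; rewrite ms0 gt_eqF.
Qed.

(** Reflecting [s] changes the signs of [b] and [xi], hence that of the boundary coefficient: the
    terms of order [1 / xi] cancel in the sum. The resulting decay [1 / xi^2] is what makes distant
    times integrable. *)
Lemma arc_oscillation A b c n phi xi : 0 < n <= 1 -> xi != 0 ->
  (forall s, -1 <= s <= 1 -> n <= quad A b c s <= 1) ->
  0 <= c -> `|b| + c <= n / 8 -> `|phi| * (`|b| + c) <= `|xi| * n / 8 ->
  `|\int[lebesgue_measure]_(s in `[0, 1]) ((1 - s) * cos (arc_phase A b c phi xi s))
  + \int[lebesgue_measure]_(s in `[0, 1]) ((1 - s) * cos (arc_phase A b c phi xi (- s)))|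
    <= 256 / (xi ^+ 2 * n ^+ 2).
Proof.
move=> n01 xi0 nD c0 bc pbc.
have P := @arc_oscillation_half A b c n phi xi n01 xi0 _ c0 bc pbc.
have Q := @arc_oscillation_half A (- b) c n phi (- xi) n01 _ _ c0 _ _.
have /ler_normlP[P1 P2] := P (fun s H => nD s ltac:(lra)).
have {Q} : `|\int[lebesgue_measure]_(s in `[0, 1])
    ((1 - s) * cos (arc_phase A b c phi xi (- s)))
    + A * Num.sqrt A / (- (xi * A - phi * b)) * sin (phi / Num.sqrt A)|
    <= 128 / (xi ^+ 2 * n ^+ 2).
  have <- : - xi * A - phi * - b = - (xi * A - phi * b) by ring.
  rewrite -(sqrrN xi).
  have <- : (fun s => (1 - s) * cos (arc_phase A (- b) c phi (- xi) s)) =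
      fun s => (1 - s) * cos (arc_phase A b c phi xi (- s)).
    by apply/funext => s; rewrite arc_phaseN.
  apply: Q; rewrite ?normrN ?oppr_eq0// => s s01; rewrite -quadN; apply: nD; lra.
rewrite invrN mulrN mulNr => /ler_normlP[Q1 Q2].
rewrite ler_norml; lra.
Qed.

End great_circle.

(** * Integrals over times near to and far from the center *)

Section interval_integrals.
Context {R : realType}.
Notation mu := (@lebesgue_measure R).
Implicit Types (f g H : R -> R) (a b c e t : R).

Lemma integrable_within f a b : {within `[a, b], continuous f} ->
  mu.-integrable `[a, b] (EFin \o f).
Proof.
by move=> cf; apply: continuous_compact_integrable => //; exact: segment_compact.
Qed.

Lemma Rintegral_split f a c b : a <= c -> c <= b ->
  mu.-integrable `[a, b] (EFin \o f) ->
  \int[mu]_(x in `[a, b]) f x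
  = \int[mu]_(x in `[a, c]) f x + \int[mu]_(x in `[c, b]) f x.
Proof.
move=> ac cb fi; have := @Rintegral_itvB R f (BLeft a) (BRight b) c fi.
rewrite !bnd_simp => /(_ ac cb); rewrite Rintegral_itv_obnd_cbnd.
  by move=> <-; ring.
by apply: integrableS fi => //; apply: subset_itvScc; rewrite ?bnd_simp.
Qed.

Lemma Rintegral_ge f H (h h' : R -> R) a b : a <= b ->
  mu.-integrable `[a, b] (EFin \o f) ->
  (forall t, a <= t <= b -> is_derive t 1 H (h t)) ->
  (forall t, a <= t <= b -> is_derive t 1 h (h' t)) ->
  (forall t, a <= t <= b -> h t <= f t) ->
  H b - H a <= \int[mu]_(x in `[a, b]) f x.
Proof.
rewrite le_eqVlt => /predU1P[-> _ _ _ _|ab fi dH dh hf].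
  by rewrite subrr set_itv1 Rintegral_set1.
have ch := derive_continuous_within dh.
rewrite -(Rintegral_FTC ab ch dH); apply: le_Rintegral => //.
exact: integrable_within.
Qed.

Lemma Rintegral_dist f g a b e : a <= b ->
  mu.-integrable `[a, b] (EFin \o f) -> mu.-integrable `[a, b] (EFin \o g) ->
  (forall t, a <= t <= b -> `|f t - g t| <= e) ->
  `|\int[mu]_(x in `[a, b]) f x - \int[mu]_(x in `[a, b]) g x| <= e * (b - a).
Proof.
move=> ab fi gi fg; rewrite -RintegralB//.
have fgi : mu.-integrable `[a, b] (EFin \o (f \- g)).
  by rewrite (_ : _ \o _ = (EFin \o f) \- (EFin \o g))%E//; exact: integrableB.
rewrite (le_trans (le_normr_Rintegral _ _))//.
have ei : mu.-integrable `[a, b] (EFin \o cst e).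
  by apply: integrable_within => x; exact: cst_continuous.
apply: (@le_trans _ _ (\int[mu]_(x in `[a, b]) (cst e x))).
  by apply: le_Rintegral => //; exact: (integrable_norm fgi).
by rewrite Rintegral_cst//= lebesgue_measure_itv/= lte_fin; case: ltgtP ab => // ->; rewrite subrr.
Qed.

(** The interval is cut into a core, two intermediate pieces and two tails. The core gives the
    positive term, the intermediate pieces lose at most [e] per unit length, and each tail loses at
    most [C h / M]. *)
Lemma kernel_lower_bound f a b (tau h nu M e m0 C : R) :
  0 < h -> 0 < nu <= M -> 0 <= C ->
  a <= tau - M * h -> tau + M * h <= b ->
  mu.-integrable `[a, b] (EFin \o f) ->
  (forall t, `|t - tau| <= nu * h -> m0 <= f t) ->
  (forall t, nu * h <= `|t - tau| <= M * h -> - e <= f t) ->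
  (forall t, a <= t <= b -> M * h <= `|t - tau| -> - (C * h ^+ 2 / (t - tau) ^+ 2) <= f t) ->
  0 <= e ->
  2 * nu * h * m0 - 2 * M * h * e - 2 * C * h / M <= \int[mu]_(x in `[a, b]) f x.
Proof.
move=> h0 /andP[nu0 nuM] C0 aM Mb fi f1 f2 f3 e0.
have M0 : 0 < M := lt_le_trans nu0 nuM.
have Mh : 0 < M * h by rewrite mulr_gt0.
have nh : 0 < nu * h by rewrite mulr_gt0.
have nMh : nu * h <= M * h by rewrite ler_pM2r.
have sub c d : a <= c -> d <= b -> mu.-integrable `[c, d] (EFin \o f).
  by move=> ac db; apply: integrableS fi => //; apply: subset_itvScc; rewrite ?bnd_simp.
have dl (k t : R) : is_derive t 1 (fun t => k * t) k.
  by apply: der_eq; eexists; [der|ring].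
have dk (k t : R) : is_derive t 1 (fun=> k) 0 by exact: der_cst.
rewrite (@Rintegral_split f a (tau - M * h))//; last by lra.
rewrite (@Rintegral_split f (tau - M * h) (tau - nu * h) b); [|lra|lra|exact: sub].
rewrite (@Rintegral_split f (tau - nu * h) (tau + nu * h) b); [|lra|lra|apply: sub; lra].
rewrite (@Rintegral_split f (tau + nu * h) (tau + M * h) b); [|lra|lra|apply: sub; lra].
(* A primitive of the tail bound [h1]. The second derivative [h2] is there to provide the continuity
   of [h1] through [Rintegral_ge]. *)
pose H t := C * h ^+ 2 / (t - tau).
pose h1 t := - (C * h ^+ 2 / (t - tau) ^+ 2).
pose h2 t := 2 * C * h ^+ 2 / (t - tau) ^+ 3.
have dH t : t - tau != 0 -> is_derive t 1 H (h1 t).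
  by move=> t0; apply: der_eq; eexists; [rewrite /H; der; exact: t0|rewrite /h1; field].
have dh t : t - tau != 0 -> is_derive t 1 h1 (h2 t).
  by move=> t0; apply: der_eq; eexists; [rewrite /h1; der; rewrite expf_neq0|rewrite /h2/=; field].
have I3 : (m0 * (tau + nu * h) - m0 * (tau - nu * h)) <=
   \int[mu]_(x in `[tau - nu * h, tau + nu * h]) f x.
  apply: (@Rintegral_ge f (fun t => m0 * t) (fun=> m0) (fun=> 0)) => //; [lra|apply: sub; lra|].
  by move=> t tt; apply: f1; rewrite ler_norml; lra.
have I2 : (- e * (tau - nu * h) - - e * (tau - M * h)) <=
   \int[mu]_(x in `[tau - M * h, tau - nu * h]) f x.
  apply: (@Rintegral_ge f (fun t => - e * t) (fun=> - e) (fun=> 0)) => //; [lra|apply: sub; lra|].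
  by move=> t tt; apply: f2; rewrite ler0_norm; lra.
have I4 : (- e * (tau + M * h) - - e * (tau + nu * h)) <=
   \int[mu]_(x in `[tau + nu * h, tau + M * h]) f x.
  apply: (@Rintegral_ge f (fun t => - e * t) (fun=> - e) (fun=> 0)) => //; [lra|apply: sub; lra|].
  by move=> t tt; apply: f2; rewrite ger0_norm; lra.
have I1 : H (tau - M * h) - H a <= \int[mu]_(x in `[a, tau - M * h]) f x.
  have a1 : a <= tau - M * h by lra.
  have D1 t (tt : a <= t <= tau - M * h) : is_derive t 1 H (h1 t).
    by apply: dH; rewrite lt_eqF//; lra.
  have D2 t (tt : a <= t <= tau - M * h) : is_derive t 1 h1 (h2 t).
    by apply: dh; rewrite lt_eqF//; lra.
  apply: (Rintegral_ge a1 (sub _ _ _ _) D1 D2); [lra|lra|].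
  by move=> t tt; apply: f3; [lra|rewrite ler0_norm; lra].
have I5 : H b - H (tau + M * h) <= \int[mu]_(x in `[tau + M * h, b]) f x.
  have a1 : tau + M * h <= b by lra.
  have D1 t (tt : tau + M * h <= t <= b) : is_derive t 1 H (h1 t).
    by apply: dH; rewrite gt_eqF//; lra.
  have D2 t (tt : tau + M * h <= t <= b) : is_derive t 1 h1 (h2 t).
    by apply: dh; rewrite gt_eqF//; lra.
  apply: (Rintegral_ge a1 (sub _ _ _ _) D1 D2); [lra|lra|].
  by move=> t tt; apply: f3; [lra|rewrite ger0_norm; lra].
have Hb : 0 <= H b.
  by rewrite /H divr_ge0//; [rewrite mulr_ge0// sqr_ge0|lra].
have Ha : H a <= 0.
  rewrite /H -oppr_ge0 -mulrN -invrN divr_ge0//; last lra.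
  by rewrite mulr_ge0// sqr_ge0.
have E1 : H (tau + M * h) = C * h / M.
  by rewrite /H (_ : tau + M * h - tau = M * h); [field; rewrite !gt_eqF|ring].
have E2 : H (tau - M * h) = - (C * h / M).
  by rewrite /H (_ : tau - M * h - tau = - (M * h)); [field; rewrite !gt_eqF|ring].
rewrite E1 in I5; rewrite E2 in I1.
move: I1 I2 I3 I4 I5.
set i1 := (\int[_]_(_ in _) _)%R; set i2 := (\int[_]_(_ in _) _)%R.
set i3 := (\int[_]_(_ in _) _)%R; set i4 := (\int[_]_(_ in _) _)%R.
set i5 := (\int[_]_(_ in _) _)%R => I1 I2 I3 I4 I5.
have e1 : 0 <= e * (nu * h) by rewrite mulr_ge0// ltW.
rewrite (_ : 2 * C * h / M = 2 * (C * h / M)); last by ring.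
have -> : 2 * nu * h * m0 = m0 * (tau + nu * h) - m0 * (tau - nu * h) by ring.
have -> : 2 * M * h * e = 2 * (e * (M * h)) by ring.
move: I2 I4.
have -> : - e * (tau - nu * h) - - e * (tau - M * h) = e * (nu * h) - e * (M * h) by ring.
have -> : - e * (tau + M * h) - - e * (tau + nu * h) = e * (nu * h) - e * (M * h) by ring.
move: I1 I3 I5 Ha Hb e1; clear; lra.
Qed.

(* For [|u| <= M h] the phase is a small perturbation of the linear phase [xi s],
   whose mean against [1 - |s|] is nonnegative (Fejer). *)
Lemma arc_near A b c n phi xi e : 0 < n <= 1 ->
  (forall s, -1 <= s <= 1 -> n <= quad A b c s <= 1) ->
  0 <= c -> (`|phi| + `|xi| * (2 * `|b| + c) / n) / n <= e ->
  let J := \int[mu]_(s in `[0, 1]) ((1 - s) * cos (arc_phase A b c phi xi s))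
    + \int[mu]_(s in `[0, 1]) ((1 - s) * cos (arc_phase A b c phi xi (- s))) in
  - (2 * e) <= J /\ (`|xi| <= Num.sqrt n -> 1 / 2 - 2 * e <= J).
Proof.
move=> /andP[n0 n1] nD c0 he.
have A01 : n <= A <= 1 by have := nD 0; rewrite /quad !mulr0 !addr0; apply; lra.
have /andP[An A1] := A01.
have sq x : n <= x <= 1 -> n <= Num.sqrt x <= 1.
  move=> /andP[nx x1]; have x0 : 0 <= x by lra.
  have sx1 : Num.sqrt x <= 1 by rewrite -sqrtr1 ler_wsqrtr.
  rewrite sx1 andbT (le_trans nx)// -{1}(sqr_sqrtr x0) expr2 ler_piMl// sqrtr_ge0//.
have /andP[sAn sA1] := sq _ A01.
pose xi0 := xi / Num.sqrt A.
have ph s : -1 <= s <= 1 -> `|arc_phase A b c phi xi s - xi0 * s| <= e.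
  move=> s1; have Ds := nD _ s1; have /andP[sDn sD1] := sq _ Ds.
  have /andP[Dn D1] := Ds.
  set D := quad A b c s in sDn sD1 Dn D1 *.
  have V x : n <= x -> 0 <= x^-1 <= n^-1.
    move=> nx; have x0 : 0 < x by exact: lt_le_trans nx.
    by apply/andP; split; [rewrite invr_ge0 ltW|rewrite lef_pV2 ?posrE].
  rewrite /arc_phase -/D.
  have s1' : `|s| <= 1 by rewrite ler_norml.
  have E : (phi + s * xi) / Num.sqrt D - xi0 * s
      = phi / Num.sqrt D + s * (xi * ((A - D) / (Num.sqrt A + Num.sqrt D) /
         (Num.sqrt A * Num.sqrt D))).
    (* Rationalizing the difference of the square roots shows that replacing [sqrt D] by [sqrt A]
       costs a factor proportional to [|A - D|]. *)
    have -> : A - D = (Num.sqrt A - Num.sqrt D) * (Num.sqrt A + Num.sqrt D).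
      by rewrite -subr_sqr !sqr_sqrtr; [|lra|lra].
    by rewrite /xi0; field; rewrite !gt_eqF//; lra.
  rewrite E (le_trans _ he)// (le_trans (ler_normD _ _))// [leRHS]mulrDl lerD//.
    rewrite normrM ler_wpM2l//; have /andP[? ?] := V _ sDn.
    by rewrite ger0_norm.
  rewrite normrM -[leRHS]mul1r ler_pM//.
  rewrite normrM -!mulrA ler_wpM2l// normrM.
  have AD : `|A - D| <= 2 * `|b| + c.
    rewrite /D /quad (_ : _ - _ = - (2 * b * s + c * (s * s))); last by ring.
    rewrite normrN (le_trans (ler_normD _ _))// lerD//.
      by rewrite normrM normrM ger0_norm// ler_piMr// mulr_ge0.
    by rewrite normrM (ger0_norm c0) ler_piMr// normrM mulr_ile1.
  have nn : Num.sqrt n * Num.sqrt n = n by rewrite -expr2 sqr_sqrtr ?ltW.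
  have S2 : n <= Num.sqrt A * Num.sqrt D.
    by rewrite -nn ler_pM ?sqrtr_ge0// ler_wsqrtr.
  have S3 : n <= Num.sqrt A + Num.sqrt D by lra.
  have /andP[S4 S5] := V _ S2; have /andP[S6 S7] := V _ S3.
  rewrite [`|_ * _|]normrM (ger0_norm S4) (ger0_norm S6).
  by apply: ler_pM => //; exact: ler_pM.
have e0 : 0 <= e.
  by rewrite (le_trans _ (ph 0 _))//; lra.
have D0 s : -1 <= s <= 1 -> 0 < quad A b c s.
  by move=> /nD /andP[+ _]; exact: lt_le_trans.
have I1 := integrable_within (continuous_within_cos
  (fun s (H : 0 <= s <= 1) => is_derive_arc_phase phi xi (D0 s ltac:(lra)))).
have I2 : mu.-integrable `[0, 1]
    (EFin \o (fun s => (1 - s) * cos (arc_phase A b c phi xi (- s)))).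
  have DN s : 0 <= s <= 1 -> 0 < quad A (- b) c s.
    by move=> s01; rewrite -quadN; apply: D0; lra.
  have E : (fun s => (1 - s) * cos (arc_phase A (- b) c phi (- xi) s)) =
      fun s => (1 - s) * cos (arc_phase A b c phi xi (- s)).
    by apply/funext => s; rewrite arc_phaseN.
  have := integrable_within (continuous_within_cos
    (fun s (H : 0 <= s <= 1) => is_derive_arc_phase phi (- xi) (DN s H))).
  by rewrite E.
have dl (s : R) : is_derive s 1 (fun s => xi0 * s) xi0.
  by apply: der_eq; eexists; [der|ring].
have I3 := integrable_within (continuous_within_cos
  (fun s (H : 0 <= s <= 1) => dl s)).
have W (s x y d : R) : 0 <= s <= 1 -> `|x - y| <= d ->
    `|(1 - s) * cos x - (1 - s) * cos y| <= d.
  move=> s01 xy; rewrite -mulrBr normrM -[leRHS]mul1r ler_pM//.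
    by rewrite ger0_norm; lra.
  exact: le_trans (cosB_le _ _) xy.
have /ler_normlP[B1 B2] := Rintegral_dist ler01 I1 I3
  (fun t ht => W _ _ _ _ ht (ph t ltac:(lra))).
have W' (t : R) : 0 <= t <= 1 -> `|(1 - t) * cos (arc_phase A b c phi xi (- t))
    - (1 - t) * cos (xi0 * t)| <= e.
  move=> ht; rewrite -(cosN (xi0 * t)) -(mulrN xi0); apply: W => //; apply: ph; lra.
have /ler_normlP[B3 B4] := Rintegral_dist ler01 I2 I3 W'.
move: B1 B2 B3 B4 => /=.
set i1 := (\int[_]_(_ in _) _)%R; set i0 := (\int[_]_(_ in _) _)%R.
set i2 := (\int[_]_(_ in _) _)%R => B1 B2 B3 B4.
split=> [|xin].
- have i00 : 0 <= i0.
    have [x0|x0] := eqVneq xi0 0; last first.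
      rewrite /i0 linear_phase_integral//; apply: divr_ge0; last exact: sqr_ge0.
      by rewrite subr_ge0 cos_le1.
    rewrite /i0; apply: Rintegral_ge0 => s; rewrite /= in_itv/= => s01.
    by rewrite x0 mul0r cos0; lra.
  by move: B1 B2 B3 B4 i00; clear; lra.
(* Here [|xi0| <= 1], so the cosine is at least [1/2] on [[0, 1]] and the weight integrates to
   [1/2]; the two halves then give [1/2] together. *)
- have i00 : 1 / 4 <= i0.
    pose H s := (s - s * s / 2) / 2 : R.
    have -> : 1 / 4 = H 1 - H 0 by rewrite /H; field.
    apply: (@Rintegral_ge _ H (fun s => (1 - s) / 2) (fun=> - (1 / 2))) => //.
    + by move=> t _; apply: der_eq; eexists; [rewrite /H; der|field].
    + by move=> t _; apply: der_eq; eexists; [der|field].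
    + move=> t t01; rewrite ler_wpM2l//; first lra.
      have x1 : `|xi0 * t| <= 1.
        rewrite normrM mulr_ile1//; last by rewrite ger0_norm; lra.
        rewrite /xi0 normrM normfV (gtr0_norm (lt_le_trans n0 sAn)).
        rewrite ler_pdivrMr ?(lt_le_trans n0 sAn)// mul1r (le_trans xin)//.
        by rewrite ler_wsqrtr.
      have := cos_ge (xi0 * t).
      have : (xi0 * t) ^+ 2 <= 1.
        by rewrite -real_normK ?num_real// expr_le1.
      by clear; lra.
  by move: B1 B2 B3 B4 i00; clear; lra.
Qed.

End interval_integrals.

(** * Lebesgue measure on tuples *)

Lemma lebesgue_measure_translate (R : realType) (v : R) (A : set R) :
  measurable A -> lebesgue_measure ((fun x => x + v) @^-1` A) = lebesgue_measure A.
Proof.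
have mv : measurable_fun setT (fun x : measurableTypeR R => x + v : measurableTypeR R).
  by apply: measurable_funD => //; exact: measurable_cst.
pose phi : {mfun _ >-> _} := HB.pack (fun x : measurableTypeR R => x + v : measurableTypeR R)
   (isMeasurableFun.Build _ _ _ _ _ mv).
move=> mA; symmetry.
apply: (@lebesgue_measure_unique R (pushforward lebesgue_measure phi)) => //.
move=> _ [[a b]] _ <-.
transitivity (lebesgue_measure ((fun x : R => x + v) @^-1` `]a, b])) => //.
rewrite (_ : _ @^-1` _ = `](a - v), (b - v)]%classic); last first.
  by apply/seteqP; split => x /=; rewrite !in_itv/= ltrBlDr lerBrDr.
by rewrite !lebesgue_measure_itv/= !lte_fin ltrD2r -!EFinD; case: ifP => // _; congr EFin; ring.
Qed.

Section tuple_translation.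
Context {R : realType}.

Definition tadd n (x y : n.-tuple R) : n.-tuple R :=
  [tuple tnth x i + tnth y i | i < n].

Lemma measurable_tadd n (v : n.-tuple R) : measurable_fun setT (fun x => tadd x v).
Proof.
apply/measurable_fun_tnthP => i.
rewrite (_ : _ \o _ = (fun x => tnth x i + tnth v i)); last first.
  by apply/funext => x /=; rewrite tnth_mktuple.
by apply: measurable_funD; [exact: measurable_tnth|exact: measurable_cst].
Qed.

Lemma integral_translate (f : R -> \bar R) (v : R) :
  measurable_fun setT f -> (forall x, 0 <= f x)%E ->
  (\int[lebesgue_measure]_x f (x + v)%R = \int[lebesgue_measure]_x f x)%E.
Proof.
move=> mf f0.
have mv : measurable_fun setT (fun x : measurableTypeR R => x + v : measurableTypeR R).
  by apply: measurable_funD => //; exact: measurable_cst.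
have := @ge0_integral_pushforward _ _ _ _ _ _ mv (@lebesgue_measure R)
  setT f measurableT mf (fun y _ => f0 y).
rewrite preimage_setT /= => <-.
apply: eq_measure_integral => A mA _; exact: lebesgue_measure_translate.
Qed.

Lemma lebesgue_tuple_translate n (v : n.-tuple R) (A : set (n.-tuple R)) :
  measurable A ->
  lebesgue_tuple R n ((fun x => tadd x v) @^-1` A) = lebesgue_tuple R n A.
Proof.
elim: n v A => [v A mA|n IH v A mA].
  congr (lebesgue_tuple R 0 _); apply/seteqP; split => x /=;
   by rewrite (tuple0 (tadd x v)) (tuple0 x).
pose X := tuple_cons @^-1` A.
have mX : measurable X.
  by rewrite -[X]setTI; exact: measurable_tuple_cons.
pose v' : n.-tuple R := [tuple of behead v].
pose g x : \bar R := lebesgue_tuple R n (xsection X x).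
have mg : measurable_fun setT g by exact: measurable_fun_xsection.
transitivity (\int[lebesgue_measure]_x g (x + thead v)%R)%E; last first.
  by rewrite integral_translate.
transitivity ((lebesgue_measure \x lebesgue_tuple R n)%E
   (tuple_cons @^-1` ((fun x => tadd x v) @^-1` A))) => //.
rewrite /product_measure1/=; apply: eq_integral => x _ /=.
rewrite /g -[RHS](IH v'); last exact: measurable_xsection.
congr (lebesgue_tuple R n _); apply/seteqP.
have E y : tadd (tuple_cons (x, y)) v = tuple_cons (x + thead v, tadd y v').
  apply: eq_from_tnth => i; rewrite tnth_mktuple.
  case: (unliftP ord0 i) => [j ->|->].
    rewrite /tuple_cons/= !tnthS tnth_mktuple; congr (_ + _).
    by rewrite !(tnth_nth 0)/= nth_behead.
  by rewrite /tuple_cons/= !tnth0.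
by split => y; rewrite /xsection/= !inE /X /= E.
Qed.

Definition tbox n (rho : R) : set (n.-tuple R) :=
  [set x | forall i, 0 <= tnth x i <= rho].

Lemma measurable_tbox n rho : measurable (@tbox n rho).
Proof.
rewrite (_ : tbox rho = \bigcap_(i in [set: 'I_n]) ((fun x => tnth x i) @^-1` `[0, rho])).
  apply: fin_bigcap_measurable => [|i _]; first exact: finite_finset.
  by rewrite -[X in measurable X]setTI; apply: measurable_tnth.
apply/seteqP; split => x /= H.
  by move=> i _ /=; rewrite in_itv/=; exact: H.
by move=> i; have := H i I; rewrite /= in_itv.
Qed.

Lemma lebesgue_tuple_box n (rho : R) : 0 <= rho ->
  lebesgue_tuple R n (tbox rho) = (rho ^+ n)%:E.
Proof.
move=> rho0; elim: n => [|n IH].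
  rewrite /= diracE mem_set ?expr0//.
  by rewrite /tbox/= => -[].
transitivity ((lebesgue_measure \x lebesgue_tuple R n)%E
   (tuple_cons @^-1` (tbox rho))) => //.
rewrite (_ : _ @^-1` _ = `[0, rho]%classic `*` tbox rho); last first.
  apply/seteqP; split => -[x y] /=.
    move=> H; split.
      by have := H ord0; rewrite /tuple_cons (tnth_nth 0)/= in_itv.
    by move=> i; have := H (lift ord0 i); rewrite !(tnth_nth 0)/=.
  rewrite in_itv/= => -[H1 H2] i.
  case: (unliftP ord0 i) => [j ->|->]; rewrite !(tnth_nth 0)//=.
  by have := H2 j; rewrite (tnth_nth 0).
rewrite product_measure1E//; last exact: measurable_tbox.
have L : lebesgue_measure `[0, rho]%classic = rho%:E.
  rewrite lebesgue_measure_itv/= lte_fin.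
  by case: ltgtP rho0 => // [r0 _|<- _]; rewrite // -EFinD subr0.
by rewrite IH exprS EFinM -L.
Qed.

End tuple_translation.

(** * Volumes of slabs by pigeonhole *)

Section slabs.
Context {R : realType}.

(** At most [3 C / a] cells of length [a] cover the values of [l]. The factor [4 C] instead of [3 C]
    leaves slack: if every cell failed, [mu Q <= 3/4 * mu Q] would force [mu Q = 0], and then the
    strict failure at the cell 0 would make a measure negative. *)
Lemma pigeonhole_slab d (T : measurableType d) (mu : {measure set T -> \bar R})
    (Q : set T) (l : T -> R) (a C : R) :
  measurable Q -> (mu Q < +oo)%E -> measurable_fun setT l ->
  (forall x, Q x -> `|l x| <= C) -> 0 < a <= C ->
  exists Q', [/\ Q' `<=` Q, measurable Q',
    forall x y, Q' x -> Q' y -> `|l x - l y| <= a &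
    fine (mu Q) * (a / (4 * C)) <= fine (mu Q')].
Proof.
move=> mQ Qoo ml lC /andP[a0 aC].
have C0 : 0 < C := lt_le_trans a0 aC.
pose Q_ (i : nat) := Q `&` l @^-1` `[- C + i%:R * a, - C + i.+1%:R * a].
have mQi i : measurable (Q_ i).
  by apply: measurableI => //; rewrite -[X in measurable X]setTI; apply: ml.
pose N := (Num.truncn (2 * C / a)).+1.
have QU : Q `<=` \big[setU/set0]_(i < N) Q_ i.
  move=> x Qx; rewrite -bigcup_mkord; exists (Num.truncn ((l x + C) / a)).
    rewrite /= ltnS; apply: le_truncn; rewrite ler_pM2r ?invr_gt0//.
    by have := lC _ Qx; rewrite ler_norml; lra.
  split=> //=; rewrite in_itv/=.
  have x0 : 0 <= (l x + C) / a.
    by rewrite divr_ge0 ?(ltW a0)//; have := lC _ Qx; rewrite ler_norml; lra.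
  have /andP[] := truncn_itv x0.
  rewrite ler_pdivlMr// ltr_pdivrMr// => t1 t2.
  by apply/andP; split; lra.
have fQ i : mu (Q_ i) \is a fin_num.
  rewrite ge0_fin_numE//; apply: le_lt_trans Qoo.
  by apply: le_measure; rewrite ?inE//; exact: subIsetl.
have [[i H]|H] := pselect (exists i, fine (mu Q) * (a / (4 * C)) <= fine (mu (Q_ i))).
  exists (Q_ i); split => //; first exact: subIsetl.
  move=> x y [_ /=]; rewrite in_itv/= => /andP[x1 x2] [_ /=].
  rewrite in_itv/= => /andP[y1 y2].
  by move: x1 x2 y1 y2; rewrite -natr1 ler_norml; lra.
exfalso.
have {}H i : fine (mu (Q_ i)) < fine (mu Q) * (a / (4 * C)).
  by rewrite ltNge; apply/negP => H'; apply: H; exists i.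
have fin : mu Q \is a fin_num by rewrite ge0_fin_numE.
have : (mu Q <= \sum_(i < N) mu (Q_ i))%E.
  exact: (@content_subadditive _ _ _ mu Q Q_ N (fun i _ => mQi i) mQ QU).
rewrite -(fineK fin); under eq_bigr do rewrite -(fineK (fQ _)).
rewrite sumEFin lee_fin => H1.
have m0 : 0 <= fine (mu Q) by rewrite fine_ge0.
have : \sum_(i < N) fine (mu (Q_ i)) <= \sum_(i < N) fine (mu Q) * (a / (4 * C)).
  by apply: ler_sum => i _; exact/ltW.
rewrite sumr_const card_ord -[_ *+ N]mulr_natr => H2.
have NC : N%:R * (a / (4 * C)) <= 3 / 4.
  have -> : N%:R = (Num.truncn (2 * C / a))%:R + 1 :> R by rewrite natr1.
  have /truncn_itv/andP[H3 _] : 0 <= 2 * C / a.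
    by rewrite divr_ge0 ?(ltW a0)// mulr_ge0// ltW.
  have -> : 3 / 4 = (2 * C / a + C / a) * (a / (4 * C)).
    by field; rewrite !gt_eqF.
  rewrite ler_wpM2r ?divr_ge0 ?mulr_ge0 ?(ltW a0) ?(ltW C0)// lerD//.
  by rewrite ler_pdivlMr// mul1r.
have : fine (mu Q) <= fine (mu Q) * (3 / 4).
  rewrite (le_trans H1)// (le_trans H2)// -mulrA [X in _ * X]mulrC ler_wpM2l//.
move=> H4; have mu0 : fine (mu Q) = 0 by lra.
have := H 0%N; rewrite mu0 mul0r ltNge => /negP; apply.
exact: fine_ge0.
Qed.

Lemma pigeonhole_slabs d (T : measurableType d) (mu : {measure set T -> \bar R})
    (k : nat) (Q : set T) (l : nat -> T -> R) (a : nat -> R) (C : R) :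
  measurable Q -> (mu Q < +oo)%E -> (forall j, measurable_fun setT (l j)) ->
  (forall j x, (j < k)%N -> Q x -> `|l j x| <= C) ->
  (forall j, (j < k)%N -> 0 < a j <= C) ->
  exists Q', [/\ Q' `<=` Q, measurable Q',
    forall j x y, (j < k)%N -> Q' x -> Q' y -> `|l j x - l j y| <= a j &
    fine (mu Q) * (\prod_(j < k) (a j / (4 * C))) <= fine (mu Q')].
Proof.
move=> mQ Qoo ml lC aC; elim: k lC aC => [|k IH] lC aC.
  by exists Q; split => //; rewrite big_ord0 mulr1.
have [||Q1 [sQ1 mQ1 dQ1 muQ1]] := IH.
- by move=> j x jk; apply: lC; rewrite ltnS ltnW.
- by move=> j jk; apply: aC; rewrite ltnS ltnW.
have Q1oo : (mu Q1 < +oo)%E by apply: le_lt_trans Qoo; apply: le_measure; rewrite ?inE.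
have [|Q2 [sQ2 mQ2 dQ2 muQ2]] := pigeonhole_slab mQ1 Q1oo (ml k) _ (aC k (ltnSn k)).
  by move=> x /sQ1; exact: lC.
exists Q2; split => //.
- exact: subset_trans sQ1.
- move=> j x y; rewrite ltnS leq_eqVlt => /predU1P[->|jk] Hx Hy; first exact: dQ2.
  by apply: dQ1 => //; exact: sQ2.
rewrite big_ord_recr/= (mulrA (fine (mu Q))) (le_trans _ muQ2)// ler_wpM2r//.
have /andP[a0 aC0] := aC k (ltnSn k).
by rewrite divr_ge0 ?mulr_ge0 ?(ltW a0)// (le_trans (ltW a0)).
Qed.

Lemma dotp_tadd n (x y l : n.-tuple R) : dotp (tadd x y) l = dotp x l + dotp y l.
Proof.
by rewrite /dotp -big_split/=; apply: eq_bigr => i _; rewrite tnth_mktuple mulrDl.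
Qed.

Lemma dotp_escale n r (x l : n.-tuple R) : dotp (escale r x) l = r * dotp x l.
Proof.
by rewrite /dotp mulr_sumr; apply: eq_bigr => i _; rewrite tnth_mktuple mulrA.
Qed.

Lemma measurable_dotp n (l : n.-tuple R) : measurable_fun setT (fun x => dotp x l).
Proof.
apply: measurable_sum => i; apply: measurable_funM; first exact: measurable_tnth.
exact: measurable_cst.
Qed.

(* No change of variables is needed: by pigeonhole some cell of values of the
   functionals has a large preimage in the cube, and translating one of its points
   to [z] moves that preimage into [S]. *)
Lemma slab_measure_ge n k (l : nat -> n.-tuple R) (a : nat -> R) (C rho : R)
    (z : n.-tuple R) (S : set (n.-tuple R)) :
  0 < rho -> (forall j, (j < k)%N -> 0 < a j <= C) ->
  (forall j x, (j < k)%N -> tbox rho x -> `|dotp x (l j)| <= C) ->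
  measurable S ->
  (forall x, (forall i, `|tnth x i - tnth z i| <= rho) ->
    (forall j, (j < k)%N -> `|dotp x (l j) - dotp z (l j)| <= a j) -> S x) ->
  ((rho ^+ n * \prod_(j < k) (a j / (4 * C)))%:E <= lebesgue_tuple R n S)%E.
Proof.
move=> rho0 aC lC mS HS.
have bE := lebesgue_tuple_box n (ltW rho0).
have boo : (lebesgue_tuple R n (tbox rho) < +oo)%E by rewrite bE ltry.
have [Q [sQ mQ dQ]] := @pigeonhole_slabs _ _ (lebesgue_tuple R n) k (tbox rho)
  (fun j x => dotp x (l j)) a C (@measurable_tbox R n rho) boo (fun j => measurable_dotp (l j)) lC aC.
rewrite [X in X * _ <= _](_ : _ = rho ^+ n); last exact: (congr1 fine bE).
move=> muQ.
have P0 : 0 < rho ^+ n * \prod_(j < k) (a j / (4 * C)).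
  rewrite mulr_gt0 ?exprn_gt0// prodr_gt0// => j _.
  have /andP[a0 aC0] := aC _ (ltn_ord j).
  by rewrite divr_gt0// mulr_gt0// (lt_le_trans a0).
have [Q0|/set0P[y Qy]] := eqVneq Q set0.
  by move: muQ; rewrite Q0 measure0/= leNgt P0.
have Qfin : lebesgue_tuple R n Q \is a fin_num.
  by rewrite ge0_fin_numE//; apply: le_lt_trans boo; apply: le_measure; rewrite ?inE//; exact: measurable_tbox.
pose v := tadd z (escale (-1) y).
rewrite -(lebesgue_tuple_translate v)//.
apply: (@le_trans _ _ (lebesgue_tuple R n Q)).
  by rewrite -(fineK Qfin) lee_fin.
apply: le_measure; rewrite ?inE//.
  by rewrite -[X in measurable X]setTI; apply: measurable_tadd.
move=> x Qx /=; apply: HS.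
  move=> i; rewrite !tnth_mktuple (_ : _ - _ = tnth x i - tnth y i); last by ring.
  by have := sQ _ Qx i; have := sQ _ Qy i; rewrite ler_norml; lra.
move=> j jk; rewrite !dotp_tadd dotp_escale (_ : _ - _ = dotp x (l j) - dotp y (l j)); last by ring.
exact: dQ.
Qed.

End slabs.

(** * Averages over translates *)

Section averaging.
Context {R : realType} {n : nat}.
Notation mu := (@lebesgue_measure R).
Notation mun := (lebesgue_tuple R n).
Implicit Types (e v x : n.-tuple R) (S T : set (n.-tuple R)).

Lemma integral_tuple_translate (f : n.-tuple R -> \bar R) v :
  measurable_fun setT f -> (forall x, 0 <= f x)%E ->
  (\int[mun]_x f (tadd x v) = \int[mun]_x f x)%E.
Proof.
move=> mf f0.
have := @ge0_integral_pushforward _ _ _ _ _ _ (measurable_tadd v) mun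
  setT f measurableT mf (fun y _ => f0 y).
rewrite preimage_setT /= => <-.
apply: eq_measure_integral => [|mv A mA _]; [exact: measurable_tadd|exact: (lebesgue_tuple_translate v mA)].
Qed.

Lemma measurable_line e : measurable_fun setT
  (fun p : n.-tuple R * R => tadd p.1 (escale p.2 e)).
Proof.
apply/measurable_fun_tnthP => i.
rewrite (_ : _ \o _ = (fun p : n.-tuple R * R => tnth p.1 i + p.2 * tnth e i)); last first.
  by apply/funext => p /=; rewrite !tnth_mktuple.
apply: measurable_funD.
  by apply: (measurableT_comp (measurable_tnth i)); exact: measurable_fst.
by apply: measurable_funM; [exact: measurable_snd|exact: measurable_cst].
Qed.

(** The right half of the weight [1 - |s|]. The left half is recovered as the same weight in the
    direction [- e], so that all integrals in [s] are over [[0, 1]]. *)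
Definition tent (s : R) : R := \1_(`[0, 1]) s * (1 - s).

Lemma tent_ge0 s : 0 <= tent s.
Proof.
rewrite /tent indicE; case: (boolP (s \in _)) => [|_]; last by rewrite mul0r.
by rewrite inE/= in_itv/= mul1r => /andP[_]; rewrite subr_ge0.
Qed.

Lemma measurable_tent : measurable_fun setT tent.
Proof.
apply: measurable_funM; first exact: measurable_indic.
by apply: measurable_funB => //; exact: measurable_cst.
Qed.

Lemma integral_tent : (\int[mu]_s (tent s)%:E = (1 / 2)%:E)%E.
Proof.
transitivity (\int[mu]_(s in `[0%R, 1%R]) (1 - s)%:E)%E.
  rewrite [RHS]integral_mkcond; apply: eq_integral => s _.
  by rewrite /tent patchE indicE; case: ifP => _; rewrite ?mul1r ?mul0r.
have d (s : R) : 0 <= s <= 1 -> is_derive s 1 (fun s => s - s * s / 2) (1 - s).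
  by move=> _; apply: der_eq; eexists; [der|field].
have c : {within `[0, 1], continuous (fun s : R => 1 - s)}.
  apply: (@derive_continuous_within _ _ (fun=> -1)) => s _.
  by apply: der_eq; eexists; [der|ring].
have i : mu.-integrable `[0, 1] (EFin \o (fun s : R => 1 - s)).
  by apply: continuous_compact_integrable => //; exact: segment_compact.
have E := Rintegral_FTC ltr01 c d.
rewrite -[LHS]fineK; last exact: integrable_fin_num.
by congr EFin; apply: (etrans E); field.
Qed.

(** By Tonelli the integral over [x] comes first. For fixed [s] the translation by [s e] preserves
    the measure and carries [S] into [T]; the constant [1 / 2] is the mass of [tent]. *)
Lemma translate_le S T (Phi : n.-tuple R -> R) e :
  measurable S -> measurable T ->
  measurable_fun setT Phi -> (forall x, 0 <= Phi x) ->
  (forall x s, S x -> 0 <= s <= 1 -> T (tadd x (escale s e))) ->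
  (\int[mun]_(x in S) \int[mu]_s (tent s * Phi (tadd x (escale s e)))%:E
   <= (1 / 2)%:E * \int[mun]_(x in T) (Phi x)%:E)%E.
Proof.
move=> mS mT mPhi Phi0 ST.
pose f (p : n.-tuple R * R) :=
  (\1_S p.1 * (tent p.2 * Phi (tadd p.1 (escale p.2 e))))%:E.
have mf : measurable_fun setT f.
  apply/measurable_EFinP; apply: measurable_funM.
    by apply: (measurableT_comp (measurable_indic mS)); exact: measurable_fst.
  apply: measurable_funM.
    by apply: (measurableT_comp measurable_tent); exact: measurable_snd.
  exact: (measurableT_comp mPhi (measurable_line e)).
have f0 p : (0 <= f p)%E.
  by rewrite lee_fin; apply: mulr_ge0; [|apply: mulr_ge0; rewrite ?tent_ge0].
have -> : (\int[mun]_(x in S) \int[mu]_s (tent s * Phi (tadd x (escale s e)))%:E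
    = \int[mun]_x \int[mu]_s f (x, s))%E.
  rewrite integral_mkcond; apply: eq_integral => x _; rewrite patchE.
  case: ifPn => xS.
    by apply: eq_integral => s _; rewrite /f/= indicE xS mul1r.
  rewrite integral0_eq// => s _.
  by rewrite /f/= indicE (negbTE xS) mul0r.
have -> := @fubini_tonelli _ _ _ _ R mun mu f mf f0.
have mPT : measurable_fun setT (fun x => (\1_T x * Phi x)%:E).
  by apply/measurable_EFinP; apply: measurable_funM => //; exact: measurable_indic.
have P0 x : (0 <= (\1_T x * Phi x)%:E)%E.
  by rewrite lee_fin mulr_ge0.
have -> : (\int[mun]_(x in T) (Phi x)%:E = \int[mun]_x (\1_T x * Phi x)%:E)%E.
  rewrite integral_mkcond; apply: eq_integral => x _; rewrite patchE indicE.
  by case: ifP => _; rewrite ?mul1r ?mul0r.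
rewrite -integral_tent -ge0_integralZr//; last 3 first.
- by apply/measurable_EFinP; exact: measurable_tent.
- by move=> s _; rewrite lee_fin tent_ge0.
- exact: integral_ge0.
apply: ge0_le_integral => //.
- by move=> s _; exact: integral_ge0.
- exact: (measurable_fun_fubini_tonelli_G f).
- apply: emeasurable_funM; last exact: measurable_cst.
  by apply/measurable_EFinP; exact: measurable_tent.
move=> s _.
rewrite -(integral_tuple_translate (escale s e) mPT P0) -ge0_integralZl//; last 2 first.
- have /(_ s) := fun s => measurableT_comp mPT (measurable_tadd (escale s e)).
  exact.
- by rewrite lee_fin tent_ge0.
apply: ge0_le_integral => //.
- by apply: (measurableT_comp mf); exact: measurable_pair2.
- by apply: emeasurable_funM; [exact: measurable_cst|exact: measurableT_comp mPT (measurable_tadd (escale s e))].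
move=> x _; rewrite -EFinM lee_fin /f/= mulrCA /tent [\1_(`[0, 1]) s]indicE.
case: (boolP (s \in _)) => [|_]; last by rewrite !mul0r.
rewrite inE/= in_itv/= mul1r => s01; rewrite ler_wpM2l//; first by lra.
rewrite ler_wpM2r// !indicE; case: (boolP (x \in S)) => [xS|_]; last exact: ler0n.
by rewrite (mem_set (ST _ _ _ s01))//; exact: set_mem.
Qed.

Lemma average_translate S T (Phi : n.-tuple R -> R) e (lam : R) :
  measurable S -> measurable T ->
  measurable_fun setT Phi -> (forall x, 0 <= Phi x) -> 0 <= lam ->
  (forall x s, S x -> -1 <= s <= 1 -> T (tadd x (escale s e))) ->
  (forall x, S x -> (lam%:E <=
    \int[mu]_s (tent s * Phi (tadd x (escale s e)))%:E
    + \int[mu]_s (tent s * Phi (tadd x (escale s (escale (-1) e))))%:E)%E) ->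
  (lam%:E * mun S <= \int[mun]_(x in T) (Phi x)%:E)%E.
Proof.
move=> mS mT mPhi Phi0 lam0 ST H.
have mI e' : measurable_fun setT
    (fun x => \int[mu]_s (tent s * Phi (tadd x (escale s e')))%:E)%E.
  pose f (p : n.-tuple R * R) := (tent p.2 * Phi (tadd p.1 (escale p.2 e')))%:E.
  have mf : measurable_fun setT f.
    apply/measurable_EFinP; apply: measurable_funM.
      by apply: (measurableT_comp measurable_tent); exact: measurable_snd.
    exact: (measurableT_comp mPhi (measurable_line e')).
  have f0 p : (0 <= f p)%E by rewrite lee_fin mulr_ge0// tent_ge0.
  exact: (@measurable_fun_fubini_tonelli_F _ _ _ _ R mu f mf f0).
have I0 e' x : (0 <= \int[mu]_s (tent s * Phi (tadd x (escale s e')))%:E)%E.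
  by apply: integral_ge0 => s _; rewrite lee_fin mulr_ge0// tent_ge0.
rewrite -integral_cst//; apply: (@le_trans _ _ (\int[mun]_(x in S)
  (\int[mu]_s (tent s * Phi (tadd x (escale s e)))%:E
    + \int[mu]_s (tent s * Phi (tadd x (escale s (escale (-1) e))))%:E))%E).
  apply: ge0_le_integral => //.
  by apply: (emeasurable_funD (measurable_funTS (mI _)) (measurable_funTS (mI _))).
rewrite ge0_integralD//; [|exact: measurable_funTS|exact: measurable_funTS].
have -> : (\int[mun]_(x in T) (Phi x)%:E = (1 / 2)%:E * \int[mun]_(x in T) (Phi x)%:E
    + (1 / 2)%:E * \int[mun]_(x in T) (Phi x)%:E)%E.
  rewrite -ge0_muleDl ?lee_fin// -EFinD (_ : 1 / 2 + 1 / 2 = 1) ?mul1e//.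
  by field.
apply: leeD; apply: translate_le => // x s Sx s01.
  by apply: ST => //; lra.
have -> : escale s (escale (-1) e) = escale (- s) e.
  by apply: eq_from_tnth => i; rewrite !tnth_mktuple; ring.
by apply: ST => //; lra.
Qed.

End averaging.

Section swap.
Context {R : realType}.
Notation mu := (@lebesgue_measure R).

Lemma Rintegral_swap (f : R -> R -> R) (a b c d C : R) :
  measurable_fun setT (fun p : R * R => f p.1 p.2) ->
  (forall s t, a <= s <= b -> c <= t <= d -> `|f s t| <= C) ->
  \int[mu]_(s in `[a, b]) \int[mu]_(t in `[c, d]) f s t =
  \int[mu]_(t in `[c, d]) \int[mu]_(s in `[a, b]) f s t /\
  mu.-integrable `[a, b] (EFin \o (fun s => \int[mu]_(t in `[c, d]) f s t)).
Proof.
move=> mf fC.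
pose g (p : R * R) := (\1_(`[a, b]) p.1 * (\1_(`[c, d]) p.2 * f p.1 p.2))%:E.
have mg : measurable_fun setT g.
  apply/measurable_EFinP; apply: measurable_funM.
    by apply: measurableT_comp; [exact: measurable_indic|exact: measurable_fst].
  apply: measurable_funM => //.
  by apply: measurableT_comp; [exact: measurable_indic|exact: measurable_snd].
have itvoo (u v : R) : (mu `[u, v]%classic < +oo)%E.
  by rewrite lebesgue_measure_itv/=; case: ifP => _; rewrite ?ltry// -EFinD ltry.
have ig : (mu \x mu)%E.-integrable setT g.
  have mA : measurable (`[a, b]%classic `*` `[c, d]%classic : set (R * R)).
    by apply: measurableX.
  have -> : g = (EFin \o (fun p : R * R => f p.1 p.2)) \_ (`[a, b]%classic `*` `[c, d]%classic).
    apply/funext => p; rewrite patchE /g !indicE.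
    case: (boolP (p.1 \in _)) => [|p1].
      rewrite inE => p1; case: (boolP (p.2 \in _)) => [|p2].
        by rewrite inE => p2; rewrite !mul1r mem_set.
      rewrite mul0r mulr0 memNset// => -[_]; move/mem_set; exact/negP.
    rewrite mul0r memNset// => -[+ _]; move/mem_set; exact/negP.
  have X := @integrable_mkcond _ _ R (mu \x mu)%E _
    (EFin \o (fun p : R * R => f p.1 p.2)) mA.
  apply: (proj1 X); apply: measurable_bounded_integrable => //.
  - rewrite [ltLHS]product_measure1E//.
    by apply: lte_mul_pinfty; rewrite ?ge0_fin_numE//; exact: itvoo.
  - exact: measurable_funTS.
  - exists C; split; first exact: num_real.
    move=> M CM p [/= + +]; rewrite !in_itv/= => H1 H2.
    by rewrite (le_trans (fC _ _ H1 H2))// ltW.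
have fin (h : R -> R) (u v D : R) : measurable_fun setT h ->
    (forall x, u <= x <= v -> `|h x| <= D) -> mu.-integrable `[u, v] (EFin \o h).
  move=> mh hD; apply: measurable_bounded_integrable => //.
  - exact: itvoo.
  - exact: measurable_funTS.
  - exists D; split; first exact: num_real.
    by move=> M DM x /=; rewrite in_itv/= => H; rewrite (le_trans (hD _ H))// ltW.
have It (s : R) : (\int[mu]_t g (s, t) =
    (\1_(`[a, b]) s * \int[mu]_(t in `[c, d]) f s t)%:E)%E.
  rewrite /g/= indicE; case: (boolP (s \in _)) => [|_]; last first.
    by rewrite mul0r integral0_eq// => x _; rewrite mul0r.
  rewrite inE/= in_itv/= => sab; rewrite mul1r fineK; last first.
    apply: integrable_fin_num => //; apply: (fin _ _ _ C) => [|x xcd]; last exact: fC.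
    by have /(_ s) := fun s => measurableT_comp mf (measurable_pair1 s); exact.
  rewrite [RHS]integral_mkcond; apply: eq_integral => t _.
  by rewrite mul1r patchE indicE; case: ifP => _; rewrite ?mul1r ?mul0r.
have Is (t : R) : (\int[mu]_s g (s, t) =
    (\1_(`[c, d]) t * \int[mu]_(s in `[a, b]) f s t)%:E)%E.
  rewrite /g/=; case: (boolP (t \in `[c, d]%classic)) => [tc|tc]; last first.
    by rewrite [in RHS]indicE (negbTE tc) mul0r integral0_eq// => x _; rewrite [\1_(`[c, d]) t]indicE (negbTE tc) mul0r mulr0.
  have tcd : c <= t <= d by move: tc; rewrite inE/= in_itv.
  rewrite [in RHS]indicE tc mul1r fineK; last first.
    apply: integrable_fin_num => //; apply: (fin _ _ _ C) => [|x xcd]; last exact: fC.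
    by have /(_ t) := fun s => measurableT_comp mf (measurable_pair2 s); exact.
  rewrite [RHS]integral_mkcond; apply: eq_integral => s _.
  by rewrite [\1_(`[c, d]) t]indicE tc mul1r patchE indicE; case: ifP => _; rewrite ?mul1r ?mul0r.
have E := Fubini ig.
have e1 (h : R -> R) (u v : R) : \int[mu]_(x in `[u, v]) h x =
    fine (\int[mu]_x (\1_(`[u, v]) x * h x)%:E)%E.
  rewrite /Rintegral integral_mkcond; congr fine; apply: eq_integral => x _.
  by rewrite patchE indicE; case: ifP => _; rewrite ?mul1r ?mul0r.
split.
  rewrite !e1; congr fine.
  transitivity (\int[mu]_x \int[mu]_y g (x, y))%E.
    by apply: eq_integral => s _; rewrite It.
  by rewrite E; apply: eq_integral => t _; rewrite Is.
have H : mu.-integrable setT (fun s => \int[mu]_t g (s, t))%E.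
  exact: (integrable_fubini_F ig).
apply/(integrable_mkcond (EFin \o _)) => //.
apply: eq_integrable H => // s _; rewrite It patchE indicE.
by case: ifP => _; rewrite ?mul1r ?mul0r.
Qed.

End swap.

(** * The Fourier transform along lines and on the sphere *)

Section fourier_line.
Context {R : realType} {n : nat}.
Notation mu := (@lebesgue_measure R).
Variables (a b : R) (gamma : R -> n.-tuple R) (chi : R -> R).
Hypothesis gamma_cont : forall i,
  {within `[a, b], continuous (fun t => tnth (gamma t) i)}.
Hypothesis chi_meas : measurable_fun setT chi.
Hypothesis chi01 : forall t, 0 <= chi t <= 1.
Implicit Types (xi x y e : n.-tuple R) (s t p r lam : R).

Lemma measurable_cos : measurable_fun setT (@cos R).
Proof. by apply: continuous_measurable_fun; exact: continuous_cos. Qed.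

Lemma measurable_sin : measurable_fun setT (@sin R).
Proof. by apply: continuous_measurable_fun; exact: continuous_sin. Qed.

Lemma lebesgue_measure_itv_lty (u v : R) : (mu `[u, v]%classic < +oo)%E.
Proof.
by rewrite lebesgue_measure_itv/=; case: ifP => _; rewrite ?ltry// -EFinD ltry.
Qed.

Lemma bounded_integrable_itv (h : R -> R) (u v D : R) : measurable_fun setT h ->
  (forall s, u <= s <= v -> `|h s| <= D) -> mu.-integrable `[u, v] (EFin \o h).
Proof.
move=> mh hD; apply: measurable_bounded_integrable => //.
- exact: lebesgue_measure_itv_lty.
- exact: measurable_funTS.
- exists D; split; first exact: num_real.
  by move=> M DM x /=; rewrite in_itv/= => H; rewrite (le_trans (hD _ H))// ltW.
Qed.

(** The curve is continuous only within [[a, b]]; extending it by zero gives a function measurable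
    on the whole line, as the product measurability arguments require. *)
Definition gamma_in t : n.-tuple R := [tuple \1_(`[a, b]) t * tnth (gamma t) i | i < n].

Lemma gamma_inE t : a <= t <= b -> gamma_in t = gamma t.
Proof.
move=> tab; apply: eq_from_tnth => i.
by rewrite tnth_mktuple indicE mem_set ?mul1r//= in_itv.
Qed.

Lemma measurable_gamma_in : measurable_fun setT gamma_in.
Proof.
apply/measurable_fun_tnthP => i.
rewrite (_ : _ \o _ = (fun t => tnth (gamma t) i) \_ `[a, b]); last first.
  apply/funext => t /=; rewrite tnth_mktuple patchE indicE.
  by case: ifP => _; rewrite ?mul1r ?mul0r.
apply/(measurable_restrictT _ _).1 => //.
apply: subspace_continuous_measurable_fun => //; exact: gamma_cont.
Qed.

Lemma measurable_dotp2 d (T : measurableType d) (f g : T -> n.-tuple R) :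
  measurable_fun setT f -> measurable_fun setT g ->
  measurable_fun setT (fun z => dotp (f z) (g z)).
Proof.
move=> mf mg; apply: measurable_sum => i; apply: measurable_funM.
- exact: (measurableT_comp (measurable_tnth i) mf).
- exact: (measurableT_comp (measurable_tnth i) mg).
Qed.

Lemma chi_bound (k : R) t : `|k| <= 1 -> `|k * chi t| <= 1.
Proof.
move=> k1; rewrite normrM mulr_ile1//.
by have /andP[? ?] := chi01 t; rewrite ger0_norm.
Qed.

Lemma measurable_phase xi (theta : R) :
  measurable_fun setT (fun t => dotp xi (gamma_in t) - theta).
Proof.
apply: measurable_funB; last exact: measurable_cst.
by apply: measurable_dotp2; [exact: measurable_cst|exact: measurable_gamma_in].
Qed.

Lemma integrable_cos xi (theta : R) : mu.-integrable `[a, b]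
  (EFin \o (fun t => cos (dotp xi (gamma_in t) - theta) * chi t)).
Proof.
apply: (bounded_integrable_itv (D := 1)) => [|t _]; last first.
  by apply: chi_bound; rewrite ler_norml cos_geN1 cos_le1.
apply: measurable_funM => //; apply: measurableT_comp; last exact: measurable_phase.
exact: measurable_cos.
Qed.

Lemma integrable_sin xi (theta : R) : mu.-integrable `[a, b]
  (EFin \o (fun t => - sin (dotp xi (gamma_in t) - theta) * chi t)).
Proof.
apply: (bounded_integrable_itv (D := 1)) => [|t _]; last first.
  by apply: chi_bound; rewrite normrN ler_norml sin_geN1 sin_le1.
apply: measurable_funM => //; apply: measurableT_comp => //.
apply: measurableT_comp; last exact: measurable_phase.
exact: measurable_sin.
Qed.

(** The real part of [e^(i theta) mu_hat(xi)], hence a lower bound for the modulus whatever [theta]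
    is. [sin_part] is the imaginary part of [mu_hat]; its [- 0] makes it an instance of the lemmas
    stated with a phase shift. *)
Definition cos_part (theta : R) xi :=
  \int[mu]_(t in `[a, b]) (cos (dotp xi (gamma_in t) - theta) * chi t).

Definition sin_part xi :=
  \int[mu]_(t in `[a, b]) (- sin (dotp xi (gamma_in t) - 0) * chi t).

Lemma mu_hatE xi : mu_hat `[a, b] gamma chi xi = (cos_part 0 xi +i* sin_part xi)%C.
Proof.
rewrite /mu_hat /Cintegral /cos_part /sin_part; congr (_ +i* _)%C.
  apply: eq_Rintegral => t; rewrite inE/= in_itv/= => tab.
  by rewrite gamma_inE// subr0 mulr0 subr0.
apply: eq_Rintegral => t; rewrite inE/= in_itv/= => tab.
by rewrite gamma_inE// subr0 mulr0 add0r.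
Qed.

Lemma cos_part_le xi (theta : R) :
  cos_part theta xi <= Normc.normc (mu_hat `[a, b] gamma chi xi).
Proof.
rewrite mu_hatE /Normc.normc.
have -> : cos_part theta xi = cos theta * cos_part 0 xi - sin theta * sin_part xi.
  rewrite /cos_part /sin_part -RintegralZl// ?integrable_cos//.
  rewrite -RintegralZl// ?integrable_sin// -RintegralB//.
  - apply: eq_Rintegral => t _ /=; rewrite subr0 cosB; ring.
  - exact: (integrableZl _ (cos theta) (integrable_cos xi 0)).
  - exact: (integrableZl _ (sin theta) (integrable_sin xi 0)).
set u := cos_part 0 xi; set v := sin_part xi.
apply: (le_trans (ler_norm _)); rewrite -sqrtr_sqr ler_wsqrtr//.
have := cos2Dsin2 theta; set c := cos theta; set s := sin theta => cs.
have : 0 <= (s * u + c * v) ^+ 2 by exact: sqr_ge0.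
have -> : (s * u + c * v) ^+ 2 = (c ^+ 2 + s ^+ 2) * (u ^+ 2 + v ^+ 2) - (c * u - s * v) ^+ 2 by ring.
by rewrite cs mul1r subr_ge0.
Qed.

(** Tonelli gives the measurability of partial integrals of nonnegative functions. The integrand is
    therefore raised to [(1 + f) * chi], and the integral of [chi] is subtracted afterwards. *)
Lemma measurable_part (f : R -> R) : measurable_fun setT f ->
  (forall s, -1 <= f s <= 1) ->
  measurable_fun setT
    (fun xi => \int[mu]_(t in `[a, b]) (f (dotp xi (gamma_in t) - 0) * chi t)).
Proof.
move=> mf f1.
pose g (z : n.-tuple R * R) :=
  (\1_(`[a, b]) z.2 * ((1 + f (dotp z.1 (gamma_in z.2) - 0)) * chi z.2))%:E.
have mph : measurable_fun setT (fun z : n.-tuple R * R =>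
    f (dotp z.1 (gamma_in z.2) - 0)).
  apply: measurableT_comp => //.
  apply: measurable_funB; last exact: measurable_cst.
  apply: measurable_dotp2; first exact: measurable_fst.
  by apply: measurableT_comp; [exact: measurable_gamma_in|exact: measurable_snd].
have mg : measurable_fun setT g.
  apply/measurable_EFinP; apply: measurable_funM.
    by apply: measurableT_comp; [exact: measurable_indic|exact: measurable_snd].
  apply: measurable_funM.
    by apply: measurable_funD; [exact: measurable_cst|exact: mph].
  by apply: measurableT_comp => //; exact: measurable_snd.
have g0 z : (0 <= g z)%E.
  have /andP[? ?] := chi01 z.2; have /andP[? ?] := f1 (dotp z.1 (gamma_in z.2) - 0).
  by rewrite lee_fin; apply: mulr_ge0 => //; apply: mulr_ge0 => //; lra.
have mG := @measurable_fun_fubini_tonelli_F _ _ _ _ R mu g mg g0.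
have ichi : mu.-integrable `[a, b] (EFin \o chi).
  apply: (bounded_integrable_itv (D := 1)) => // t _.
  by have := @chi_bound 1 t; rewrite mul1r normr1; apply.
have iphi xi : mu.-integrable `[a, b]
    (EFin \o (fun t => f (dotp xi (gamma_in t) - 0) * chi t)).
  apply: (bounded_integrable_itv (D := 1)) => [|t _]; last first.
    by apply: chi_bound; rewrite ler_norml.
  by apply: measurable_funM => //; apply: measurableT_comp => //; exact: measurable_phase.
rewrite (_ : (fun xi => _) = fun xi => fine (\int[mu]_t g (xi, t))%E
    - \int[mu]_(t in `[a, b]) chi t).
  apply: measurable_funB; last exact: measurable_cst.
  exact: measurableT_comp mG.
apply/funext => xi.
have -> : fine (\int[mu]_t g (xi, t))%E =
    \int[mu]_(t in `[a, b]) (chi t + f (dotp xi (gamma_in t) - 0) * chi t).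
  rewrite /Rintegral [in RHS]integral_mkcond; congr fine.
  apply: eq_integral => t _; rewrite patchE /g indicE.
  by case: ifP => _; rewrite ?mul1r ?mul0r// mulrDl mul1r.
by rewrite RintegralD//; ring.
Qed.

Lemma measurable_mu_hat :
  measurable_fun setT (fun xi => Normc.normc (mu_hat `[a, b] gamma chi xi)).
Proof.
rewrite (_ : (fun _ => _) =
  fun xi => Num.sqrt (cos_part 0 xi ^+ 2 + sin_part xi ^+ 2)); last first.
  by apply/funext => xi; rewrite mu_hatE.
apply: (@measurableT_comp _ _ _ _ _ _ (@Num.sqrt R)).
  by apply: continuous_measurable_fun; exact: sqrt_continuous.
have mc : measurable_fun setT (cos_part 0).
  apply: (@measurable_part cos); first exact: measurable_cos.
  by move=> s; rewrite cos_geN1 cos_le1.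
have ms : measurable_fun setT sin_part.
  apply: (@measurable_part (fun s => - sin s)).
    by apply: measurableT_comp => //; exact: measurable_sin.
  by move=> s; have := sin_geN1 s; have := sin_le1 s; lra.
by apply: measurable_funD; exact: measurable_funX.
Qed.

Lemma measurable_escale r : measurable_fun setT (@escale R n r).
Proof.
apply/measurable_fun_tnthP => i.
rewrite (_ : _ \o _ = (fun x => r * tnth x i)); last first.
  by apply/funext => x /=; rewrite tnth_mktuple.
by apply: measurable_funM; [exact: measurable_cst|exact: measurable_tnth].
Qed.

(** The function [|mu_hat(r w)|] of the direction [w], extended to nonzero [x] by homogeneity of
    degree 0. This lets [x] move along straight lines. *)
Definition fourier_size r x : R :=
  Normc.normc (mu_hat `[a, b] gamma chi (escale r (unitize x))).

Lemma measurable_fourier_size r : measurable_fun setT (fourier_size r).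
Proof.
apply: (measurableT_comp measurable_mu_hat).
exact: (measurableT_comp (measurable_escale r) measurable_unitize).
Qed.

Lemma tent_cos_le s (z : R) : 0 <= s <= 1 -> `|(1 - s) * cos z| <= 1.
Proof.
move=> s01; rewrite normrM mulr_ile1//; first by rewrite ger0_norm; lra.
by rewrite ler_norml cos_geN1 cos_le1.
Qed.

(** The shift [theta = <w s, gamma tau>] removes the phase of the time [tau], so that times close to
    [tau] add up coherently for all [s]. *)
Definition line_integral (tau : R) (w : R -> n.-tuple R) :=
  \int[mu]_(s in `[0, 1]) ((1 - s) * cos_part (dotp (w s) (gamma tau)) (w s)).

(** The average in [s] is moved inside the integral in [t]: each time then contributes a
    one-dimensional oscillatory integral [J t], to which the estimates above apply. *)
Lemma line_integralE tau (w : R -> n.-tuple R) : measurable_fun setT w ->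
  let J t := \int[mu]_(s in `[0, 1])
    ((1 - s) * cos (dotp (w s) (gamma_in t) - dotp (w s) (gamma tau))) in
  [/\ line_integral tau w = \int[mu]_(t in `[a, b]) (chi t * J t),
    mu.-integrable `[a, b] (EFin \o (fun t => chi t * J t)) &
    mu.-integrable `[0, 1] (EFin \o (fun s => (1 - s) * cos_part (dotp (w s) (gamma tau)) (w s)))].
Proof.
move=> mw J.
pose f t s := chi t * ((1 - s) * cos (dotp (w s) (gamma_in t) - dotp (w s) (gamma tau))).
have mf : measurable_fun setT (fun z : R * R => f z.1 z.2).
  apply: measurable_funM; first by apply: measurableT_comp => //; exact: measurable_fst.
  apply: measurable_funM.
    by apply: measurable_funB; [exact: measurable_cst|exact: measurable_snd].
  apply: measurableT_comp; first exact: measurable_cos.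
  have mw2 : measurable_fun setT (fun z : R * R => w z.2).
    by apply: measurableT_comp => //; exact: measurable_snd.
  apply: measurable_funB; apply: measurable_dotp2 => //.
  by apply: measurableT_comp; [exact: measurable_gamma_in|exact: measurable_fst].
have fC t s : a <= t <= b -> 0 <= s <= 1 -> `|f t s| <= 1.
  by move=> _ s01; rewrite /f mulrC; apply: chi_bound; exact: tent_cos_le.
have mf' : measurable_fun setT (fun z : R * R => f z.2 z.1).
  have -> : (fun z : R * R => f z.2 z.1) = (fun z : R * R => f z.1 z.2) \o (fun z => (z.2, z.1)) by [].
  apply: measurableT_comp => //; apply: measurable_fun_pair.
    exact: measurable_snd.
  exact: measurable_fst.
have [E1 I1] := Rintegral_swap mf fC.
have [_ I2] := Rintegral_swap mf' (fun s t H1 H2 => fC t s H2 H1).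
have iK t : mu.-integrable `[0, 1] (EFin \o (fun s =>
    (1 - s) * cos (dotp (w s) (gamma_in t) - dotp (w s) (gamma tau)))).
  apply: (bounded_integrable_itv (D := 1)) => [|s s01]; last exact: tent_cos_le.
  apply: measurable_funM; first by apply: measurable_funB => //; exact: measurable_cst.
  apply: measurableT_comp; first exact: measurable_cos.
  by apply: measurable_funB; apply: measurable_dotp2 => //; exact: measurable_cst.
have i1 t : \int[mu]_(s in `[0, 1]) f t s = chi t * J t.
  by rewrite /J -(@RintegralZl _ _ R mu `[0, 1]%classic _ (chi t) (measurable_itv _) (iK t)).
have i2 s : \int[mu]_(t in `[a, b]) f t s = (1 - s) * cos_part (dotp (w s) (gamma tau)) (w s).
  rewrite /cos_part -RintegralZl; [|exact: measurable_itv|exact: integrable_cos].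
  by apply: eq_Rintegral => t _; rewrite /f; ring.
split.
- rewrite /line_integral; under eq_Rintegral do rewrite -i2.
  by rewrite -E1; apply: eq_Rintegral => t _; rewrite i1.
- by apply: eq_integrable I1 => [|t _]; [exact: measurable_itv|rewrite /= i1].
- by apply: eq_integrable I2 => [|s _]; [exact: measurable_itv|rewrite /= i2].
Qed.

Lemma tent_integral_ge (Phi k : R -> R) : measurable_fun setT Phi ->
  (forall s, 0 <= Phi s) -> mu.-integrable `[0, 1] (EFin \o k) ->
  (forall s, 0 <= s <= 1 -> k s <= (1 - s) * Phi s) ->
  ((\int[mu]_(s in `[0, 1]) k s)%R%:E <= \int[mu]_s (tent s * Phi s)%:E)%E.
Proof.
move=> mP P0 ik kP.
have mtP : measurable_fun setT (fun s => (tent s * Phi s)%:E).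
  apply/measurable_EFinP; apply: measurable_funM => //; exact: measurable_tent.
have t0 s : (0 <= (tent s * Phi s)%:E)%E by rewrite lee_fin mulr_ge0// tent_ge0.
have [oo|] := ltP (\int[mu]_s (tent s * Phi s)%:E)%E +oo%E; last first.
  by rewrite leye_eq => /eqP ->; rewrite leey.
have iP : mu.-integrable setT (EFin \o (fun s => tent s * Phi s)).
  apply/integrableP; split; first exact: mtP.
  apply: le_lt_trans oo; apply: ge0_le_integral => //.
  - exact: measurableT_comp.
  - by move=> s _; rewrite [leLHS]gee0_abs; [exact: lexx|exact: t0].
have iP1 : mu.-integrable `[0, 1] (EFin \o (fun s => tent s * Phi s)).
  exact: integrableS iP.
apply: (@le_trans _ _ (\int[mu]_(s in `[0, 1]) (tent s * Phi s))%R%:E).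
  rewrite lee_fin; apply: le_Rintegral => // s.
  rewrite /= in_itv/= => s01; have -> : tent s = 1 - s.
    by rewrite /tent indicE mem_set ?mul1r//= in_itv.
  exact: kP.
rewrite /Rintegral fineK; last exact: integrable_fin_num.
by apply: ge0_subset_integral.
Qed.

(** Jensen's inequality takes the form of the tangent-type bound [lam^(p-1) (F - lam) <= F^p], which
    also holds when [F < lam]. The two tents have total mass 1, so subtracting [lam] costs exactly
    [lam]; this is why [2 * lam] is assumed. *)
Lemma jensen_line r x e tau p lam : 1 <= p -> 0 < lam ->
  let w s := escale r (unitize (tadd x (escale s e))) in
  2 * lam <= line_integral tau w + line_integral tau (w \o -%R) ->
  ((lam `^ p)%:E <=
    \int[mu]_s (tent s * fourier_size r (tadd x (escale s e)) `^ p)%:E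
    + \int[mu]_s (tent s * fourier_size r (tadd x (escale s (escale (-1) e))) `^ p)%:E)%E.
Proof.
move=> p1 lam0 w wl.
have mw : measurable_fun setT w.
  apply: (measurableT_comp (measurable_escale r)).
  apply: (measurableT_comp measurable_unitize).
  by have /(_ x) := fun x => measurableT_comp (measurable_line e) (measurable_pair1 x); exact.
have mw' : measurable_fun setT (w \o -%R) by exact: measurableT_comp.
pose lp := lam `^ (p - 1).
have F0 y : 0 <= fourier_size r y.
  by rewrite /fourier_size mu_hatE /Normc.normc sqrtr_ge0.
have half (v : R -> n.-tuple R) : measurable_fun setT v ->
    ((lp * (line_integral tau (fun s => escale r (unitize (v s))) - lam / 2))%:E <=
      \int[mu]_s (tent s * fourier_size r (v s) `^ p)%:E)%E.
  move=> mv; set wv := fun s => _.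
  have mwv : measurable_fun setT wv.
    by apply: (measurableT_comp (measurable_escale r)); exact: (measurableT_comp measurable_unitize).
  have [_ _ iL] := line_integralE tau mwv.
  have i1 : mu.-integrable `[0, 1] (EFin \o (fun s => lam * (1 - s))).
    apply: (bounded_integrable_itv (D := lam)).
      by apply: measurable_funM; [exact: measurable_cst|apply: measurable_funB => //; exact: measurable_cst].
    move=> s /andP[s0 s1]; have s2 : 0 <= 1 - s by rewrite subr_ge0.
    rewrite ger0_norm; last exact: mulr_ge0 (ltW lam0) s2.
    by apply: ler_piMr; [exact: ltW|rewrite gerBl].
  have i2 : mu.-integrable `[0, 1] (EFin \o (fun s =>
      (1 - s) * cos_part (dotp (wv s) (gamma tau)) (wv s) - lam * (1 - s))).
    have := integrableB _ iL i1; apply; exact: measurable_itv.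
  have i3 := integrableZl _ lp i2.
  have i0 : \int[mu]_(s in `[0, 1]) (lam * (1 - s)) = lam / 2.
    have dH (s : R) : 0 <= s <= 1 ->
        is_derive s 1 (fun s => lam * (s - s * s / 2)) (lam * (1 - s)).
      by move=> _; apply: der_eq; eexists; [der|field].
    have cH : {within `[0, 1], continuous (fun s => lam * (1 - s))}.
      apply: (@derive_continuous_within _ _ (fun=> - lam)) => s _.
      by apply: der_eq; eexists; [der|ring].
    by rewrite (Rintegral_FTC ltr01 cH dH); field.
  have -> : lp * (line_integral tau wv - lam / 2) =
     \int[mu]_(s in `[0, 1]) (lp * ((1 - s) * cos_part (dotp (wv s) (gamma tau)) (wv s) - lam * (1 - s))).
    rewrite (@RintegralZl _ _ R mu `[0, 1]%classic _ lp (measurable_itv _) i2) RintegralB//.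
    by rewrite i0.
  apply: tent_integral_ge => //.
  - apply: (measurableT_comp (measurable_powR _)).
    exact: (measurableT_comp (measurable_fourier_size r)).
  - by move=> s; exact: powR_ge0.
  - exact: i3.
  move=> s s01; have s1 : 0 <= 1 - s by rewrite subr_ge0; case/andP: s01.
  have L := cos_part_le (wv s) (dotp (wv s) (gamma tau)).
  set c := cos_part _ _ in L *.
  have -> : lp * ((1 - s) * c - lam * (1 - s)) = (1 - s) * (lp * (c - lam)) by ring.
  apply: ler_wpM2l => //.
  apply: (@le_trans _ _ (lp * (fourier_size r (v s) - lam))).
    by rewrite ler_wpM2l ?powR_ge0// lerD2r.
  have [Fl|Fl] := leP lam (fourier_size r (v s)); last first.
    rewrite (@le_trans _ _ 0) ?powR_ge0// mulr_ge0_le0 ?powR_ge0//.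
    by rewrite subr_le0 ltW.
  have Fs0 : 0 < fourier_size r (v s) by exact: lt_le_trans Fl.
  apply: (@le_trans _ _ (lp * fourier_size r (v s))).
    by rewrite ler_wpM2l ?powR_ge0// lerBlDr lerDl ltW.
  rewrite -[in leRHS](subrK 1 p) powRD ?(gt_eqF Fs0) ?implybT//.
  rewrite powRr1 ?F0// ler_wpM2r ?F0//.
  by rewrite ge0_ler_powR ?nnegrE ?subr_ge0 ?(ltW lam0) ?F0.
have ml e' : measurable_fun setT (fun s => tadd x (escale s e')).
  by have /(_ x) := fun x => measurableT_comp (measurable_line e') (measurable_pair1 x); exact.
apply: le_trans (leeD (half _ (ml e)) (half _ (ml (escale (-1) e)))).
rewrite -EFinD lee_fin.
have -> : (fun s => escale r (unitize (tadd x (escale s (escale (-1) e))))) = w \o -%R.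
  apply/funext => s /=; rewrite /w; congr (escale r (unitize (tadd x _))).
  by apply: eq_from_tnth => i; rewrite !tnth_mktuple; ring.
rewrite -mulrDr -[in leLHS](subrK 1 p) powRD ?(gt_eqF lam0) ?implybT//.
rewrite powRr1 ?(ltW lam0)// ler_wpM2l ?powR_ge0//.
move: wl; rewrite -/w; set u := line_integral _ _; set v := line_integral _ _.
clear; lra.
Qed.

End fourier_line.

(** * Lower bound for one averaged transform *)

Section pointwise.
Context {R : realType} {n : nat}.
Notation mu := (@lebesgue_measure R).
Variables (a b : R) (gamma : R -> n.-tuple R) (chi : R -> R).
Hypothesis gamma_cont : forall i,
  {within `[a, b], continuous (fun t => tnth (gamma t) i)}.
Hypothesis chi_meas : measurable_fun setT chi.
Hypothesis chi01 : forall t, 0 <= chi t <= 1.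
Implicit Types (x y e : n.-tuple R) (s t r : R).

Lemma dotpC x y : dotp x y = dotp y x.
Proof. by apply: eq_bigr => i _; rewrite mulrC. Qed.

Lemma dotp_ge0 x : 0 <= dotp x x.
Proof. by apply: sumr_ge0 => i _; rewrite -expr2 sqr_ge0. Qed.

Lemma dotp_line x e s : dotp (tadd x (escale s e)) (tadd x (escale s e)) =
  quad (dotp x x) (dotp x e) (dotp e e) s.
Proof.
rewrite dotp_tadd dotp_escale (dotpC x) (dotpC e) !dotp_tadd !dotp_escale.
by rewrite (dotpC e x) /quad; ring.
Qed.

Lemma line_phase x e r s v v' :
  let w := escale r (unitize (tadd x (escale s e))) in
  dotp w v - dotp w v' =
  arc_phase (dotp x x) (dotp x e) (dotp e e)
    (r * (dotp x v - dotp x v')) (r * (dotp e v - dotp e v')) s.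
Proof.
rewrite /= /arc_phase -dotp_line /unitize /enorm !dotp_escale !dotp_tadd !dotp_escale.
by ring.
Qed.

(** The core [|t - tau| <= (m / 2) h] contributes [m chi0 h / 4]. The constants [M] and [e1] are
    tuned so that the tails and the intermediate times lose [m chi0 h / 16] each, which leaves
    [m chi0 h / 8]. *)
Lemma pointwise_estimate x e tau r h (m chi0 M e1 : R) :
  0 < h -> 0 < m <= 1 -> 0 < chi0 <= 1 -> 0 < r ->
  M = 32 * 32 * 32 / (m ^+ 3 * chi0) -> e1 = m * chi0 / (32 * M) ->
  a <= tau <= b ->
  let A := dotp x x in let B := dotp x e in let C := dotp e e in
  (forall s, -1 <= s <= 1 -> m <= quad A B C s <= 1) ->
  `|B| + C <= m / 8 -> 2 * `|B| + C <= m ^+ 2 * e1 / (8 * M) ->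
  (forall t, a <= t <= b -> chi t != 0 ->
    [/\ `|t - tau| / (2 * h) <= `|r * (dotp e (gamma t) - dotp e (gamma tau))|,
        `|r * (dotp e (gamma t) - dotp e (gamma tau))| <= 2 * `|t - tau| / h &
        r * `|dotp x (gamma t) - dotp x (gamma tau)| * (`|B| + C)
          <= `|t - tau| / h * m / 16]) ->
  a <= tau - M * h -> tau + M * h <= b ->
  (forall t, `|t - tau| <= M * h -> chi0 <= chi t) ->
  (forall t, `|t - tau| <= M * h ->
    r * `|dotp x (gamma t) - dotp x (gamma tau)| <= m * e1 / 4) ->
  let w s := escale r (unitize (tadd x (escale s e))) in
  is_true (m * chi0 / 8 * h <= line_integral a b gamma chi tau w
    + line_integral a b gamma chi tau (w \o -%R)).
Proof.
move=> h0 /andP[m0 m1] /andP[c0 c1] r0 ME e1E tab A B C HD HBC HBC2 HG aM Mb Hchi HX w.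
have mw : measurable_fun setT w.
  apply: (measurableT_comp (measurable_escale r)).
  apply: (measurableT_comp measurable_unitize).
  by have /(_ x) := fun x => measurableT_comp (measurable_line e) (measurable_pair1 x); exact.
have mw' : measurable_fun setT (w \o -%R) by exact: measurableT_comp.
have [-> I1 _] := line_integralE gamma_cont chi_meas chi01 tau mw.
have [-> I2 _] := line_integralE gamma_cont chi_meas chi01 tau mw'.
have M0 : 0 < M by rewrite ME divr_gt0// mulr_gt0// exprn_gt0.
have e10 : 0 < e1 by rewrite e1E divr_gt0// mulr_gt0.
have C0 : 0 <= C by exact: dotp_ge0.
have m3c : m ^+ 3 * chi0 <= 1.
  by rewrite mulr_ile1 ?exprn_ge0 ?(ltW m0) ?(ltW c0)// exprn_ile1// ltW.
have M1 : 1 <= M.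
  rewrite ME ler_pdivlMr ?mulr_gt0 ?exprn_gt0// mul1r (le_trans m3c)//.
  by rewrite -2!natrM ler1n.
have e14 : e1 <= 1 / 32.
  rewrite e1E ler_pdivrMr ?mulr_gt0//.
  have : m * chi0 <= 1 by rewrite mulr_ile1// ltW.
  by move: M1; clear -gamma_cont chi_meas chi01; lra.
rewrite -RintegralD; [|exact: measurable_itv|exact: I1|exact: I2].
pose phi t := r * (dotp x (gamma t) - dotp x (gamma tau)).
pose xi t := r * (dotp e (gamma t) - dotp e (gamma tau)).
pose J t := \int[mu]_(s in `[0, 1]) ((1 - s) * cos (arc_phase A B C (phi t) (xi t) s))
  + \int[mu]_(s in `[0, 1]) ((1 - s) * cos (arc_phase A B C (phi t) (xi t) (- s))).
set f := (X in \int[_]_(t in _) X t).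
have fE t : a <= t <= b -> f t = chi t * J t.
  move=> ht; rewrite /f -mulrDr; congr (_ * (_ + _)); apply: eq_Rintegral => s _.
    by rewrite gamma_inE// line_phase.
  by rewrite gamma_inE// /= line_phase.
have nab t : `|t - tau| <= M * h -> a <= t <= b.
  by rewrite ler_norml; move: aM Mb; clear -gamma_cont chi_meas chi01; lra.
have e1m : e1 * m = m ^+ 2 * chi0 / (32 * M) by rewrite e1E; ring.
have near_ t : `|t - tau| <= M * h ->
    - e1 <= J t /\ (`|xi t| <= Num.sqrt m -> 1 / 2 - e1 <= J t).
  move=> tM; have tb := nab _ tM.
  have ch0 : chi t != 0 by rewrite gt_eqF// (lt_le_trans c0)// Hchi.
  have [_ G2 _] := HG _ tb ch0.
  have := @arc_near R A B C m (phi t) (xi t) (e1 / 2) _ HD C0 _.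
  rewrite (_ : 2 * (e1 / 2) = e1); last by field.
  apply; first by rewrite m0.
  rewrite ler_pdivrMr//.
  have p1 : `|phi t| <= m * e1 / 4.
    by rewrite /phi normrM (gtr0_norm r0) HX.
  have x2 : `|xi t| <= 2 * M.
    rewrite (le_trans G2)// ler_pdivrMr// -mulrA ler_pM2l//.
  have : `|xi t| * (2 * `|B| + C) / m <= m * e1 / 4.
    rewrite ler_pdivrMr//.
    have -> : m * e1 / 4 * m = 2 * M * (m ^+ 2 * e1 / (8 * M)).
      by field; rewrite gt_eqF.
    by rewrite ler_pM// addr_ge0// mulr_ge0.
  by move: p1; clear -gamma_cont chi_meas chi01; lra.
(* The bound [256 / (xi^2 m^2)] combined with [|xi| >= |t - tau| / (2 h)] gives the constant
   [32 * 32 / m^2]. *)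
have far t : a <= t <= b -> M * h <= `|t - tau| ->
    - ((32 * 32) / m ^+ 2 * h ^+ 2 / (t - tau) ^+ 2) <= f t.
  move=> tb tM; rewrite fE//.
  have u0 : 0 < `|t - tau| by rewrite (lt_le_trans _ tM)// mulr_gt0.
  have u2 : 0 < (t - tau) ^+ 2 by rewrite -real_normK ?num_real// exprn_gt0.
  have bd0 : 0 <= (32 * 32) / m ^+ 2 * h ^+ 2 / (t - tau) ^+ 2.
    by rewrite !mulr_ge0 ?invr_ge0 ?sqr_ge0// ltW// exprn_gt0.
  have [->|ch] := eqVneq (chi t) 0; first by rewrite mul0r oppr_le0.
  have [G1 G2 G3] := HG _ tb ch.
  have xg : 0 < `|xi t|.
    by rewrite (lt_le_trans _ G1)// divr_gt0// mulr_gt0.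
  have xi0 : xi t != 0 by rewrite -normr_gt0.
  have J1 : `|J t| <= 256 / (xi t ^+ 2 * m ^+ 2).
    apply: arc_oscillation => //; first by rewrite m0.
    rewrite /phi normrM (gtr0_norm r0) (le_trans G3)//.
    have : `|t - tau| / h * m / 16 <= `|xi t| * m / 8.
      have -> : `|t - tau| / h * m / 16 = `|t - tau| / (2 * h) * (m / 8).
        by field; rewrite gt_eqF.
      by rewrite -[leRHS]mulrA ler_pM2r// divr_gt0.
    by [].
  have J2 : `|J t| <= (32 * 32) / m ^+ 2 * h ^+ 2 / (t - tau) ^+ 2.
    rewrite (le_trans J1)//.
    have xx : 0 < xi t ^+ 2 by rewrite -real_normK ?num_real// exprn_gt0.
    rewrite ler_pdivrMr; last by rewrite mulr_gt0// exprn_gt0.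
    have X2 : (t - tau) ^+ 2 / (4 * h ^+ 2) <= xi t ^+ 2.
      have -> : (t - tau) ^+ 2 / (4 * h ^+ 2) = (`|t - tau| / (2 * h)) ^+ 2.
        rewrite expr_div_n real_normK ?num_real//.
        by rewrite exprMn (_ : 2 ^+ 2 = 4)// -natrX.
      rewrite -[leRHS]real_normK ?num_real// lerXn2r// nnegrE.
      by rewrite divr_ge0// mulr_ge0// ltW.
    have -> : 256 = (32 * 32) / m ^+ 2 * h ^+ 2 / (t - tau) ^+ 2 *
        ((t - tau) ^+ 2 / (4 * h ^+ 2) * m ^+ 2).
      have tn : t - tau != 0 by rewrite -normr_gt0.
      by field; rewrite ?tn ?(gt_eqF h0) ?(gt_eqF m0).
    by rewrite ler_wpM2l// ler_wpM2r// exprn_ge0// ltW.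
  have /andP[ct0 ct1] := chi01 t.
  rewrite lerNl -mulrN (le_trans (ler_norm _))// normrM normrN (ger0_norm ct0).
  by rewrite (le_trans _ J2)// ler_piMl.
have := @kernel_lower_bound R f a b tau h (m / 2) M e1 (chi0 / 4) ((32 * 32) / m ^+ 2) h0.
(* The core radius [nu = m / 2] ensures [|xi| <= m <= sqrt m], the range in which [arc_near] yields
   a positive lower bound. *)
have mM : 0 < m / 2 <= M.
  by rewrite divr_gt0//=; move: m1 M1; clear -gamma_cont chi_meas chi01; lra.
move=> /(_ mM) K; have {}K := K _ aM Mb _ _ _ far (ltW e10).
apply: (le_trans _ (K _ _ _ _)).
- have -> : 2 * (m / 2) * h * (chi0 / 4) - 2 * M * h * e1 - 2 * ((32 * 32) / m ^+ 2) * h / M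
     = m * chi0 / 8 * h.
    by rewrite e1E ME; field; rewrite !gt_eqF.
  exact: lexx.
- by rewrite divr_ge0// exprn_ge0// ltW.
- have := integrableD _ I1 I2; apply; exact: measurable_itv.
- move=> t tt.
  have tM : `|t - tau| <= M * h.
    by rewrite (le_trans tt)// ler_pM2r//; case/andP: mM.
  have [_] := near_ _ tM.
  have ch0 : chi t != 0 by rewrite gt_eqF// (lt_le_trans c0)// Hchi.
  have [_ G2 _] := HG _ (nab _ tM) ch0.
  have xm : `|xi t| <= Num.sqrt m.
    apply: (@le_trans _ _ m).
      rewrite (le_trans G2)// ler_pdivrMr//.
      by move: tt; clear -gamma_cont chi_meas chi01; lra.
    by rewrite -{1}(sqr_sqrtr (ltW m0)) expr2 ler_piMl// ?sqrtr_ge0// -sqrtr1 ler_wsqrtr.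
  move=> /(_ xm) Jt; rewrite fE ?nab//.
  have J4 : 1 / 4 <= J t by move: e14 Jt; clear -gamma_cont chi_meas chi01; lra.
  have -> : chi0 / 4 = chi0 * (1 / 4) by ring.
  by apply: ler_pM => //; [exact: ltW|exact: Hchi].
- move=> t /andP[_ tM]; rewrite fE ?nab//.
  have [Jt _] := near_ _ tM.
  have /andP[ct0 ct1] := chi01 t.
  have [J0|J0] := leP 0 (J t).
    by rewrite (@le_trans _ _ 0) ?oppr_le0 ?mulr_ge0// ltW.
  by rewrite (le_trans Jt)// ler_niMl// ltW.
Qed.

End pointwise.

(** * From the sphere to the ball *)

Section sphere.
Context {R : realType} {n : nat}.
Notation mun := (lebesgue_tuple R n).
Implicit Types (x y e : n.-tuple R).

Lemma enorm_escale (r : R) x : enorm (escale r x) = `|r| * enorm x.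
Proof.
rewrite /enorm dotp_escale dotpC dotp_escale mulrA -expr2 sqrtrM ?sqr_ge0//.
by rewrite sqrtr_sqr.
Qed.

Lemma enorm_unitize x : 0 < enorm x -> enorm (unitize x) = 1.
Proof.
move=> x0; rewrite /unitize enorm_escale ger0_norm ?invr_ge0 ?ltW//.
by rewrite mulVf// gt_eqF.
Qed.

(** Surface measure is [n] times the image of Lebesgue measure on the truncated ball under
    [unitize]. Points outside that ball are sent to the origin, which is off the sphere, so a total
    map can serve for the pushforward. *)
Definition cone_retract x : n.-tuple R := escale (\1_(@unit_ball0 R n) x) (unitize x).

Lemma measurable_cone_retract : measurable_fun setT cone_retract.
Proof.
apply/measurable_fun_tnthP => i.
rewrite (_ : _ \o _ = fun x => \1_(@unit_ball0 R n) x * tnth (unitize x) i); last first.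
  by apply/funext => x /=; rewrite tnth_mktuple.
apply: measurable_funM; first by apply: measurable_indic; exact: measurable_unit_ball0.
exact: (measurableT_comp (measurable_tnth i) measurable_unitize).
Qed.

Lemma measurable_usphere : measurable (@usphere R n).
Proof.
have -> : @usphere R n = setT `&` enorm @^-1` [set 1] by rewrite setTI.
by apply: measurable_enorm => //; exact: measurable_set1.
Qed.

Lemma cone_retract_in x : unit_ball0 x -> cone_retract x = unitize x.
Proof.
move=> xB; rewrite /cone_retract indicE mem_set//.
by apply: eq_from_tnth => i; rewrite tnth_mktuple mul1r.
Qed.

Lemma preimage_cone_retract (A : set (n.-tuple R)) : A `<=` @usphere R n ->
  cone_retract @^-1` A = unitize @^-1` A `&` @unit_ball0 R n.
Proof.
move=> AS; apply/seteqP; split => x /=; last first.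
  by move=> [xA xB]; rewrite cone_retract_in.
have [xB|xB] := pselect (unit_ball0 x); first by rewrite cone_retract_in.
rewrite /cone_retract indicE memNset//= => /AS.
rewrite /usphere/= enorm_escale normr0 mul0r => /esym/eqP.
by rewrite oner_eq0.
Qed.

Lemma sphere_integralE (f : n.-tuple R -> R) : measurable_fun setT f ->
  (forall x, 0 <= f x) ->
  (\int[@sphere_measure R n]_(w in @usphere R n) (f w)%:E
   = n%:R%:E * \int[mun]_(x in @unit_ball0 R n) (f (unitize x))%:E)%E.
Proof.
move=> mf f0.
pose nn : {nonneg R} := NngNum (ler0n R n).
pose push := measure_function_pushforward__canonical__measure_function_Measure
  mun measurable_cone_retract.
have mfE D : measurable_fun D (fun w => (f w)%:E).
  by apply/measurable_EFinP; exact: measurable_funTS.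
rewrite (@eq_measure_integral _ _ _ _ (mscale nn push)); last first.
  move=> A mA AS; transitivity ((n%:R)%:E * mun (cone_retract @^-1` A))%E => //.
  by rewrite preimage_cone_retract.
rewrite (ge0_integral_mscale push measurable_usphere nn (mfE _)) => [|x _]; last by rewrite lee_fin.
congr (_ * _)%E.
rewrite (@ge0_integral_pushforward _ _ _ _ _ _ measurable_cone_retract mun _ _ measurable_usphere (mfE _)) => [|x _]; last by rewrite lee_fin.
have -> : cone_retract @^-1` (@usphere R n) = @unit_ball0 R n.
  rewrite preimage_cone_retract//; apply/seteqP; split => x /=; first by case.
  by move=> xB; split => //; apply: enorm_unitize; case/andP: xB.
by apply: eq_integral => x; rewrite inE => xB /=; rewrite cone_retract_in.
Qed.

Variables (a b : R) (gamma : R -> n.-tuple R) (chi : R -> R).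
Hypothesis gamma_cont : forall i,
  {within `[a, b], continuous (fun t => tnth (gamma t) i)}.
Hypothesis chi_meas : measurable_fun setT chi.
Hypothesis chi01 : forall t, 0 <= chi t <= 1.

Lemma Gq_ge (r p lam : R) : 0 < p -> (0 < n)%N -> 0 <= lam ->
  (lam%:E <= \int[mun]_(x in @unit_ball0 R n) (fourier_size a b gamma chi r x `^ p)%:E)%E ->
  ((lam `^ p^-1)%:E <= Gq `[a, b] gamma chi p%:E r)%E.
Proof.
move=> p0 n0 lam0 H; rewrite /Gq.
have mF : measurable_fun setT (fun w =>
    Normc.normc (mu_hat `[a, b] gamma chi (escale r w)) `^ p).
  apply: (measurableT_comp (measurable_powR _)).
  exact: (measurableT_comp (measurable_mu_hat gamma_cont chi_meas chi01) (measurable_escale r)).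
rewrite (sphere_integralE mF) => [|x]; last exact: powR_ge0.
rewrite -poweR_EFin; apply: gt0_ler_poweR.
- by rewrite invr_ge0 ltW.
- by rewrite in_itv/= leey andbT lee_fin.
- by rewrite in_itv/= leey andbT mule_ge0// ?lee_fin// integral_ge0// => x _; rewrite lee_fin powR_ge0.
apply: (le_trans H); rewrite -[leLHS]mul1e; apply: lee_pmul => //.
- by apply: integral_ge0 => x _; rewrite lee_fin powR_ge0.
- by rewrite lee_fin ler1n.
Qed.

(** The case [p = 1] of [jensen_line] bounds an average of total mass 1 from below by [lam], and
    this average is at most the supremum. The segment must avoid the origin for its points to have a
    direction. *)
Lemma Gq_infty_ge (r lam tau : R) x e : 0 < lam ->
  (forall s, -1 <= s <= 1 -> 0 < enorm (tadd x (escale s e))) ->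
  let w s := escale r (unitize (tadd x (escale s e))) in
  2 * lam <= line_integral a b gamma chi tau w
    + line_integral a b gamma chi tau (w \o -%R) ->
  (lam%:E <= Gq `[a, b] gamma chi +oo r)%E.
Proof.
move=> lam0 xe w wl.
have := @jensen_line R n a b gamma chi gamma_cont chi_meas chi01 r x e tau 1 lam (lexx _) lam0 wl.
rewrite powRr1 ?(ltW lam0)// /Gq.
set S := ereal_sup _.
have FS y : 0 < enorm y -> ((fourier_size a b gamma chi r y)%:E <= S)%E.
  move=> y0; apply: ereal_sup_ubound; exists (unitize y) => //.
  exact: enorm_unitize.
have F0 y : 0 <= fourier_size a b gamma chi r y.
  by rewrite /fourier_size mu_hatE /Normc.normc sqrtr_ge0.
have [->|Soo] := eqVneq S +oo%E; first by rewrite leey.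
have S0 : (0 <= S)%E.
  apply: le_trans (FS (tadd x (escale 0 e)) (xe 0 _)); first by rewrite lee_fin.
  by rewrite lerN10 ler01.
have Sf : S \is a fin_num by rewrite ge0_fin_numE// lt_neqAle Soo leey.
have mt e' : measurable_fun setT (fun s : R => tadd x (escale s e')).
  by have /(_ x) := fun x => measurableT_comp (measurable_line e') (measurable_pair1 x); exact.
have half e' : (forall s, 0 <= s <= 1 -> 0 < enorm (tadd x (escale s e'))) ->
    (\int[lebesgue_measure]_s (tent s * fourier_size a b gamma chi r (tadd x (escale s e')) `^ 1)%:E
      <= (1 / 2)%:E * S)%E.
  move=> pos; rewrite -(fineK Sf) -integral_tent -ge0_integralZr//; last 3 first.
  - by apply/measurable_EFinP; exact: measurable_tent.
  - by move=> s _; rewrite lee_fin tent_ge0.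
  - by rewrite lee_fin fine_ge0.
  apply: ge0_le_integral => //.
  - by move=> s _; rewrite lee_fin mulr_ge0 ?tent_ge0 ?powR_ge0.
  - apply/measurable_EFinP; apply: measurable_funM; first exact: measurable_tent.
    apply: (measurableT_comp (measurable_powR _)).
    exact: (measurableT_comp (measurable_fourier_size gamma_cont chi_meas chi01 r) (mt e')).
  - apply/measurable_EFinP; apply: measurable_funM; first exact: measurable_tent.
    exact: measurable_cst.
  move=> s _; rewrite lee_fin powRr1//.
  have [s01|s01] := boolP (0 <= s <= 1).
    by rewrite ler_wpM2l ?tent_ge0// -lee_fin fineK// FS// pos.
  by rewrite /tent indicE memNset ?mul0r//= in_itv/=; exact/negP.
move=> /le_trans; apply.
apply: (@le_trans _ _ ((1 / 2)%:E * S + (1 / 2)%:E * S)%E).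
  apply: leeD; apply: half => s s01.
    by apply: xe; move: s01; clear -gamma_cont chi_meas chi01; lra.
  have -> : escale s (escale (-1) e) = escale (- s) e.
    by apply: eq_from_tnth => i; rewrite !tnth_mktuple; ring.
  by apply: xe; move: s01; clear -gamma_cont chi_meas chi01; lra.
rewrite -(fineK Sf) -!EFinM -EFinD lee_fin -mulrDl.
by rewrite (_ : 1 / 2 + 1 / 2 = 1) ?mul1r//; field.
Qed.

End sphere.

(** * Slabs and scales *)

Section curve_frame.
Context {R : realType} {n : nat}.
Variables (al be : R) (D : nat -> R -> n.-tuple R) (C0 : R) (J : nat).
Hypothesis C01 : 1 <= C0.
Hypothesis DD : forall j t i, al <= t <= be ->
  is_derive t 1 (fun s => tnth (D j s) i) (tnth (D j.+1 t) i).
Hypothesis DC : forall j t i, (j <= J)%N -> al <= t <= be -> `|tnth (D j t) i| <= C0.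
Implicit Types (x y z e : n.-tuple R) (s t r h tau : R).

Lemma is_derive_dotp x j t : al <= t <= be ->
  is_derive t 1 (fun s => dotp x (D j s)) (dotp x (D j.+1 t)).
Proof.
move=> tJ; have H i : is_derive t 1 (fun s => tnth x i * tnth (D j s) i) (tnth x i * tnth (D j.+1 t) i).
  by have := DD j i tJ => ?; apply: der_eq; eexists; [der|ring].
have := @is_derive_sum R R R n (fun i s => tnth x i * tnth (D j s) i) t 1 _ H.
rewrite (_ : (fun s => dotp x (D j s)) = \sum_(i < n) (fun s => tnth x i * tnth (D j s) i))//.
by apply/funext => s; rewrite /dotp fct_sumE.
Qed.

Lemma mvt_le (f f' : R -> R) (B : R) t tau : al <= t <= be -> al <= tau <= be ->
  (forall s, al <= s <= be -> `|s - tau| <= `|t - tau| -> is_derive s 1 f (f' s)) ->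
  (forall s, al <= s <= be -> `|s - tau| <= `|t - tau| -> `|f' s| <= B) ->
  `|f t - f tau| <= B * `|t - tau|.
Proof.
move=> tJ tauJ df fB.
have [/andP[t1 t2] /andP[u1 u2]] := (tJ, tauJ).
have [tt|tt] := leP tau t.
  have H s : tau <= s <= t -> al <= s <= be /\ `|s - tau| <= `|t - tau|.
    move=> /andP[s1 s2]; rewrite (le_trans u1 s1) (le_trans s2 t2).
    by rewrite !ger0_norm ?subr_ge0// lerD2r.
  have cf : {within `[tau, t], continuous f}.
    by apply: (@derive_continuous_within _ _ f') => s /H[? ?]; exact: df.
  have df' s : s \in `]tau, t[ -> is_derive s 1 f (f' s).
    by rewrite in_itv/= => /andP[s1 s2]; apply: df; have [] := H s ltac:(by rewrite !ltW).
  have [c cI ->] := MVT_segment tt df' cf.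
  by rewrite normrM ler_wpM2r//; apply: fB; move: cI; rewrite in_itv/= => /H[].
have H s : t <= s <= tau -> al <= s <= be /\ `|s - tau| <= `|t - tau|.
  move=> /andP[s1 s2]; rewrite (le_trans t1 s1) (le_trans s2 u2); split => //.
  by rewrite !ler0_norm ?subr_le0 ?(ltW tt)// lerN2 lerD2r.
have cf : {within `[t, tau], continuous f}.
  by apply: (@derive_continuous_within _ _ f') => s /H[? ?]; exact: df.
have df' s : s \in `]t, tau[ -> is_derive s 1 f (f' s).
  by rewrite in_itv/= => /andP[s1 s2]; apply: df; have [] := H s ltac:(by rewrite !ltW).
have [c cI E] := MVT_segment (ltW tt) df' cf.
rewrite distrC E normrM (distrC tau) ler_wpM2r//.
by apply: fB; move: cI; rewrite in_itv/= => /H[].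
Qed.

Lemma dotp_le x y (u v : R) : (forall i, `|tnth x i| <= u) ->
  (forall i, `|tnth y i| <= v) -> `|dotp x y| <= n%:R * (u * v).
Proof.
move=> xu yv; rewrite (le_trans (ler_norm_sum _ _ _))//.
apply: (@le_trans _ _ (\sum_(i < n) u * v)).
  by apply: ler_sum => i _; rewrite normrM ler_pM.
by rewrite sumr_const card_ord mulr_natl.
Qed.

Lemma dotp_D_lip x (u : R) j t tau : (j < J)%N -> (forall i, `|tnth x i| <= u) ->
  al <= t <= be -> al <= tau <= be ->
  `|dotp x (D j t) - dotp x (D j tau)| <= n%:R * (u * C0) * `|t - tau|.
Proof.
move=> jJ xu tJ tauJ.
apply: (@mvt_le (fun s => dotp x (D j s)) (fun s => dotp x (D j.+1 s))) => //.
  by move=> s sJ _; exact: is_derive_dotp.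
by move=> s sJ _; apply: dotp_le => // i; exact: DC.
Qed.

(** Descending induction on the order, starting from order [k.+1], which is controlled on the whole
    interval. Passing from order [j.+1] to order [j] integrates over a length at most [M h] and
    costs a factor [1 + M]. *)
Lemma taylor_bound x k tau (M h r beta : R) : 0 < h -> 0 <= M -> 0 < r -> 0 <= beta ->
  al <= tau <= be ->
  (forall j, (0 < j <= k)%N -> `|dotp x (D j tau)| <= 2 * beta / (r * h ^+ j)) ->
  (forall t, al <= t <= be -> `|dotp x (D k.+1 t)| <= 2 * beta / (r * h ^+ k.+1)) ->
  forall t, al <= t <= be -> `|t - tau| <= M * h ->
    r * `|dotp x (D 0 t) - dotp x (D 0 tau)| <= 2 * beta * M * (1 + M) ^+ k.
Proof.
move=> h0 M0 r0 b0 tauJ Hj Hk.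
have step i : (i <= k)%N -> forall t, al <= t <= be -> `|t - tau| <= M * h ->
    `|dotp x (D (k.+1 - i) t)| <= (1 + M) ^+ i * (2 * beta / (r * h ^+ (k.+1 - i))).
  elim: i => [_ t tJ tM|i IH ik t tJ tM].
    by rewrite subn0 expr0 mul1r; exact: Hk.
  have ki : (k.+1 - i = (k.+1 - i.+1).+1)%N by rewrite subnSK// ltnW.
  set j := (k.+1 - i.+1)%N in ki *.
  have jk : (0 < j <= k)%N by rewrite /j subn_gt0 ltnS ik subSS leq_subr.
  set B := 2 * beta / (r * h ^+ j).
  have B0 : 0 <= B by rewrite divr_ge0 ?mulr_ge0 ?exprn_ge0// ltW.
  have := @mvt_le (fun s => dotp x (D j s)) (fun s => dotp x (D j.+1 s))
    ((1 + M) ^+ i * (2 * beta / (r * h ^+ j.+1))) t tau tJ tauJ.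
  move=> /(_ (fun s sJ _ => is_derive_dotp x j sJ)) W.
  have {}W : `|dotp x (D j t) - dotp x (D j tau)|
      <= (1 + M) ^+ i * (2 * beta / (r * h ^+ j.+1)) * `|t - tau|.
    apply: W => s sJ st; rewrite -ki; apply: IH => //; first exact: ltnW.
    exact: le_trans st tM.
  have {}W : `|dotp x (D j t) - dotp x (D j tau)| <= (1 + M) ^+ i * M * B.
    rewrite (le_trans W)//.
    have -> : (1 + M) ^+ i * M * B = (1 + M) ^+ i * (2 * beta / (r * h ^+ j.+1)) * (M * h).
      by rewrite /B exprS; field; rewrite !gt_eqF// exprn_gt0.
    rewrite ler_wpM2l// mulr_ge0 ?exprn_ge0 ?addr_ge0//.
    by rewrite divr_ge0 ?mulr_ge0 ?exprn_ge0// ltW.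
  have -> : dotp x (D j t) = dotp x (D j tau) + (dotp x (D j t) - dotp x (D j tau)) by ring.
  rewrite (le_trans (ler_normD _ _))//.
  rewrite exprS mulrDl mul1r mulrDl (mulrC M) lerD//.
  rewrite (le_trans (Hj _ jk))// -/B ler_peMl// exprn_ege1// lerDl//.
move=> t tJ tM.
have := @mvt_le (fun s => dotp x (D 0 s)) (fun s => dotp x (D 1 s))
    ((1 + M) ^+ k * (2 * beta / (r * h ^+ 1))) t tau tJ tauJ
    (fun s sJ _ => is_derive_dotp x 0 sJ).
have -> : 2 * beta * M * (1 + M) ^+ k = r * ((1 + M) ^+ k * (2 * beta / (r * h ^+ 1)) * (M * h)).
  by field; rewrite !gt_eqF.
move=> W; rewrite ler_pM2l//; apply: (@le_trans _ _
   ((1 + M) ^+ k * (2 * beta / (r * h ^+ 1)) * `|t - tau|)).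
  apply: W => s sJ st; have := step k (leqnn k) s sJ (le_trans st tM).
  by rewrite subSnn.
rewrite ler_wpM2l// mulr_ge0 ?exprn_ge0 ?addr_ge0//.
by rewrite divr_ge0 ?mulr_ge0 ?exprn_ge0// ltW.
Qed.

End curve_frame.

Lemma integral_trivIset_ge d (T : measurableType d) (R : realType)
    (mu : {measure set T -> \bar R}) (N : nat) (U : nat -> set T) (B : set T)
    (f : T -> R) (A : nat -> R) :
  (forall i, (i < N)%N -> measurable (U i)) -> measurable B ->
  (forall i, (i < N)%N -> U i `<=` B) -> measurable_fun setT f -> (forall x, 0 <= f x) ->
  (forall i j x, (i < j < N)%N -> U i x -> U j x -> False) ->
  (forall i, (i < N)%N -> ((A i)%:E <= \int[mu]_(x in U i) (f x)%:E)%E) ->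
  ((\sum_(i < N) A i)%:E <= \int[mu]_(x in B) (f x)%:E)%E.
Proof.
move=> mU mB UB mf f0 tU HA.
have mf' S : measurable_fun S (fun x => (f x)%:E).
  by apply/measurable_EFinP; exact: measurable_funTS.
have mV M : (M <= N)%N -> measurable (\bigcup_(i < M) U i).
  by move=> MN; apply: bigcup_measurable => i /= iM; apply: mU; exact: leq_trans MN.
apply: (@le_trans _ _ (\int[mu]_(x in \bigcup_(i < N) U i) (f x)%:E)%E); last first.
  apply: ge0_subset_integral => //; [exact: mV|by move=> x _; rewrite lee_fin|].
  by move=> x [i /= iN]; apply: UB.
suff H M : (M <= N)%N -> ((\sum_(i < M) A i)%:E <=
    \int[mu]_(x in \bigcup_(i < M) U i) (f x)%:E)%E by exact: H.
elim: M => [_|M IH MN].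
  by rewrite big_ord0 integral_ge0// => x _; rewrite lee_fin.
have -> : \bigcup_(i < M.+1) U i = \bigcup_(i < M) U i `|` U M.
  by rewrite !bigcup_mkord big_ord_recr.
rewrite big_ord_recr/= EFinD ge0_integral_setU//.
- by apply: leeD; [exact/IH/ltnW|exact: HA].
- exact/mV/ltnW.
- exact: mU.
- by move=> x _; rewrite lee_fin.
apply/disj_set2P/seteqP; split => // x [[i /= iM] Ui UM].
by apply: (tU i M x) => //; rewrite iM.
Qed.

(** The origin of the critical exponents: the slab volume brings [h^-(1 + ... + k)], and the number
    of centers one more [h^-1]. *)
Lemma q_sum (R : realType) (k : nat) : (\sum_(j < k) j.+1).+1%:R = q_ k :> R.
Proof.
rewrite -natr1 /q_; elim: k => [|k IH].
  by rewrite big_ord0; field.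
by rewrite big_ord_recr/= natrD -addrA (addrC _ 1) addrA IH -natr1; field.
Qed.

(** * Powers and logarithms with uniform constants *)

Section powers.
Context {R : realType}.
Implicit Types c e r g V W s q a : R.

Lemma powR_large c e : 0 < c -> 0 < e ->
  exists r0, 1 <= r0 /\ forall r, r0 < r -> 1 <= c * r `^ e.
Proof.
move=> c0 e0; exists (Num.max 1 ((c^-1) `^ e^-1)); split; first by rewrite le_max lexx.
move=> r; rewrite gt_max => /andP[r1 rc].
have c1 : 0 <= c^-1 by rewrite invr_ge0 ltW.
rewrite -ler_pdivrMl// mulr1.
have -> : c^-1 = (c^-1 `^ e^-1) `^ e by rewrite -powRrM mulVf ?gt_eqF// powRr1.
rewrite ge0_ler_powR ?nnegrE ?powR_ge0//; [exact: ltW|exact: le_trans ler01 (ltW r1)|exact: ltW].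
Qed.

(** Used with the exponents [1 / q] and [(q - q_k) / q], which stay bounded for [q >= 1]: this is
    how constants independent of [q] arise. *)
Lemma powR_pinch W (B : R) : 0 < W -> exists c, 0 < c <= 1 /\ forall e, `|e| <= B -> c <= W `^ e.
Proof.
move=> W0; exists (expR (- (`|B| * `|ln W|))); split.
  by rewrite expR_gt0/= -expR0 ler_expR oppr_le0 mulr_ge0.
move=> e eB; rewrite /powR gt_eqF// ler_expR lerNl.
apply: (le_trans (ler_norm _)); rewrite normrN normrM ler_wpM2r//.
exact: le_trans (ler_norm _).
Qed.

(** Follows from [4 <= e^2]. It says that of the order of [ln r] consecutive 4-adic scales stay
    within a prescribed small power of [r]. *)
Lemma dyadic a r (i k : nat) : 1 <= r -> i%:R <= a * ln r ->
  4 ^+ (i * k) <= r `^ (2 * (a * k%:R)).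
Proof.
move=> r1 ia; have r0 : 0 < r := lt_le_trans ltr01 r1.
have e4 : (4 : R) <= expR 2.
  have e2 : (2 : R) <= expR 1 by have := expR_ge1Dx (1 : R).
  have -> : 2 = 1 + 1 :> R by [].
  rewrite expRD (_ : 4 = 2 * 2); last by rewrite -natrM.
  by rewrite ler_pM.
rewrite /powR gt_eqF//; apply: (@le_trans _ _ (expR 2 ^+ (i * k))).
  by rewrite lerXn2r// nnegrE// ltW ?expR_gt0.
rewrite -expRM_natl ler_expR natrM.
have -> : 2 * (a * k%:R) * ln r = a * ln r * k%:R * 2 by ring.
by rewrite ler_wpM2r// ler_wpM2r.
Qed.

(** The constant is chosen before [q], so one [c] serves all finite exponents. The clause
    [c <= g * W] makes it serve [q = +oo] too, where a scale [h = W r^(-s)] contributes [g h]. *)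
Lemma power_bound g V W s (qk : R) : 0 < g -> 0 < V -> 0 < W -> exists c, [/\ 0 < c, c <= g * W &
  forall q r (k : nat), 1 <= q -> 0 < r -> c * r `^ (- ((s * (q - qk) + k%:R) / q)) <=
    (g `^ q * V * (W * r `^ (- s)) `^ (q - qk) / r ^+ k) `^ q^-1].
Proof.
move=> g0 V0 W0.
have [c1 [/andP[c10 c11] H1]] := powR_pinch 1 V0.
have [c2 [/andP[c20 c21] H2]] := powR_pinch (1 + `|qk|) W0.
exists (g * (c1 * c2)); split; first by rewrite !mulr_gt0.
  rewrite ler_pM2l// -[leRHS]mul1r ler_pM// ?(ltW c10) ?(ltW c20)//.
  rewrite -[leRHS](powRr1 (ltW W0)); apply: H2.
  by rewrite normr1 lerDl.
move=> q r k q1 r0; have q0 : 0 < q := lt_le_trans ltr01 q1.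
have qn : q != 0 by rewrite gt_eqF.
have -> : (r ^+ k)^-1 = r `^ (- k%:R) by rewrite powRN powR_mulrn// ltW.
rewrite !powRM ?mulr_ge0 ?powR_ge0 ?(ltW W0) ?(ltW V0) ?(ltW g0)//.
rewrite -!powRrM mulfV// powRr1 ?(ltW g0)// -!mulrA ler_pM2l//.
apply: ler_pM; rewrite ?(ltW c10) ?mulr_ge0 ?(ltW c20) ?powR_ge0//.
  by apply: H1; rewrite ger0_norm ?invr_ge0 ?(ltW q0)// invf_le1.
apply: ler_pM; rewrite ?(ltW c20) ?powR_ge0//.
  apply: H2; rewrite mulrBl mulfV// (le_trans (ler_normB _ _))// normr1 lerD2l.
  by rewrite normrM ler_piMr// ger0_norm ?invr_ge0 ?(ltW q0)// invf_le1.
rewrite -powRD; last by rewrite (gt_eqF r0) implybT.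
by rewrite le_eqVlt; apply/orP; left; apply/eqP; congr (_ `^ _); field.
Qed.

Lemma log_bound g V a q (k : nat) : 0 < g -> 0 < V -> 0 < a -> 0 < q ->
  exists c, 0 < c /\ forall r (L : nat), 1 <= r -> a * ln r <= L%:R ->
    c * r `^ (- (k%:R / q)) * ln r `^ (1 / q) <= (g `^ q * V * L%:R / r ^+ k) `^ q^-1.
Proof.
move=> g0 V0 a0 q0; exists ((g `^ q * V * a) `^ q^-1); split.
  by rewrite powR_gt0// !mulr_gt0// powR_gt0.
move=> r L r1 aL; have r0 : 0 < r := lt_le_trans ltr01 r1.
have l0 : 0 <= ln r by rewrite ln_ge0.
have gV : 0 <= g `^ q * V by rewrite mulr_ge0 ?powR_ge0// ltW.
have -> : - (k%:R / q) = - k%:R * q^-1 by rewrite mulNr.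
rewrite powRrM div1r -!powRM ?mulr_ge0 ?powR_ge0 ?(ltW a0) ?(ltW V0)//.
rewrite powRN powR_mulrn ?(ltW r0)//.
have rk : 0 <= (r ^+ k)^-1 by rewrite invr_ge0 exprn_ge0// ltW.
apply: ge0_ler_powR; rewrite ?nnegrE ?invr_ge0 ?(ltW q0)//.
- by rewrite mulr_ge0// mulr_ge0// mulr_ge0// ltW.
- by rewrite mulr_ge0// mulr_ge0.
set B := g `^ q * V in gV *.
have -> : B * a * (r ^+ k)^-1 * ln r = B * (a * ln r) * (r ^+ k)^-1 by ring.
by rewrite ler_wpM2r// ler_wpM2l.
Qed.

End powers.

(** * The contribution of a single scale *)

Section scale.
Context {R : realType} {n : nat}.
(** Three nested intervals: the curve is given on [[a, b]]; [chi] vanishes off [[al, be]], where the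
    [D j] are classical derivatives with uniform bounds; [chi >= chi0] on [[al', be']], which
    contains the centers [tau]. [Ce] bounds the dual vectors, and [m] bounds [|x|^2] from below on
    the slabs. *)
Variables (a b al be al' be' : R) (gamma : R -> n.-tuple R) (chi : R -> R).
Variables (D : nat -> R -> n.-tuple R) (C0 Ce m chi0 : R) (J : nat).
Hypothesis gamma_cont : forall i,
  {within `[a, b], continuous (fun t => tnth (gamma t) i)}.
Hypothesis chi_meas : measurable_fun setT chi.
Hypothesis chi01 : forall t, 0 <= chi t <= 1.
Hypothesis C01 : 1 <= C0.
Hypothesis DD : forall j t i, al <= t <= be ->
  is_derive t 1 (fun s => tnth (D j s) i) (tnth (D j.+1 t) i).
Hypothesis DC : forall j t i, (j <= J)%N -> al <= t <= be -> `|tnth (D j t) i| <= C0.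
Hypothesis D0 : forall t, al <= t <= be -> gamma t = D 0 t.
Hypothesis chi_supp : forall t, chi t != 0 -> al <= t <= be.
Hypothesis chi_ge : forall t, al' <= t <= be' -> chi0 <= chi t.
Hypothesis order : [/\ a <= al, al <= al', be' <= be & be <= b].
Hypothesis m01 : 0 < m <= 1.
Hypothesis chi001 : 0 < chi0 <= 1.
Hypothesis Ce1 : 1 <= Ce.
Hypothesis n0 : (0 < n)%N.
Hypothesis J2 : (2 <= J)%N.
Implicit Types (x y z e : n.-tuple R) (s t r h tau : R).

Local Ltac slra := clear -gamma_cont chi_meas chi01 C01 DD DC D0 chi_supp chi_ge
  order m01 chi001 Ce1 n0 J2; lra.

(* [cutoff], [defect] and [gain] are the constants of [pointwise_estimate]; [window]
   makes the bound of [taylor_bound] at distance [cutoff * h] equal to the phase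
   error allowed there. *)
Definition cutoff : R := 32 * 32 * 32 / (m ^+ 3 * chi0).
Definition defect : R := m * chi0 / (32 * cutoff).
(** For [|x_i| <= 1] and a step [s0 <= 1], the displacement [e' = s0 e] satisfies
    [|<x, e'>| + |e'|^2 <= s0 * dir_size]. The bound [s0 <= step_size] turns this into the smallness
    conditions of [pointwise_estimate]. *)
Definition dir_size : R := n%:R * (Ce + Ce * Ce).
Definition step_size : R := m ^+ 2 * defect / (16 * cutoff * dir_size).
Definition window (k : nat) : R := m * defect / (8 * cutoff * (1 + cutoff) ^+ k).
Definition gain : R := m * chi0 / 16.

(** On so short an interval [<e, gamma'>] stays within [1/2] of its value 1 at [tau], and by
    [short2] the function [<x, gamma'>] stays close to its small value at [tau]. *)
Hypothesis short1 : (be - al) * (n%:R * (Ce * C0)) <= 1 / 2.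
Hypothesis short2 : (be - al) * (n%:R * (1 * C0)) <= m / (32 * dir_size).

Lemma cutoff_ge1 : 1 <= cutoff.
Proof.
have /andP[m0 m1] := m01; have /andP[c0 c1] := chi001.
rewrite /cutoff ler_pdivlMr ?mulr_gt0 ?exprn_gt0// mul1r.
apply: (@le_trans _ _ 1); last by rewrite -2!natrM ler1n.
by rewrite mulr_ile1 ?exprn_ge0 ?(ltW m0) ?(ltW c0)// exprn_ile1// ltW.
Qed.

Lemma defect_bounds : 0 < defect <= 1 / 32.
Proof.
have /andP[m0 m1] := m01; have /andP[c0 c1] := chi001.
have M1 := cutoff_ge1; have M0 : 0 < cutoff := lt_le_trans ltr01 M1.
apply/andP; split; first by apply: divr_gt0; apply: mulr_gt0.
rewrite /defect ler_pdivrMr; last exact: mulr_gt0.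
have : m * chi0 <= 1 by rewrite mulr_ile1// ltW.
by move: M1; set M := cutoff; slra.
Qed.

Lemma dir_size_ge1 : 1 <= dir_size.
Proof.
rewrite /dir_size -[leLHS]mulr1 ler_pM ?ler1n// (le_trans Ce1)// lerDl.
by rewrite mulr_ge0// (le_trans ler01 Ce1).
Qed.

Lemma window_bounds k : 0 < window k <= 1.
Proof.
have /andP[m0 m1] := m01; have /andP[d0 d1] := defect_bounds.
have M1 := cutoff_ge1; have M0 : 0 < cutoff := lt_le_trans ltr01 M1.
have P1 : 1 <= (1 + cutoff) ^+ k by rewrite exprn_ege1// lerDl ltW.
have P0 : 0 < (1 + cutoff) ^+ k := lt_le_trans ltr01 P1.
apply/andP; split; first by apply: divr_gt0; [|apply: mulr_gt0 => //]; apply: mulr_gt0.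
rewrite /window ler_pdivrMr ?mul1r; last by apply: mulr_gt0 => //; apply: mulr_gt0.
apply: (@le_trans _ _ 1); first by rewrite mulr_ile1 ?(ltW m0) ?(ltW d0)// (le_trans d1); lra.
have M8 : 1 <= 8 * cutoff by move: M1; set M := cutoff; slra.
by rewrite -[leLHS]mulr1 ler_pM.
Qed.

Lemma step_size_gt0 : 0 < step_size.
Proof.
have /andP[m0 m1] := m01; have /andP[d0 d1] := defect_bounds.
have M0 : 0 < cutoff := lt_le_trans ltr01 cutoff_ge1.
have E0 : 0 < dir_size := lt_le_trans ltr01 dir_size_ge1.
by apply: divr_gt0; [apply: mulr_gt0; rewrite ?exprn_gt0|apply: mulr_gt0 => //; apply: mulr_gt0].
Qed.

(** After scaling by [1 / (r h)] the displacement has frequency [(t - tau) / h] up to a factor 2, as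
    [pointwise_estimate] demands. The slab conditions enter through [taylor_bound], for times up to
    [cutoff * h], and through order 1 alone beyond. *)
Lemma scale_line x e tau r h k : (0 < k < J)%N ->
  0 < r -> 0 < h -> 1 / (r * h) <= step_size -> 1 / (r * h) <= 1 ->
  al' <= tau - cutoff * h -> tau + cutoff * h <= be' ->
  (forall i, `|tnth x i| <= 1) -> (forall i, `|tnth e i| <= Ce) ->
  dotp e (D 1 tau) = 1 ->
  (forall s, -1 <= s <= 1 ->
    m <= dotp (tadd x (escale s (escale (1 / (r * h)) e)))
              (tadd x (escale s (escale (1 / (r * h)) e))) <= 1) ->
  (forall j, (0 < j <= k)%N -> `|dotp x (D j tau)| <= 2 * window k / (r * h ^+ j)) ->
  (forall t, al <= t <= be -> `|dotp x (D k.+1 t)| <= 2 * window k / (r * h ^+ k.+1)) ->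
  let w s := escale r (unitize (tadd x (escale s (escale (1 / (r * h)) e)))) in
  is_true (2 * (gain * h) <= line_integral a b gamma chi tau w
    + line_integral a b gamma chi tau (w \o -%R)).
Proof.
move=> /andP[k0 kJ] r0 h0 s1 s11 alt bet x1 eC e1 Hm Hj Hk w.
have /andP[m0 m1] := m01; have /andP[d0 d1] := defect_bounds.
have [ord1 ord2 ord3 ord4] := order.
have M1 := cutoff_ge1; have M0 : 0 < cutoff := lt_le_trans ltr01 M1.
have E1 := dir_size_ge1; have E0 : 0 < dir_size := lt_le_trans ltr01 E1.
have /andP[w0 w1] := window_bounds k.
have rh0 : 0 < r * h by rewrite mulr_gt0.
have Mh0 : 0 < cutoff * h by rewrite mulr_gt0.
have tauJ : al <= tau <= be.
  by move: ord2 ord3 alt bet Mh0; set M := cutoff * h; slra.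
have tauab : a <= tau <= b.
  by move: ord1 ord4 tauJ; slra.
set s0 := 1 / (r * h) in s1 s11 Hm w *.
have s00 : 0 < s0 by rewrite divr_gt0.
set e' := escale s0 e in Hm w *.
have n1 : 1 <= n%:R :> R by rewrite ler1n.
have Bx : `|dotp x e'| <= s0 * (n%:R * (1 * Ce)).
  by rewrite dotpC dotp_escale normrM gtr0_norm// ler_wpM2l ?(ltW s00)// dotpC; exact: dotp_le.
have Be : dotp e' e' <= s0 * (n%:R * (Ce * Ce)).
  rewrite dotp_escale dotpC dotp_escale mulrA -[s0 * s0]expr2.
  apply: ler_pM => //; first exact: sqr_ge0.
  - exact: dotp_ge0.
  - by rewrite expr2 ler_piMl// ltW.
  - by rewrite (le_trans (ler_norm _))// dotp_le.
have BC : `|dotp x e'| + dotp e' e' <= s0 * dir_size.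
  rewrite /dir_size (_ : s0 * _ = s0 * (n%:R * (1 * Ce)) + s0 * (n%:R * (Ce * Ce))); last by ring.
  exact: lerD.
have BC2 : 2 * `|dotp x e'| + dotp e' e' <= 2 * (s0 * dir_size).
  have := dotp_ge0 e'; move: BC; slra.
have sE : 2 * (s0 * dir_size) <= m ^+ 2 * defect / (8 * cutoff).
  have -> : m ^+ 2 * defect / (8 * cutoff) = 2 * (step_size * dir_size).
    by rewrite /step_size; field; rewrite !gt_eqF.
  by rewrite ler_pM2l// ler_wpM2r// ltW.
have md8 : m ^+ 2 * defect / (8 * cutoff) <= m / 8 * (1 / 32).
  rewrite ler_pdivrMr; last exact: mulr_gt0.
  rewrite expr2.
  have : m * defect <= 1 * (1 / 32) by rewrite ler_pM ?(ltW m0) ?(ltW d0).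
  move=> H; rewrite -[m * m * defect]mulrA.
  have -> : m / 8 * (1 / 32) * (8 * cutoff) = m * (1 * (1 / 32) * cutoff) by field.
  rewrite ler_pM2l// (le_trans H)// ler_peMr//.
have := @pointwise_estimate R n a b gamma chi gamma_cont chi_meas chi01 x e' tau r h
   m chi0 cutoff defect h0 m01 chi001 r0 erefl erefl tauab.
have -> : 2 * (gain * h) = m * chi0 / 8 * h by rewrite /gain; field.
apply => //.
- by move=> s s01; rewrite -dotp_line; exact: Hm.
- rewrite (le_trans BC)//; move: sE md8.
  by have : 0 <= s0 * dir_size by [rewrite mulr_ge0// ltW]; move: m0; slra.
- exact: le_trans sE.
- move=> t tab ct; have tJ := chi_supp ct.
  have tt : `|t - tau| <= be - al.
    by rewrite ler_norml; move: tJ tauJ; slra.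
  (* The derivative of [<e, D 0 s> - s] vanishes at [tau] and is at most [1/2] in absolute value by
     [short1]. *)
  have G : `|dotp e (D 0 t) - dotp e (D 0 tau) - (t - tau)| <= `|t - tau| / 2.
    have := @mvt_le R al be (fun s => dotp e (D 0 s) - s) (fun s => dotp e (D 1 s) - 1)
      (1 / 2) t tau tJ tauJ.
    have -> : dotp e (D 0 t) - t - (dotp e (D 0 tau) - tau) =
       dotp e (D 0 t) - dotp e (D 0 tau) - (t - tau) by ring.
    rewrite mul1r mulrC; apply.
      move=> s sJ _; have := is_derive_dotp DD e 0 sJ => ?.
      by apply: der_eq; eexists; [der|].
    move=> s sJ st.
    have -> : dotp e (D 1 s) - 1 = dotp e (D 1 s) - dotp e (D 1 tau) by rewrite e1.
    apply: (le_trans (dotp_D_lip DD DC J2 eC sJ tauJ)).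
    apply: (@le_trans _ _ ((be - al) * (n%:R * (Ce * C0)))); last first.
      by move: short1; set q := (be - al) * _; slra.
    rewrite mulrC ler_wpM2r//; last exact: le_trans tt.
    by rewrite !mulr_ge0// (le_trans ler01).
  have G' : r * (dotp e' (gamma t) - dotp e' (gamma tau)) =
      (dotp e (D 0 t) - dotp e (D 0 tau)) / h.
    rewrite !D0// !dotp_escale /s0; field.
    by rewrite !gt_eqF.
  move: G; rewrite G' normrM normfV (gtr0_norm h0) => G.
  set g := dotp e (D 0 t) - dotp e (D 0 tau) in G *.
  have [g1 g2] : `|t - tau| / 2 <= `|g| /\ `|g| <= 2 * `|t - tau|.
    have h1 := ler_normD (g - (t - tau)) (t - tau).
    have h2 := ler_normB g (g - (t - tau)).
    rewrite subrK in h1; rewrite subKr in h2.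
    by move: h1 h2 G (normr_ge0 (t - tau)); slra.
  split.
  + rewrite (_ : `|t - tau| / (2 * h) = `|t - tau| / 2 / h); last by field; rewrite gt_eqF.
    by rewrite ler_wpM2r// invr_ge0 ltW.
  + by rewrite ler_wpM2r// invr_ge0 ltW.
  (* Half of this slope is the value of [<x, D 1>] at [tau], bounded by [2 / (r h)]; the other half
     is its oscillation, bounded by [short2]. *)
  have X1 : `|dotp x (gamma t) - dotp x (gamma tau)| <= m / (16 * dir_size) * `|t - tau|.
    rewrite !D0//; apply: (@mvt_le R al be (fun s => dotp x (D 0 s)) (fun s => dotp x (D 1 s))) => //.
      by move=> s sJ _; exact: is_derive_dotp.
    move=> s sJ st.
    have L1 := dotp_D_lip DD DC J2 x1 sJ tauJ.
    have L2 : `|dotp x (D 1 s) - dotp x (D 1 tau)| <= m / (32 * dir_size).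
      apply: (le_trans L1); apply: le_trans short2.
      rewrite mulrC ler_wpM2r//; last exact: le_trans tt.
      by rewrite !mulr_ge0// (le_trans ler01).
    have L3 : `|dotp x (D 1 tau)| <= m / (32 * dir_size).
      have /Hj : (0 < 1 <= k)%N by rewrite k0.
      rewrite expr1 => /le_trans; apply.
      apply: (@le_trans _ _ (2 * s0)).
        by rewrite -mulrA ler_pM2l// /s0 ler_wpM2r// invr_ge0 ltW.
      rewrite ler_pdivlMr; last exact: mulr_gt0.
      by move: sE md8 m0; set q := s0 * dir_size; rewrite (_ : 2 * s0 * (32 * dir_size) = 64 * q); [slra|rewrite /q; ring].
    have -> : dotp x (D 1 s) = dotp x (D 1 tau) + (dotp x (D 1 s) - dotp x (D 1 tau)) by ring.
    rewrite (le_trans (ler_normD _ _))//.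
    have -> : m / (16 * dir_size) = m / (32 * dir_size) + m / (32 * dir_size).
      by field; rewrite gt_eqF.
    exact: lerD.
  apply: (@le_trans _ _ (r * (m / (16 * dir_size) * `|t - tau|) * (s0 * dir_size))).
    apply: ler_pM => //; first by rewrite mulr_ge0// ltW.
    - by rewrite addr_ge0// dotp_ge0.
    - by rewrite ler_pM2l.
  rewrite le_eqVlt; apply/orP; left; apply/eqP; rewrite /s0; field.
  by rewrite !gt_eqF.
- exact: le_trans (le_trans ord1 ord2) alt.
- by move: bet ord3 ord4; set M := cutoff * h; slra.
- move=> t tM; apply: chi_ge; move: tM; rewrite ler_norml.
  by move: alt bet; set M := cutoff * h; slra.
- move=> t tM.
  have tJ : al <= t <= be.
    by move: tM alt bet ord2 ord3; rewrite ler_norml; set M := cutoff * h; slra.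
  rewrite !D0//.
  have := taylor_bound DD h0 (ltW M0) r0 (ltW w0) tauJ Hj Hk tJ tM.
  move=> /le_trans; apply; rewrite le_eqVlt; apply/orP; left; apply/eqP.
  rewrite /window; field.
  by rewrite expf_neq0 ?gt_eqF// addr_gt0.
Qed.

Definition height (k : nat) r h : R := window k / (r * h ^+ k).

(* The box and the bounds for [j < k] are twice those under which [slab_line] starts:
   this leaves room for the displacement along [e]. *)
Definition slab (k : nat) r h tau z (rho : R) : set (n.-tuple R) :=
  [set x | [/\ forall i, `|tnth x i - tnth z i| <= 2 * rho,
    forall j, (0 < j < k)%N -> `|dotp x (D j tau)| <= 2 / (r * h ^+ j) &
    height k r h <= dotp x (D k tau) <= 2 * height k r h]].

Lemma measurable_norm_le (f : n.-tuple R -> R) (c : R) : measurable_fun setT f ->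
  measurable [set x | `|f x| <= c].
Proof.
move=> mf; rewrite (_ : [set x | _] = f @^-1` `[- c, c]); last first.
  by apply/seteqP; split => x /=; rewrite in_itv/= ler_norml.
by rewrite -[X in measurable X]setTI; apply: mf.
Qed.

Lemma measurable_box z (c : R) :
  measurable [set x : n.-tuple R | forall i, `|tnth x i - tnth z i| <= c].
Proof.
rewrite (_ : [set x | _] = \bigcap_(i in [set: 'I_n]) [set x | `|tnth x i - tnth z i| <= c]).
  apply: fin_bigcap_measurable => [|i _]; first exact: finite_finset.
  apply: measurable_norm_le; apply: measurable_funB; first exact: measurable_tnth.
  exact: measurable_cst.
by apply/seteqP; split => x /= H i => [_|]; [exact: H|exact: (H i I)].
Qed.

Lemma measurable_slab k r h tau z rho : measurable (slab k r h tau z rho).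
Proof.
rewrite (_ : slab _ _ _ _ _ _ = [set x : n.-tuple R | forall i, `|tnth x i - tnth z i| <= 2 * rho]
  `&` (\bigcap_(j in [set j | (0 < j < k)%N]) [set x | `|dotp x (D j tau)| <= 2 / (r * h ^+ j)]
  `&` (fun x => dotp x (D k tau)) @^-1` `[height k r h, 2 * height k r h])); last first.
  apply/seteqP; split => x /=.
    by move=> [H1 H2 H3]; split => //; split => //; rewrite in_itv.
  by rewrite in_itv/= => -[H1 [H2 H3]]; split.
apply: measurableI; first exact: measurable_box.
apply: measurableI.
  apply: fin_bigcap_measurable => [|j _].
    by apply: (sub_finite_set _ (finite_II k)) => j /= /andP[].
  by apply: measurable_norm_le; exact: measurable_dotp.
by rewrite -[X in measurable X]setTI; apply: measurable_dotp.
Qed.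

(** Since [e] is orthogonal to the derivatives of orders 2 to [k], the motion changes only the first
    pairing, by at most [1 / (r h)]. The pairing of order [k], which carries the sharp two-sided
    condition, does not move because [k >= 2]. *)
Lemma slab_line (k : nat) tau r h z e (rho : R) x : (2 <= k < J)%N ->
  0 < r -> 0 < h -> 1 / (r * h) <= step_size -> 1 / (r * h) <= 1 ->
  al' <= tau - cutoff * h -> tau + cutoff * h <= be' ->
  0 < rho -> Ce / (r * h) <= rho ->
  (forall x, (forall i, `|tnth x i - tnth z i| <= 2 * rho) ->
    m <= dotp x x <= 1 /\
    forall t, al <= t <= be -> `|dotp x (D k.+1 t)| <= 2 * window k / (r * h ^+ k.+1)) ->
  (forall i, `|tnth e i| <= Ce) ->
  dotp e (D 1 tau) = 1 -> (forall j, (1 < j <= k)%N -> dotp e (D j tau) = 0) ->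
  (forall i, `|tnth x i - tnth z i| <= rho) ->
  (forall j, (0 < j < k)%N -> `|dotp x (D j tau)| <= window k / (r * h ^+ j)) ->
  height k r h <= dotp x (D k tau) <= 2 * height k r h ->
  let e' := escale (1 / (r * h)) e in
  let w s := escale r (unitize (tadd x (escale s e'))) in
  [/\ forall s, -1 <= s <= 1 -> slab k r h tau z rho (tadd x (escale s e')),
    forall s, -1 <= s <= 1 -> m <= dotp (tadd x (escale s e')) (tadd x (escale s e')) <= 1 &
    2 * (gain * h) <= line_integral a b gamma chi tau w
    + line_integral a b gamma chi tau (w \o -%R)].
Proof.
move=> /andP[k2 kJ] r0 h0 s1 s11 alt bet rho0 Cerho Hz eC e1 ej xz xj xk e' w.
have /andP[w0 w1] := window_bounds k.
have rh0 : 0 < r * h by rewrite mulr_gt0.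
have line s : -1 <= s <= 1 -> forall i, `|tnth (tadd x (escale s e')) i - tnth z i| <= 2 * rho.
  move=> s01 i; rewrite !tnth_mktuple.
  have -> : tnth x i + s * (1 / (r * h) * tnth e i) - tnth z i =
     tnth x i - tnth z i + s * (tnth e i / (r * h)) by ring.
  rewrite (le_trans (ler_normD _ _))// (_ : 2 * rho = rho + rho); last by ring.
  rewrite lerD// normrM -[leRHS]mul1r ler_pM//; first by rewrite ler_norml.
  rewrite normrM normfV (gtr0_norm rh0) (le_trans _ Cerho)// ler_wpM2r//.
  by rewrite invr_ge0 ltW.
have lm s (s01 : -1 <= s <= 1) := (Hz _ (line s s01)).1.
have x0 : tadd x (escale 0 e') = x.
  by apply: eq_from_tnth => i; rewrite !tnth_mktuple mul0r addr0.
have s0 : -1 <= (0 : R) <= 1.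
  by apply/andP; split; rewrite ?oppr_le0; exact: ler01.
have [xm xk1] : m <= dotp x x <= 1 /\
    forall t, al <= t <= be -> `|dotp x (D k.+1 t)| <= 2 * window k / (r * h ^+ k.+1).
  by rewrite -x0; exact: Hz (line 0 s0).
have x1 i : `|tnth x i| <= 1.
  have /andP[_ X] := xm; rewrite -sqrtr1 -sqrtr_sqr ler_wsqrtr// (le_trans _ X)//.
  by rewrite /dotp (bigD1 i)//= -expr2 lerDl sumr_ge0// => j _; rewrite -expr2 sqr_ge0.
have hk0 : 0 < height k r h by rewrite divr_gt0// mulr_gt0// exprn_gt0.
have pos j : 0 < r * h ^+ j by rewrite mulr_gt0// exprn_gt0.
split => //.
- move=> s s01; split; first exact: line.
  + move=> j /andP[j0 jk].
    rewrite dotp_tadd !dotp_escale.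
    have [->|j1] := eqVneq j 1%N.
      rewrite e1 mulr1 expr1 (le_trans (ler_normD _ _))//.
      have -> : 2 / (r * h) = 1 / (r * h) + 1 / (r * h) by ring.
      rewrite lerD//.
        have /xj : (0 < 1 < k)%N by rewrite k2.
        rewrite expr1 => /le_trans; apply; rewrite ler_wpM2r// invr_ge0 ltW//.
      have i0 : 0 <= 1 / (r * h) by rewrite divr_ge0// ltW.
      by rewrite normrM (ger0_norm i0) ler_piMl// ler_norml.
    rewrite ej ?mulr0 ?addr0; last by rewrite ltn_neqAle eq_sym j1 j0/= ltnW.
    rewrite (le_trans (xj _ _)) ?j0// ler_wpM2r ?invr_ge0 ?(ltW (pos j))//.
    by rewrite (le_trans w1)// ler1n.
  + by rewrite dotp_tadd !dotp_escale ej ?mulr0 ?addr0// k2 leqnn.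
- apply: (scale_line (k := k)) => //.
  + by rewrite (leq_trans _ k2).
  + move=> j /andP[j0]; rewrite leq_eqVlt => /predU1P[->|jk].
      have /andP[d1 d2] := xk.
      by rewrite ger0_norm ?(le_trans (ltW hk0))// (le_trans d2)// /height mulrA.
    rewrite (le_trans (xj _ _)) ?j0// ler_wpM2r ?invr_ge0 ?(ltW (pos j))//.
    by rewrite ler_peMl ?(ltW w0)// ler1n.
Qed.

(** The volume guaranteed by [slab_measure_ge] for the starting set, with the powers of [h] taken
    out. [n%:R * C0 + 1] bounds the functionals on the cube, and 8 is the pigeonhole factor 4 times
    the 2 from half-widths. *)
Definition volume (k : nat) r (rho : R) : R :=
  rho ^+ n * (window k / (8 * (n%:R * C0 + 1)) / r) ^+ k.

Lemma slab_integral (k : nat) tau r h z e (rho p : R) : (2 <= k < J)%N ->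
  0 < r -> 0 < h <= 1 -> 1 / (r * h) <= step_size -> 1 / (r * h) <= 1 ->
  al' <= tau - cutoff * h -> tau + cutoff * h <= be' ->
  0 < rho <= 1 -> Ce / (r * h) <= rho -> height k r h <= 1 -> 1 <= p ->
  (forall x, (forall i, `|tnth x i - tnth z i| <= 2 * rho) ->
    m <= dotp x x <= 1 /\
    forall t, al <= t <= be -> `|dotp x (D k.+1 t)| <= 2 * window k / (r * h ^+ k.+1)) ->
  (forall i, `|tnth e i| <= Ce) ->
  dotp e (D 1 tau) = 1 -> (forall j, (1 < j <= k)%N -> dotp e (D j tau) = 0) ->
  (forall j, (0 < j < k)%N -> dotp z (D j tau) = 0) ->
  dotp z (D k tau) = 3 / 2 * height k r h ->
  (((gain * h) `^ p * (volume k r rho / h ^+ (\sum_(j < k) j.+1)))%:E <=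
    \int[lebesgue_tuple R n]_(x in slab k r h tau z rho)
      (fourier_size a b gamma chi r x `^ p)%:E)%E.
Proof.
move=> kJ r0 /andP[h0 h1] s1 s11 alt bet /andP[rho0 rho1] Cerho hk1 p1 Hz eC e1 ej zj zk.
have /andP[k2 kJ'] := kJ.
have /andP[w0 w1] := window_bounds k.
have [ord1 ord2 ord3 ord4] := order.
have M0 : 0 < cutoff := lt_le_trans ltr01 cutoff_ge1.
have Mh0 : 0 < cutoff * h by rewrite mulr_gt0.
have tauJ : al <= tau <= be.
  by move: ord2 ord3 alt bet Mh0; set M := cutoff * h; slra.
have pos j : 0 < r * h ^+ j by rewrite mulr_gt0// exprn_gt0.
have hk0 : 0 < height k r h by rewrite divr_gt0.
(* Half of the allowed width: the center has its pairing of order [k] at [3/2] of the height, so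
   this deviation stays within the range from one to two heights. *)
pose A (j : nat) : R := window k / (2 * (r * h ^+ j.+1)).
pose S := [set x : n.-tuple R | forall i, `|tnth x i - tnth z i| <= rho] `&`
  \bigcap_(j in [set j | (j < k)%N]) [set x | `|dotp x (D j.+1 tau) - dotp z (D j.+1 tau)| <= A j].
have mS : measurable S.
  apply: measurableI; first exact: measurable_box.
  apply: fin_bigcap_measurable => [|j _]; first exact: finite_II.
  apply: measurable_norm_le; apply: measurable_funB; first exact: measurable_dotp.
  exact: measurable_cst.
have Sx x : S x -> [/\ forall i, `|tnth x i - tnth z i| <= rho,
    forall j, (0 < j < k)%N -> `|dotp x (D j tau)| <= window k / (r * h ^+ j) &
    height k r h <= dotp x (D k tau) <= 2 * height k r h].
  move=> [xz xA]; split => //.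
    move=> [//|j] /andP[_ jk]; have := xA j (ltnW jk); rewrite /= zj ?jk// subr0.
    have wn : 0 <= window k / (r * h ^+ j.+1) by apply: divr_ge0; exact: ltW.
    move=> /le_trans; apply; rewrite /A invfM mulrCA ler_piMl//.
    by rewrite invf_le1// ler1n.
  have k1 : k.-1.+1 = k by rewrite prednK// (leq_trans _ k2).
  have kk : (k.-1 < k)%N by rewrite k1.
  have := xA k.-1 kk; rewrite /= /A k1 zk.
  have -> : window k / (2 * (r * h ^+ k)) = height k r h / 2.
    by rewrite /height; field; rewrite ?(gt_eqF h0) ?(gt_eqF r0) ?expf_neq0 ?(gt_eqF h0).
  by rewrite ler_norml; move: hk0; set H := height k r h; slra.
have vol : ((volume k r rho / h ^+ (\sum_(j < k) j.+1))%:E <= lebesgue_tuple R n S)%E.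
  pose C : R := n%:R * C0 + 1.
  have Cp : 0 < C by rewrite ltr_wpDl// mulr_ge0// (le_trans ler01).
  have -> : volume k r rho / h ^+ (\sum_(j < k) j.+1) =
      rho ^+ n * \prod_(j < k) (A j / (4 * C)).
    rewrite /volume -mulrA; congr (_ * _).
    rewrite -prodrXr -prodfV -[X in _ ^+ X](card_ord k) -prodr_const -big_split/=.
    apply: eq_bigr => j _; rewrite /A -/C; field.
    by rewrite ?(gt_eqF r0) ?expf_neq0 ?(gt_eqF h0) ?(gt_eqF Cp).
  apply: (@slab_measure_ge R n k (fun j => D j.+1 tau) A C rho z) => //.
  - move=> j jk; apply/andP; split; first by rewrite divr_gt0// mulr_gt0.
    have C1 : 1 <= C by rewrite lerDr mulr_ge0// (le_trans ler01).
    apply: le_trans C1; apply: le_trans hk1.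
    rewrite /A /height ler_wpM2l ?(ltW w0)// lef_pV2 ?posrE ?pos ?mulr_gt0 ?exprn_gt0//.
    apply: (@le_trans _ _ (r * h ^+ j.+1)).
      by rewrite ler_wpM2l ?(ltW r0)// ler_wiXn2l // ltW.
    by rewrite ler_peMl ?(ltW (pos _))// ler1n.
  - move=> j x jk xb; rewrite (le_trans (@dotp_le R n x (D j.+1 tau) 1 C0 _ _))//.
    + by move=> i; have /andP[? ?] := xb i; rewrite ger0_norm// (le_trans _ rho1).
    + by move=> i; apply: DC => //; rewrite (leq_trans jk)// ltnW.
    + by rewrite mul1r lerDl.
have vol' : (((gain * h) `^ p * (volume k r rho / h ^+ (\sum_(j < k) j.+1)))%:E <=
    ((gain * h) `^ p)%:E * lebesgue_tuple R n S)%E.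
  by rewrite EFinM; apply: lee_wpmul2l => //; rewrite lee_fin powR_ge0.
apply: (le_trans vol').
apply: (@average_translate R n S (slab k r h tau z rho)
  (fun x => fourier_size a b gamma chi r x `^ p) (escale (1 / (r * h)) e)
  ((gain * h) `^ p) mS (measurable_slab _ _ _ _ _ _)).
- apply: (measurableT_comp (measurable_powR _)).
  exact: measurable_fourier_size.
- by move=> x; exact: powR_ge0.
- exact: powR_ge0.
- move=> x s /Sx[x1 x2 x3]; have [H _ _] := @slab_line k tau r h z e rho x kJ r0 h0 s1 s11 alt bet
    rho0 Cerho Hz eC e1 ej x1 x2 x3.
  exact: H.
move=> x /Sx[x1 x2 x3]; have [_ _ H] := @slab_line k tau r h z e rho x kJ r0 h0 s1 s11 alt bet
    rho0 Cerho Hz eC e1 ej x1 x2 x3.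
apply: jensen_line H => //.
have /andP[m0 _] := m01; have /andP[c0 _] := chi001.
by apply: mulr_gt0 => //; apply: divr_gt0 => //; apply: mulr_gt0.
Qed.

Lemma slab_infty (k : nat) tau r h z e (rho : R) : (2 <= k < J)%N ->
  0 < r -> 0 < h <= 1 -> 1 / (r * h) <= step_size -> 1 / (r * h) <= 1 ->
  al' <= tau - cutoff * h -> tau + cutoff * h <= be' ->
  0 < rho -> Ce / (r * h) <= rho ->
  (forall x, (forall i, `|tnth x i - tnth z i| <= 2 * rho) ->
    m <= dotp x x <= 1 /\
    forall t, al <= t <= be -> `|dotp x (D k.+1 t)| <= 2 * window k / (r * h ^+ k.+1)) ->
  (forall i, `|tnth e i| <= Ce) ->
  dotp e (D 1 tau) = 1 -> (forall j, (1 < j <= k)%N -> dotp e (D j tau) = 0) ->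
  (forall j, (0 < j < k)%N -> dotp z (D j tau) = 0) ->
  dotp z (D k tau) = 3 / 2 * height k r h ->
  ((gain * h)%:E <= Gq `[a, b] gamma chi +oo r)%E.
Proof.
move=> kJ r0 /andP[h0 h1] s1 s11 alt bet rho0 Cerho Hz eC e1 ej zj zk.
have /andP[m0 _] := m01; have /andP[c0 _] := chi001.
have /andP[w0 _] := window_bounds k.
have hk0 : 0 < height k r h.
  by apply: divr_gt0 => //; apply: mulr_gt0 => //; apply: exprn_gt0.
have x1 i : `|tnth z i - tnth z i| <= rho by rewrite subrr normr0 ltW.
have x2 j : (0 < j < k)%N -> `|dotp z (D j tau)| <= window k / (r * h ^+ j).
  move=> /zj ->; rewrite normr0; apply: divr_ge0; first exact: ltW.
  by apply: mulr_ge0; [exact: ltW|apply: exprn_ge0; exact: ltW].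
have x3 : height k r h <= dotp z (D k tau) <= 2 * height k r h.
  by rewrite zk; move: hk0; set H := height k r h; slra.
have [_ L1 L2] := @slab_line k tau r h z e rho z kJ r0 h0 s1 s11 alt bet
    rho0 Cerho Hz eC e1 ej x1 x2 x3.
apply: (Gq_infty_ge gamma_cont chi_meas chi01 _ _ L2).
  by apply: mulr_gt0 => //; apply: divr_gt0 => //; apply: mulr_gt0.
by move=> s /L1/andP[X _]; rewrite /enorm sqrtr_gt0 (lt_le_trans m0).
Qed.

(** The term [2 * cutoff] leaves room at both ends of [[al', be']]. The term [16 / window k] makes
    the order [k.-1] pairing grow by [8 / (r h^(k-1))], twice the difference that two slabs
    permit. *)
Definition spacing (k : nat) : R := 2 * cutoff + 16 / window k.

(* The order [k.-1] derivative grows between the two points by more than the slabs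
   allow. *)
Lemma slab_disjoint (k : nat) r h rho z z' tau tau' x : (2 <= k)%N ->
  0 < r -> 0 < h -> al <= tau -> tau' <= be -> spacing k * h <= tau' - tau ->
  (forall t, tau <= t <= be -> height k r h / 2 <= dotp x (D k t)) ->
  slab k r h tau z rho x -> slab k r h tau' z' rho x -> False.
Proof.
move=> k2 r0 h0 alt bet sp pos [_ X _] [_ X' _].
have /andP[w0 w1] := window_bounds k.
have M0 : 0 < cutoff := lt_le_trans ltr01 cutoff_ge1.
have kk : k.-1.+1 = k by rewrite prednK// (leq_trans _ k2).
have k1 : (0 < k.-1 < k)%N.
  by rewrite -ltnS kk k2/= leqnn.
have {}X := X _ k1; have {}X' := X' _ k1.
have p0 : 0 < r * h ^+ k.-1 by apply: mulr_gt0 => //; exact: exprn_gt0.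
have sp0 : 0 < spacing k * h.
  apply: mulr_gt0 => //; apply: addr_gt0; first exact: mulr_gt0.
  exact: divr_gt0.
have tt : tau < tau' by rewrite -subr_gt0 (lt_le_trans sp0).
have dd s : s \in `]tau, tau'[ -> is_derive s 1 (fun s => dotp x (D k.-1 s)) (dotp x (D k s)).
  rewrite in_itv/= => /andP[s1 s2]; rewrite -[in D k s]kk.
  apply: (is_derive_dotp DD); rewrite (le_trans alt (ltW s1))/=.
  exact: le_trans (ltW s2) bet.
have cc : {within `[tau, tau'], continuous (fun s => dotp x (D k.-1 s))}.
  apply: (@derive_continuous_within _ (fun s => dotp x (D k.-1 s)) (fun s => dotp x (D k s))) => s.
  move=> /andP[s1 s2]; rewrite -[in D k s]kk; apply: (is_derive_dotp DD).
  by rewrite (le_trans alt s1)/= (le_trans s2 bet).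
have [c cI E] := MVT_segment (ltW tt) dd cc.
have {}pos : height k r h / 2 <= dotp x (D k c).
  by move: cI; rewrite in_itv/= => /andP[c1 c2]; apply: pos; rewrite c1/= (le_trans c2).
have hk0 : 0 < height k r h.
  by apply: divr_gt0 => //; apply: mulr_gt0 => //; apply: exprn_gt0.
have low : height k r h / 2 * (16 / window k * h) <= dotp x (D k.-1 tau') - dotp x (D k.-1 tau).
  rewrite E; apply: ler_pM => //.
  - by apply: divr_ge0 => //; exact: ltW.
  - by apply: mulr_ge0; [apply: divr_ge0 => //|]; exact: ltW.
  have M2 : 0 <= 2 * cutoff * h by apply: mulr_ge0; [apply: mulr_ge0|]; rewrite // ltW.
  have S2 : spacing k * h = 2 * cutoff * h + 16 / window k * h by rewrite /spacing mulrDl.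
  by apply: le_trans sp; rewrite S2 lerDr.
have E8 : height k r h / 2 * (16 / window k * h) = 8 / (r * h ^+ k.-1).
  rewrite /height -[in h ^+ k]kk exprS; field.
  by rewrite (gt_eqF w0) (gt_eqF r0) (gt_eqF h0) expf_neq0// (gt_eqF h0).
move: low; rewrite E8; move: X X'; rewrite !ler_norml.
have -> : 8 / (r * h ^+ k.-1) = 4 * (2 / (r * h ^+ k.-1)) by ring.
have : 0 < 2 / (r * h ^+ k.-1) by exact: divr_gt0.
by set q := 2 / _; slra.
Qed.

(** * Families of slabs along the curve *)

Variable K : nat.
Hypothesis KJ : (2 <= K < J)%N.
Hypothesis omega0 : al' < be'.
Hypothesis frame : forall t (c : nat -> R) M, al <= t <= be -> (forall j, `|c j| <= M) ->
  exists z, (forall i, `|tnth z i| <= Ce * M) /\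
    forall j, (0 < j <= K)%N -> dotp z (D j t) = c j.

Local Ltac slra ::= clear -gamma_cont chi_meas chi01 C01 DD DC D0 chi_supp chi_ge
  order m01 chi001 Ce1 n0 J2 short1 short2 K KJ omega0 frame; lra.

(** Every factor lies between 0 and 1, so a scale below the product is below each factor, and one
    bound on [h] implies all the conditions of [scale_conditions]. *)
Definition hmax (k : nat) (rho : R) : R :=
  window k * (step_size * (rho / Ce) * ((be' - al') / spacing k)).

Definition scale_const (k : nat) (rho : R) : R :=
  volume k 1 rho * ((be' - al') / (2 * spacing k)).

Lemma step_size_le1 : step_size <= 1.
Proof.
have /andP[m0 m1] := m01; have /andP[d0 d1] := defect_bounds.
have M1 := cutoff_ge1; have E1 := dir_size_ge1.
have M0 : 0 < cutoff := lt_le_trans ltr01 M1.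
have E0 : 0 < dir_size := lt_le_trans ltr01 E1.
rewrite /step_size ler_pdivrMr ?mul1r; last by apply: mulr_gt0 => //; apply: mulr_gt0.
apply: (@le_trans _ _ 1).
  rewrite mulr_ile1 ?exprn_ge0 ?exprn_ile1 ?(ltW m0) ?(ltW d0)// (le_trans d1)//.
  by lra.
by rewrite -[leLHS]mulr1 ler_pM//; move: M1; set M := cutoff; slra.
Qed.

Lemma spacing_ge1 k : 1 <= spacing k.
Proof.
have M1 := cutoff_ge1; have /andP[w0 w1] := window_bounds k.
rewrite /spacing; have : 0 < 16 / window k by exact: divr_gt0.
by move: M1; set M := cutoff; set q := 16 / _; slra.
Qed.

Lemma omega_le1 : be' - al' <= 1.
Proof.
have [ord1 ord2 ord3 ord4] := order.
have H : (be - al) * 1 <= (be - al) * (n%:R * (Ce * C0)).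
  apply: ler_wpM2l; first by move: ord2 ord3 omega0; slra.
  have n1 : 1 <= n%:R :> R by rewrite ler1n.
  have CC : 1 <= Ce * C0 by rewrite -[leLHS]mulr1 ler_pM.
  by rewrite -[leLHS]mulr1 ler_pM.
by move: ord2 ord3 short1 H; set q := _ * (_ * _); slra.
Qed.

Lemma hmax_gt0 k rho : 0 < rho -> 0 < hmax k rho.
Proof.
move=> rho0; have /andP[w0 w1] := window_bounds k.
have S0 : 0 < spacing k := lt_le_trans ltr01 (spacing_ge1 k).
have Ce0 : 0 < Ce := lt_le_trans ltr01 Ce1.
apply: mulr_gt0 => //; apply: mulr_gt0; last by rewrite divr_gt0// subr_gt0.
by apply: mulr_gt0; [exact: step_size_gt0|exact: divr_gt0].
Qed.

(** From [window k <= r h^k] with [k >= 2] and [h <= 1] follows [1 / (r h) <= h / window k]. The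
    displacement is therefore small as soon as [h] is, uniformly in [r]. *)
Lemma scale_conditions k r h rho : (2 <= k)%N -> 0 < r -> 0 < rho <= 1 ->
  0 < h <= hmax k rho -> window k <= r * h ^+ k ->
  [/\ h <= 1, 1 / (r * h) <= step_size, 1 / (r * h) <= 1, Ce / (r * h) <= rho &
    spacing k * h <= be' - al'].
Proof.
move=> k2 r0 /andP[rho0 rho1] /andP[h0 hm] wr.
have /andP[w0 w1] := window_bounds k.
have S1 := spacing_ge1 k.
have S0 : 0 < spacing k := lt_le_trans ltr01 S1.
have Ce0 : 0 < Ce := lt_le_trans ltr01 Ce1.
have om1 := omega_le1.
have a0 := step_size_gt0; have a1 := step_size_le1.
have b0 : 0 < rho / Ce by exact: divr_gt0.
have b1 : rho / Ce <= 1 by rewrite ler_pdivrMr// mul1r (le_trans rho1).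
have c0 : 0 < (be' - al') / spacing k by rewrite divr_gt0// subr_gt0.
have c1 : (be' - al') / spacing k <= 1 by rewrite ler_pdivrMr// mul1r (le_trans om1).
have ab0 : 0 < step_size * (rho / Ce) by apply: mulr_gt0.
have abc0 : 0 < step_size * (rho / Ce) * ((be' - al') / spacing k) by apply: mulr_gt0.
have ab1 : step_size * (rho / Ce) <= 1 by rewrite mulr_ile1// ltW.
have abc1 : step_size * (rho / Ce) * ((be' - al') / spacing k) <= 1.
  by rewrite mulr_ile1// ltW.
have h1 : h <= 1 by rewrite (le_trans hm)// /hmax mulr_ile1// ltW.
have rh0 : 0 < r * h by exact: mulr_gt0.
have wrh : window k <= r * h * h.
  rewrite (le_trans wr)// -mulrA ler_pM2l// -expr2.
  by apply: ler_wiXn2l => //; exact: ltW.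
have rh : 1 / (r * h) <= step_size * (rho / Ce) * ((be' - al') / spacing k).
  rewrite ler_pdivrMr// -(ler_pM2l w0) mulr1 (le_trans wrh)// mulrC.
  by rewrite [leRHS]mulrA ler_pM2r.
split => //.
- apply: (le_trans rh); rewrite -mulrA ler_piMr ?(ltW a0)//.
  by rewrite mulr_ile1// ltW.
- exact: le_trans rh abc1.
- have -> : Ce / (r * h) = Ce * (1 / (r * h)) by ring.
  rewrite mulrC -ler_pdivlMr// (le_trans rh)//.
  rewrite -mulrA (mulrCA step_size) ler_piMr ?(ltW b0)//.
  by rewrite mulr_ile1// ltW.
- rewrite mulrC -ler_pdivlMr// (le_trans hm)// /hmax mulrA ler_piMl ?(ltW c0)//.
  by rewrite mulr_ile1// ltW.
Qed.

Lemma scale_frame tau : al <= tau <= be -> exists e : n.-tuple R,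
  [/\ forall i, `|tnth e i| <= Ce, dotp e (D 1 tau) = 1 &
    forall j, (1 < j <= K)%N -> dotp e (D j tau) = 0].
Proof.
move=> tauJ; have /andP[K2 _] := KJ.
have [|z [z1 z2]] := @frame tau (fun j => (j == 1%N)%:R) 1 tauJ.
  by move=> j; case: eqP; rewrite ?normr1 ?normr0.
exists z; split.
- by move=> i; rewrite (le_trans (z1 i))// mulr1.
- by rewrite z2// (leq_trans _ K2).
- by move=> j /andP[j1 jK]; rewrite z2 ?jK ?(ltnW j1)// gtn_eqF.
Qed.

Lemma scale_infty k r h rho (z : R -> n.-tuple R) : (2 <= k <= K)%N -> 0 < r ->
  0 < rho <= 1 -> 0 < h <= hmax k rho -> window k <= r * h ^+ k ->
  (forall tau x, al' <= tau <= be' -> (forall i, `|tnth x i - tnth (z tau) i| <= 2 * rho) ->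
    m <= dotp x x <= 1 /\
    forall t, al <= t <= be -> `|dotp x (D k.+1 t)| <= 2 * window k / (r * h ^+ k.+1)) ->
  (forall tau, al <= tau <= be -> (forall j, (0 < j < k)%N -> dotp (z tau) (D j tau) = 0) /\
    dotp (z tau) (D k tau) = 3 / 2 * height k r h) ->
  ((gain * h)%:E <= Gq `[a, b] gamma chi +oo r)%E.
Proof.
move=> /andP[k2 kK] r0 rho01 hh wr Hz Hc.
have /andP[_ KJ'] := KJ; have [ord1 ord2 ord3 ord4] := order.
have [h1 s1 s11 Cr Sp] := scale_conditions k2 r0 rho01 hh wr.
have /andP[h0 _] := hh; have /andP[rho0 _] := rho01.
have /andP[w0 _] := window_bounds k.
have M0 : 0 < cutoff * h by apply: mulr_gt0 => //; exact: lt_le_trans ltr01 cutoff_ge1.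
have Sp' : cutoff * h + cutoff * h <= be' - al'.
  apply: le_trans Sp; rewrite -mulrDl ler_pM2r// /spacing mulr_natl mulr2n lerDl.
  by apply: divr_ge0 => //; exact: ltW.
pose tau := al' + cutoff * h.
have tau' : al' <= tau <= be' by rewrite /tau; move: Sp' M0; set q := cutoff * h; slra.
have tauJ : al <= tau <= be by move: tau' ord2 ord3; slra.
have [e [e1 e2 e3]] := scale_frame tauJ.
have [z1 z2] := Hc _ tauJ.
apply: (@slab_infty k tau r h (z tau) e rho) => //.
- by rewrite k2 (leq_ltn_trans kK).
- by rewrite h0.
- by rewrite /tau addrK.
- by rewrite /tau; move: Sp'; set q := cutoff * h; slra.
- by move=> x; exact: Hz.
- by move=> j /andP[j1 jk]; rewrite e3// j1 (leq_trans jk).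
Qed.

(** Each slab contributes [h^p] times its volume, of order [r^-k h^-(1 + ... + k)], and there are of
    order [1 / h] disjoint slabs; [q_sum] collects the powers into [h^(p - q_k)]. *)
Lemma scale_family k r h rho p (z : R -> n.-tuple R) : (2 <= k <= K)%N -> 0 < r ->
  0 < rho <= 1 -> 0 < h <= hmax k rho -> window k <= r * h ^+ k -> 1 <= p ->
  (forall tau x, al' <= tau <= be' -> (forall i, `|tnth x i - tnth (z tau) i| <= 2 * rho) ->
    m <= dotp x x <= 1 /\
    forall t, al <= t <= be -> `|dotp x (D k.+1 t)| <= 2 * window k / (r * h ^+ k.+1)) ->
  (forall tau, al <= tau <= be -> (forall j, (0 < j < k)%N -> dotp (z tau) (D j tau) = 0) /\
    dotp (z tau) (D k tau) = 3 / 2 * height k r h) ->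
  (forall tau x t, al' <= tau <= be' -> slab k r h tau (z tau) rho x ->
    tau <= t <= be -> height k r h / 2 <= dotp x (D k t)) ->
  exists U : set (n.-tuple R), [/\ measurable U,
    (forall x, U x -> exists tau, al' <= tau <= be' /\ slab k r h tau (z tau) rho x) &
    ((gain `^ p * scale_const k rho * h `^ (p - q_ k) / r ^+ k)%:E <=
      \int[lebesgue_tuple R n]_(x in U) (fourier_size a b gamma chi r x `^ p)%:E)%E].
Proof.
move=> /andP[k2 kK] r0 rho01 hh wr p1 Hz Hc pos.
have /andP[_ KJ'] := KJ; have [ord1 ord2 ord3 ord4] := order.
have [h1 s1 s11 Cr Sp] := scale_conditions k2 r0 rho01 hh wr.
have /andP[h0 _] := hh; have /andP[rho0 _] := rho01.
have /andP[w0 _] := window_bounds k.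
have M0 : 0 < cutoff * h by apply: mulr_gt0 => //; exact: lt_le_trans ltr01 cutoff_ge1.
have S0 : 0 < spacing k * h.
  by apply: mulr_gt0 => //; exact: lt_le_trans ltr01 (spacing_ge1 k).
have Sp' : cutoff * h + cutoff * h <= spacing k * h.
  rewrite -mulrDl ler_pM2r// /spacing mulr_natl mulr2n lerDl.
  by apply: divr_ge0 => //; exact: ltW.
set sp := spacing k * h in Sp S0 Sp' *.
pose N := Num.truncn ((be' - al') / sp).
have om : 1 <= (be' - al') / sp by rewrite ler_pdivlMr// mul1r.
have /andP[N1 N2] : N%:R <= (be' - al') / sp < N.+1%:R.
  by apply: truncn_itv; exact: le_trans ler01 om.
(* Rounding down loses at most a factor 2, since at least one center fits. *)
have N3 : (be' - al') / (2 * sp) <= N%:R.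
  have -> : (be' - al') / (2 * sp) = (be' - al') / sp / 2 by field; rewrite gt_eqF.
  have : 1 <= N%:R :> R.
    by rewrite ler1n lt0n; apply/eqP => N0; move: N2; rewrite N0 ltNge om.
  by move: N2; rewrite -natr1; set q := _ / sp; slra.
pose tau (i : nat) : R := al' + cutoff * h + i%:R * sp.
have tauI i : (i < N)%N -> al' + cutoff * h <= tau i <= be' - cutoff * h.
  move=> iN; have i0 : 0 <= i%:R * sp by rewrite mulr_ge0// ltW.
  have i1 : (i%:R + 1) * sp <= be' - al'.
    by rewrite -ler_pdivlMr// natr1 (le_trans _ N1)// ler_nat.
  by move: i0 i1 Sp'; rewrite mulrDl mul1r /tau; set u := i%:R * sp; set q := cutoff * h; slra.
have tau' i : (i < N)%N -> al' <= tau i <= be'.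
  by move=> /tauI; move: M0; set q := cutoff * h; slra.
have tauJ i : (i < N)%N -> al <= tau i <= be by move=> /tau'; move: ord2 ord3; slra.
pose U := \bigcup_(i < N) slab k r h (tau i) (z (tau i)) rho.
exists U; split.
- by apply: bigcup_measurable => i _; exact: measurable_slab.
- by move=> x [i /= iN Ux]; exists (tau i); split => //; exact: tau'.
have := @integral_trivIset_ge _ _ R (lebesgue_tuple R n) N
  (fun i => slab k r h (tau i) (z (tau i)) rho) U
  (fun x => fourier_size a b gamma chi r x `^ p)
  (fun=> (gain * h) `^ p * (volume k r rho / h ^+ (\sum_(j < k) j.+1))).
move=> I; apply: le_trans (I _ _ _ _ _ _ _).
- rewrite sumr_const card_ord lee_fin -mulr_natl.
  have g0 : 0 < gain.
    have /andP[m0 _] := m01; have /andP[c0 _] := chi001.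
    by apply: divr_gt0 => //; apply: mulr_gt0.
  have -> : h `^ (p - q_ k) = h `^ p / h ^+ (\sum_(j < k) j.+1).+1.
    rewrite -powR_mulrn; last exact: ltW.
    by rewrite q_sum powRB// (gt_eqF h0) implybT.
  have -> : volume k r rho = volume k 1 rho / r ^+ k.
    rewrite /volume; set W := _ / (8 * _).
    by rewrite expr_div_n divr1 mulrA.
  rewrite powRM ?(ltW g0) ?(ltW h0)// exprS.
  rewrite /scale_const.
  have -> : (be' - al') / (2 * spacing k) = (be' - al') / (2 * sp) * h.
    by rewrite /sp; field; rewrite (gt_eqF h0) gt_eqF// (lt_le_trans ltr01 (spacing_ge1 k)).
  set V := volume k 1 rho; set q := (be' - al') / (2 * sp) in N3 *.
  set H := h ^+ _; set G := gain `^ p; set P := h `^ p.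
  have hn : h != 0 by rewrite gt_eqF.
  have Hn : 0 < H by exact: exprn_gt0.
  have rn : 0 < r ^+ k by exact: exprn_gt0.
  have -> : G * (V * (q * h)) * (P / (h * H)) / r ^+ k = q * (G * P * (V / r ^+ k / H)).
    by field; rewrite hn !gt_eqF.
  apply: ler_wpM2r => //.
  apply: mulr_ge0; first by apply: mulr_ge0; exact: powR_ge0.
  apply: divr_ge0; last exact: ltW.
  apply: divr_ge0; last exact: ltW.
  rewrite /V /volume divr1; apply: mulr_ge0; first by apply: exprn_ge0; exact: ltW.
  apply: exprn_ge0; apply: divr_ge0; first exact: ltW.
  by rewrite mulr_ge0// addr_ge0// mulr_ge0// (le_trans ler01).
- by move=> i _; exact: measurable_slab.
- by apply: bigcup_measurable => i _; exact: measurable_slab.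
- by move=> i iN x Ux; exists i.
- apply: (measurableT_comp (measurable_powR _)).
  exact: measurable_fourier_size.
- by move=> x; exact: powR_ge0.
- move=> i j x /andP[ij jN] Ui Uj; have iN := ltn_trans ij jN.
  apply: (slab_disjoint k2 r0 h0 _ _ _ _ Ui Uj).
  + by have /andP[] := tauJ i iN.
  + by have /andP[] := tauJ j jN.
  + rewrite -/sp /tau opprD addrACA subrr add0r -mulrBl ler_peMl ?(ltW S0)//.
    by rewrite -natrB ?(ltnW ij)// ler1n subn_gt0.
  + by move=> t tt; apply: (pos (tau i) x t) => //; exact: tau'.
move=> i iN; have [e [e1 e2 e3]] := scale_frame (tauJ _ iN).
have [z1 z2] := Hc _ (tauJ _ iN).
apply: (@slab_integral k (tau i) r h (z (tau i)) e rho p) => //.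
- by rewrite k2 (leq_ltn_trans kK).
- by rewrite h0.
- by have := tauI i iN; set q := cutoff * h; slra.
- by have := tauI i iN; set q := cutoff * h; slra.
- rewrite /height ler_pdivrMr ?mul1r//; apply: mulr_gt0 => //.
  exact: exprn_gt0.
- by move=> x; apply: Hz; exact: tau'.
- by move=> j /andP[j1 jk]; rewrite e3// j1 (leq_trans jk).
Qed.

(** [ds] is the size of the largest pairing prescribed for a center, up to a factor [3/2]. By [dsCe]
    the dual vectors then remain inside the unit ball; conversely [m] is a squared norm that a
    pairing of that size forces. By [short3] pairings vary by at most [ds / 4] along [[al, be]]. *)
Variable ds : R.
Hypothesis ds0 : 0 < ds.
Hypothesis dsCe : ds * Ce <= 1 / (64 * n%:R).
Hypothesis mE : m = (ds / (8 * (n%:R * C0))) ^+ 2.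
Hypothesis short3 : (be - al) * (n%:R * C0) <= ds / 4.

Local Ltac slra ::= clear -gamma_cont chi_meas chi01 C01 DD DC D0 chi_supp chi_ge
  order m01 chi001 Ce1 n0 J2 short1 short2 K KJ omega0 frame ds0 dsCe mE short3; lra.

(** A change of [2 * box] in every coordinate moves each pairing by at most [ds / 8]. *)
Definition box : R := ds / (16 * (n%:R * C0)).

Lemma ds_le : ds <= 1 / (64 * n%:R).
Proof. by apply: le_trans dsCe; rewrite ler_peMr// ltW. Qed.

Lemma nC0_ge1 : 1 <= n%:R * C0.
Proof. by rewrite -[leLHS]mulr1 ler_pM// ler1n. Qed.

Lemma ds_le1 : ds <= 1.
Proof.
apply: (le_trans ds_le); rewrite ler_pdivrMr ?mul1r ?mulr_gt0 ?ltr0n//.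
by rewrite -natrM ler1n muln_gt0.
Qed.

Lemma box_bounds : 0 < box <= 1.
Proof.
have N1 := nC0_ge1; have N0 := lt_le_trans ltr01 N1.
apply/andP; split; first by apply: divr_gt0 => //; apply: mulr_gt0.
rewrite /box ler_pdivrMr ?mul1r; last exact: mulr_gt0.
by move: ds_le1 N1; set q := n%:R * C0; slra.
Qed.

Lemma box_le : 2 * box <= 1 / (8 * 64 * n%:R).
Proof.
have N1 := nC0_ge1; have N0 := lt_le_trans ltr01 N1.
have n1 : 0 < n%:R :> R by rewrite ltr0n.
have Cp := lt_le_trans ltr01 C01.
have -> : 2 * box = ds / (n%:R * C0) / 8.
  by rewrite /box; field; rewrite !gt_eqF.
have -> : 1 / (8 * 64 * n%:R) = 1 / (64 * n%:R) / 8 :> R by field; rewrite gt_eqF.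
rewrite ler_pM2r// (le_trans _ ds_le)// ler_pdivrMr// ler_peMr//.
exact: ltW.
Qed.

Lemma box_dotp x z j t : (j <= J)%N -> al <= t <= be ->
  (forall i, `|tnth x i - tnth z i| <= 2 * box) ->
  `|dotp x (D j t) - dotp z (D j t)| <= ds / 8.
Proof.
move=> jJ tJ xz.
have N0 := lt_le_trans ltr01 nC0_ge1.
have n1 : 0 < n%:R :> R by rewrite ltr0n.
have Cp := lt_le_trans ltr01 C01.
have -> : dotp x (D j t) - dotp z (D j t) = dotp (tadd x (escale (-1) z)) (D j t).
  by rewrite dotp_tadd dotp_escale mulN1r.
have -> : ds / 8 = n%:R * (2 * box * C0).
  by rewrite /box; field; rewrite !gt_eqF.
apply: dotp_le => i; last exact: DC.
by rewrite !tnth_mktuple mulN1r.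
Qed.

Lemma unit_bound x : (forall i, `|tnth x i| <= 1 / n%:R) -> dotp x x <= 1.
Proof.
move=> x1; apply: (le_trans (ler_norm _)); apply: (le_trans (dotp_le x1 x1)).
have n1 : 1 <= n%:R :> R by rewrite ler1n.
have np : 0 < n%:R :> R by rewrite ltr0n.
have -> : n%:R * (1 / n%:R * (1 / n%:R)) = 1 / n%:R :> R by field; rewrite gt_eqF.
by rewrite ler_pdivrMr// mul1r.
Qed.

Lemma coord_le x i : `|tnth x i| <= Num.sqrt (dotp x x).
Proof.
rewrite -sqrtr_sqr ler_wsqrtr// /dotp (bigD1 i)//= -expr2 lerDl.
by apply: sumr_ge0 => j _; rewrite -expr2 sqr_ge0.
Qed.

Lemma low_bound x j t : (j <= J)%N -> al <= t <= be ->
  ds / 2 <= dotp x (D j t) -> m <= dotp x x.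
Proof.
move=> jJ tJ H; have N0 := lt_le_trans ltr01 nC0_ge1.
have H1 := dotp_le (coord_le x) (fun i => DC i jJ tJ).
have H2 : ds / (8 * (n%:R * C0)) <= Num.sqrt (dotp x x).
  rewrite ler_pdivrMr; last exact: mulr_gt0.
  move: H1 (ler_norm (dotp x (D j t))) H ds0; rewrite mulrCA (mulrCA _ 8).
  by set q := Num.sqrt _ * _; slra.
rewrite mE -(sqr_sqrtr (dotp_ge0 x)) lerXn2r// nnegrE ?sqrtr_ge0//.
by apply: divr_ge0; [|apply: mulr_ge0]; rewrite // ltW.
Qed.

Lemma low_bound_coord x i : 1 / (8 * n%:R) <= `|tnth x i| -> m <= dotp x x.
Proof.
move=> H; have N0 := lt_le_trans ltr01 nC0_ge1.
have n1 : 0 < n%:R :> R by rewrite ltr0n.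
have Cp := lt_le_trans ltr01 C01.
have H2 : ds / (8 * (n%:R * C0)) <= Num.sqrt (dotp x x).
  apply: le_trans (coord_le x i); apply: le_trans H.
  rewrite ler_pdivrMr; last exact: mulr_gt0.
  have -> : 1 / (8 * n%:R) * (8 * (n%:R * C0)) = C0 by field; rewrite gt_eqF.
  exact: le_trans ds_le1 C01.
rewrite mE -(sqr_sqrtr (dotp_ge0 x)) lerXn2r// nnegrE ?sqrtr_ge0//.
by apply: divr_ge0; [|apply: mulr_ge0]; rewrite // ltW.
Qed.

(** The common interface between [scale_family], [scale_infty] and the three ways of choosing
    centers: [good_pure], [good_log] and [good_flat]. *)
Definition good_scale (k : nat) r h (z : R -> n.-tuple R) : Prop :=
  [/\ 0 < h <= hmax k box, window k <= r * h ^+ k,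
    forall tau x, al' <= tau <= be' ->
      (forall i, `|tnth x i - tnth (z tau) i| <= 2 * box) ->
      m <= dotp x x <= 1 /\
      forall t, al <= t <= be -> `|dotp x (D k.+1 t)| <= 2 * window k / (r * h ^+ k.+1),
    forall tau, al <= tau <= be -> (forall j, (0 < j < k)%N -> dotp (z tau) (D j tau) = 0) /\
      dotp (z tau) (D k tau) = 3 / 2 * height k r h &
    forall tau x t, al' <= tau <= be' -> slab k r h tau (z tau) box x ->
      tau <= t <= be -> height k r h / 2 <= dotp x (D k t)].

Lemma multi_scale k r p L (h : nat -> R) (z : nat -> R -> n.-tuple R) :
  (2 <= k <= K)%N -> 0 < r -> 1 <= p ->
  (forall i, (i < L)%N -> good_scale k r (h i) (z i)) ->
  (forall i j tau tau' x, (i < j < L)%N -> al' <= tau <= be' -> al' <= tau' <= be' ->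
    slab k r (h i) tau (z i tau) box x -> slab k r (h j) tau' (z j tau') box x -> False) ->
  (((gain `^ p * scale_const k box * (\sum_(i < L) h i `^ (p - q_ k)) / r ^+ k) `^ p^-1)%:E
    <= Gq `[a, b] gamma chi p%:E r)%E.
Proof.
move=> kK r0 p1 good cross.
have mp : 0 < m by case/andP: m01.
have V0 : 0 <= scale_const k box.
  have /andP[w0 _] := window_bounds k; have /andP[b0 _] := box_bounds.
  have S0 : 0 < spacing k := lt_le_trans ltr01 (spacing_ge1 k).
  apply: mulr_ge0; last by rewrite divr_ge0 ?subr_ge0 ?mulr_ge0 ?(ltW omega0)// ltW.
  rewrite /volume divr1; apply: mulr_ge0; first by apply: exprn_ge0; exact: ltW.
  apply: exprn_ge0; apply: divr_ge0; first exact: ltW.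
  by rewrite mulr_ge0// addr_ge0// mulr_ge0// (le_trans ler01).
have /boolp.choice[U HU] : forall i, exists V : set (n.-tuple R), (i < L)%N -> [/\ measurable V,
    (forall x, V x -> exists tau, al' <= tau <= be' /\ slab k r (h i) tau (z i tau) box x) &
    ((gain `^ p * scale_const k box * h i `^ (p - q_ k) / r ^+ k)%:E <=
      \int[lebesgue_tuple R n]_(x in V) (fourier_size a b gamma chi r x `^ p)%:E)%E].
  move=> i; have [iL|_] := ltnP i L; last by exists set0.
  have [h1 h2 h3 h4 h5] := good i iL.
  by have [U HU] := scale_family kK r0 box_bounds h1 h2 p1 h3 h4 h5; exists U.
apply: (Gq_ge gamma_cont chi_meas chi01) => //.
- exact: lt_le_trans ltr01 p1.
- apply: divr_ge0; last by apply: exprn_ge0; exact: ltW.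
  apply: mulr_ge0; first by rewrite mulr_ge0// powR_ge0.
  by apply: sumr_ge0 => i _; exact: powR_ge0.
rewrite mulr_sumr mulr_suml.
apply: (@integral_trivIset_ge _ _ R (lebesgue_tuple R n) L U (@unit_ball0 R n)
  (fun x => fourier_size a b gamma chi r x `^ p)
  (fun i => gain `^ p * scale_const k box * h i `^ (p - q_ k) / r ^+ k)).
- by move=> i /HU[].
- exact: measurable_unit_ball0.
- move=> i iL x; have [_ H _] := HU i iL => /H[tau [tauJ [X _ _]]].
  have [_ _ h3 _ _] := good i iL.
  have [/andP[x1 x2] _] := h3 tau x tauJ X.
  rewrite /unit_ball0/= /enorm sqrtr_gt0 (lt_le_trans mp x1)/=.
  by rewrite -[leRHS]sqrtr1 ler_wsqrtr.
- apply: (measurableT_comp (measurable_powR _)).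
  exact: measurable_fourier_size.
- by move=> x; exact: powR_ge0.
- move=> i j x /andP[ij jL] Ui Uj; have iL := ltn_trans ij jL.
  have [_ H _] := HU i iL; have [tau [tauJ Hi]] := H _ Ui.
  have [_ H' _] := HU j jL; have [tau' [tauJ' Hj]] := H' _ Uj.
  by apply: (cross i j tau tau' x) => //; rewrite ij.
- by move=> i /HU[].
Qed.

Lemma frame_fun (c : nat -> R) M : (forall j, `|c j| <= M) ->
  exists z : R -> n.-tuple R, forall tau, al <= tau <= be ->
    (forall i, `|tnth (z tau) i| <= Ce * M) /\
    forall j, (0 < j <= K)%N -> dotp (z tau) (D j tau) = c j.
Proof.
move=> cM.
have /boolp.choice[z Hz] : forall tau, exists v : n.-tuple R, al <= tau <= be ->
    (forall i, `|tnth v i| <= Ce * M) /\ forall j, (0 < j <= K)%N -> dotp v (D j tau) = c j.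
  move=> tau; case: (boolP (al <= tau <= be)) => [tauJ|_]; last by exists (nseq_tuple n 0).
  by have [z Hz] := frame tauJ cM; exists z.
by exists z.
Qed.

Lemma near_bounds x z M : (forall i, `|tnth x i - tnth z i| <= 2 * box) ->
  (forall i, `|tnth z i| <= M) -> M <= 1 / (2 * n%:R) ->
  forall i, `|tnth x i| <= 1 / n%:R.
Proof.
move=> xz zM M2 i; have n1 : 0 < n%:R :> R by rewrite ltr0n.
have -> : tnth x i = tnth z i + (tnth x i - tnth z i) by ring.
rewrite (le_trans (ler_normD _ _))//.
have -> : 1 / n%:R = 1 / (2 * n%:R) + 1 / (2 * n%:R) :> R by field; rewrite gt_eqF.
apply: lerD; first exact: le_trans (zM i) M2.
apply: (le_trans (xz i)); apply: (le_trans box_le).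
rewrite ler_pM2l// lef_pV2 ?posrE ?mulr_gt0// ler_pM2r//.
by rewrite -natrM ler_nat.
Qed.

Lemma dotp_small x j t : (forall i, `|tnth x i| <= 1 / n%:R) -> (j <= J)%N -> al <= t <= be ->
  `|dotp x (D j t)| <= C0.
Proof.
move=> x1 jJ tJ; apply: (le_trans (dotp_le x1 (fun i => DC i jJ tJ))).
have n1 : 0 < n%:R :> R by rewrite ltr0n.
by have -> : n%:R * (1 / n%:R * C0) = C0 by field; rewrite gt_eqF.
Qed.

Lemma dotp_osc x j t tau : (forall i, `|tnth x i| <= 1 / n%:R) -> (j < J)%N ->
  al <= t <= be -> al <= tau <= be -> `|dotp x (D j t) - dotp x (D j tau)| <= ds / 4.
Proof.
move=> x1 jJ tJ tauJ; have n1 : 1 <= n%:R :> R by rewrite ler1n.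
have n0' : 0 < n%:R :> R by rewrite ltr0n.
have x1' i : `|tnth x i| <= 1 by rewrite (le_trans (x1 i))// ler_pdivrMr// mul1r.
apply: (le_trans (dotp_D_lip DD DC jJ x1' tJ tauJ)); apply: le_trans short3.
rewrite mul1r mulrC; apply: ler_wpM2r.
  by rewrite mulr_ge0// (le_trans ler01).
by rewrite ler_norml; move: tJ tauJ; slra.
Qed.

Lemma dotp_D_ge x j u v (c : R) : al <= u -> u <= v -> v <= be ->
  (forall t, u <= t <= v -> c <= dotp x (D j.+1 t)) ->
  c * (v - u) <= dotp x (D j v) - dotp x (D j u).
Proof.
move=> alu uv vbe cD.
have H s : u <= s <= v -> is_derive s 1 (fun s => dotp x (D j s)) (dotp x (D j.+1 s)).
  move=> /andP[s1 s2]; apply: (is_derive_dotp DD).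
  by rewrite (le_trans alu s1)/= (le_trans s2 vbe).
have dd s : s \in `]u, v[ -> is_derive s 1 (fun s => dotp x (D j s)) (dotp x (D j.+1 s)).
  by rewrite in_itv/= => /andP[s1 s2]; apply: H; rewrite !ltW.
have cc := derive_continuous_within H.
have [w wI ->] := MVT_segment uv dd cc.
by apply: ler_wpM2r; [rewrite subr_ge0|apply: cD; move: wI; rewrite in_itv].
Qed.

Lemma K_lt_J k : (k <= K)%N -> (k < J)%N.
Proof. by move=> kK; have /andP[_] := KJ; apply: leq_ltn_trans. Qed.

Lemma height_ds k r h : 0 < r -> 0 < h -> window k <= ds * (r * h ^+ k) -> height k r h <= ds.
Proof.
move=> r0 h0 H; have p0 : 0 < r * h ^+ k by rewrite mulr_gt0// exprn_gt0.
by rewrite /height ler_pdivrMr.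
Qed.

Lemma height_gt0 k r h : 0 < r -> 0 < h -> 0 < height k r h.
Proof.
move=> r0 h0; have /andP[w0 _] := window_bounds k.
by apply: divr_gt0 => //; apply: mulr_gt0 => //; exact: exprn_gt0.
Qed.

Lemma frame_size (M : R) : M <= 3 / 2 * ds -> Ce * M <= 3 / (128 * n%:R).
Proof.
move=> Md; have Ce0 : 0 < Ce := lt_le_trans ltr01 Ce1.
have n0' : 0 < n%:R :> R by rewrite ltr0n.
apply: (@le_trans _ _ (3 / 2 * (ds * Ce))).
  by rewrite mulrC mulrA ler_pM2r.
have -> : 3 / (128 * n%:R) = 3 / 2 * (1 / (64 * n%:R)) :> R by field; rewrite gt_eqF.
by rewrite ler_pM2l.
Qed.

(** The smallest scale, [h ~ r^(-1/k)]: the height equals [ds], so the order [k] pairing alone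
    bounds the norm from below and stays positive by [short3]. The permitted size of the order
    [k.+1] pairing is [2 ds / h], which exceeds [C0] by the assumption on [h]. *)
Lemma good_pure k r h : (2 <= k <= K)%N -> 0 < r -> 0 < h <= hmax k box -> h <= ds / C0 ->
  ds * (r * h ^+ k) = window k -> exists z : R -> n.-tuple R, good_scale k r h z.
Proof.
move=> /andP[k2 kK] r0 hh hC rh; have /andP[h0 _] := hh.
have Cp : 0 < C0 := lt_le_trans ltr01 C01.
have n0' : 0 < n%:R :> R by rewrite ltr0n.
have [ord1 ord2 ord3 ord4] := order.
have rhp : 0 < r * h ^+ k by rewrite mulr_gt0// exprn_gt0.
have hd : height k r h = ds by rewrite /height -rh mulfK// gt_eqF.
have [|z Hz] := @frame_fun (fun j => (j == k)%:R * (3 / 2 * ds)) (3 / 2 * ds).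
  have d0 : 0 <= 3 / 2 * ds by rewrite mulr_ge0// ltW.
  by move=> j; case: (j == k); rewrite ?mul1r ?mul0r ?normr0 ?ger0_norm.
have tJ tau : al' <= tau <= be' -> al <= tau <= be by move: ord2 ord3; slra.
have x1 tau x : al' <= tau <= be' -> (forall i, `|tnth x i - tnth (z tau) i| <= 2 * box) ->
    forall i, `|tnth x i| <= 1 / n%:R.
  move=> tau' xz; have [z1 _] := Hz _ (tJ _ tau').
  apply: (near_bounds xz z1); apply: (le_trans (frame_size (lexx _))).
  rewrite ler_pdivrMr ?mulr_gt0//.
  have -> : 1 / (2 * n%:R) * (128 * n%:R) = 64 :> R by field; rewrite gt_eqF.
  by rewrite ler_nat.
have zk tau : al <= tau <= be -> dotp (z tau) (D k tau) = 3 / 2 * ds.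
  by move=> /Hz[_ ->]; rewrite ?eqxx ?mul1r// kK (leq_trans _ k2).
exists z; split => //.
- by rewrite -rh ler_piMl ?ds_le1// ltW.
- move=> tau x tau' xz; have X1 := x1 _ _ tau' xz; split.
    rewrite unit_bound// andbT; apply: (@low_bound x k tau (ltnW (K_lt_J kK)) (tJ _ tau')).
    have := box_dotp (ltnW (K_lt_J kK)) (tJ _ tau') xz.
    by rewrite zk ?tJ// ler_norml; move: ds0; slra.
  move=> t tt; apply: (le_trans (dotp_small X1 (K_lt_J kK) tt)).
  have -> : 2 * window k / (r * h ^+ k.+1) = 2 * ds / h.
    by rewrite -rh exprSr; field; rewrite !gt_eqF// exprn_gt0.
  rewrite ler_pdivlMr// mulrC -ler_pdivlMr// (le_trans hC)//.
  by rewrite ler_pM2r ?invr_gt0// mulr_natl mulr2n lerDl ltW.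
- move=> tau tau'; rewrite hd zk//; split => // j /andP[j0 jk].
  by have [_ ->] := Hz _ tau'; rewrite ?ltn_eqF ?mul0r// j0 (leq_trans (ltnW jk)).
move=> tau x t tau' [xz _]; rewrite hd => /andP[xk _] /andP[tt tb].
have tJ' : al <= t <= be by move: tb tt (tJ _ tau'); slra.
have := dotp_osc (x1 _ _ tau' xz) (K_lt_J kK) tJ' (tJ _ tau').
by rewrite ler_norml; move: xk ds0; slra.
Qed.

(** At larger scales the height may be tiny, so the norm is kept up by prescribing the value [ds]
    for the pairing of order [k.+1], which is possible because [k < K]. That pairing stays
    nonnegative, hence the one of order [k] is nondecreasing and never falls below the height after
    [tau]. *)
Lemma good_log k r h : (2 <= k < K)%N -> 0 < r -> 0 < h <= hmax k box ->
  window k <= ds * (r * h ^+ k) -> C0 * (r * h ^+ k.+1) <= 2 * window k ->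
  exists z : R -> n.-tuple R, good_scale k r h z /\ forall tau x t, al' <= tau <= be' ->
    slab k r h tau (z tau) box x -> al <= t <= be ->
    0 <= dotp x (D k.+1 t) <= C0 /\ `|dotp x (D k t)| <= C0.
Proof.
move=> /andP[k2 kK] r0 hh rhk rhk1; have /andP[h0 _] := hh.
have Cp : 0 < C0 := lt_le_trans ltr01 C01.
have n0' : 0 < n%:R :> R by rewrite ltr0n.
have [ord1 ord2 ord3 ord4] := order.
have hd := height_ds r0 h0 rhk; have hp := height_gt0 k r0 h0.
have [|z Hz] := @frame_fun
  (fun j => if j == k then 3 / 2 * height k r h else if j == k.+1 then ds else 0) (3 / 2 * ds).
  move=> j; case: (j == k); [|case: (j == k.+1)]; rewrite ler_norml;
    by move: ds0 hd hp; set q := height k r h; slra.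
have tJ tau : al' <= tau <= be' -> al <= tau <= be by move: ord2 ord3; slra.
have x1 tau x : al' <= tau <= be' -> (forall i, `|tnth x i - tnth (z tau) i| <= 2 * box) ->
    forall i, `|tnth x i| <= 1 / n%:R.
  move=> tau' xz; have [z1 _] := Hz _ (tJ _ tau').
  apply: (near_bounds xz z1); apply: (le_trans (frame_size (lexx _))).
  rewrite ler_pdivrMr ?mulr_gt0//.
  have -> : 1 / (2 * n%:R) * (128 * n%:R) = 64 :> R by field; rewrite gt_eqF.
  by rewrite ler_nat.
have zk1 tau : al <= tau <= be -> dotp (z tau) (D k.+1 tau) = ds.
  by move=> /Hz[_ ->]; rewrite ?kK// gtn_eqF// eqxx.
have k1J : (k.+1 < J)%N by exact: K_lt_J.
have kJ := ltnW k1J.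
have y1 tau x : al' <= tau <= be' -> (forall i, `|tnth x i - tnth (z tau) i| <= 2 * box) ->
    7 / 8 * ds <= dotp x (D k.+1 tau).
  move=> tau' xz; have := box_dotp (ltnW k1J) (tJ _ tau') xz.
  by rewrite zk1 ?tJ// ler_norml; move: ds0; slra.
have y2 tau x t : al' <= tau <= be' -> (forall i, `|tnth x i - tnth (z tau) i| <= 2 * box) ->
    al <= t <= be -> 0 <= dotp x (D k.+1 t).
  move=> tau' xz tt; have := dotp_osc (x1 _ _ tau' xz) k1J tt (tJ _ tau').
  by rewrite ler_norml; move: (y1 _ _ tau' xz) ds0; slra.
exists z; split; last first.
  move=> tau x t tau' [xz _ _] tt; rewrite (y2 _ _ _ tau' xz tt)/=; split.
    by apply: (le_trans (ler_norm _)); apply: dotp_small => //; exact: x1 xz.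
  by apply: dotp_small => //; [exact: x1 xz|exact: ltnW].
split => //.
- by rewrite (le_trans rhk)// ler_piMl ?ds_le1// ltW// mulr_gt0// exprn_gt0.
- move=> tau x tau' xz; have X1 := x1 _ _ tau' xz; split.
    rewrite unit_bound// andbT; apply: (@low_bound x k.+1 tau (ltnW k1J) (tJ _ tau')).
    by move: (y1 _ _ tau' xz) ds0; slra.
  move=> t tt; apply: (le_trans (dotp_small X1 kJ tt)).
  by rewrite ler_pdivlMr// mulr_gt0// exprn_gt0.
- move=> tau tau'; have [_ H] := Hz _ tau'; split => [j /andP[j0 jk]|].
    by rewrite H ?j0 ?(leq_trans (ltnW jk) (ltnW kK))// !ltn_eqF// ltnS ltnW.
  by rewrite H ?eqxx// (leq_trans _ k2)//= ltnW.
move=> tau x t tau' [xz _] /andP[xk _] /andP[tt tb].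
have := @dotp_D_ge x k tau t 0 _ tt tb _.
rewrite mul0r subr_ge0 => /(_ _ _)/(le_trans xk) H.
apply: le_trans (H _ _).
- by rewrite ler_pdivrMr// ler_peMr ?ler1n// ltW.
- by have /andP[] := tJ _ tau'.
move=> s /andP[s1 s2]; apply: (y2 _ _ _ tau' xz).
by move: s1 s2 tb (tJ _ tau'); slra.
Qed.

Lemma height_ratio k r h h' : (2 <= k)%N -> 0 < r -> 0 < h' -> h' * 4 <= h ->
  16 * height k r h <= height k r h'.
Proof.
move=> k2 r0 h'0 hh; have /andP[w0 w1] := window_bounds k.
have h0 : 0 < h by move: hh h'0; slra.
have p0 : 0 < r * h ^+ k by rewrite mulr_gt0// exprn_gt0.
have p0' : 0 < r * h' ^+ k by rewrite mulr_gt0// exprn_gt0.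
rewrite /height mulrA ler_pdivrMr// mulrAC ler_pdivlMr// (mulrC 16) -mulrA ler_pM2l//.
rewrite mulrCA ler_pM2l//.
have -> : 16 = 4 ^+ 2 :> R by rewrite -natrX.
apply: (@le_trans _ _ (4 ^+ k * h' ^+ k)).
  by rewrite ler_wpM2r ?exprn_ge0 ?(ltW h'0)// ler_eXn2l// ltr1n.
by rewrite mulrC -exprMn lerXn2r// nnegrE ltW// mulr_gt0.
Qed.

(* The order [k] derivative increases and jumps from the height of the scale [h] to
   that of [h'], so the order [k.-1] derivative gains [height k r h' ^+ 2 / (4 * C0)],
   more than the slabs allow. *)
Lemma log_cross k r h h' z z' tau tau' x : (2 <= k < K)%N -> 0 < r -> 0 < h' -> h' * 4 <= h ->
  16 * C0 * (r * h' ^+ k.+1) < window k ^+ 2 ->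
  al' <= tau <= be' -> al' <= tau' <= be' ->
  (forall t, al <= t <= be -> 0 <= dotp x (D k.+1 t) <= C0) ->
  slab k r h tau z box x -> slab k r h' tau' z' box x -> False.
Proof.
move=> /andP[k2 kK] r0 h'0 hh rh tau1 tau1' Hx [_ Y /andP[dl du]] [_ Y' /andP[dl' du']].
have Cp : 0 < C0 := lt_le_trans ltr01 C01.
have [ord1 ord2 ord3 ord4] := order.
have /andP[w0 w1] := window_bounds k.
have h'h : h' <= h by move: hh h'0; slra.
have h0 : 0 < h := lt_le_trans h'0 h'h.
have hp := height_gt0 k r0 h0; have hp' := height_gt0 k r0 h'0.
have d16 := height_ratio k2 r0 h'0 hh.
have tJ s : al' <= s <= be' -> al <= s <= be by move: ord2 ord3; slra.
(* The pairing of order [k] is nondecreasing in time and takes at [tau'] a value far above the one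
   at [tau]. *)
have tt : tau < tau'.
  rewrite ltNge; apply/negP => tt.
  have := @dotp_D_ge x k tau' tau 0 _ tt _ _.
  rewrite mul0r subr_ge0 => /(_ _ _ _) H.
  have {H} : dotp x (D k tau') <= dotp x (D k tau).
    apply: H; [by have /andP[] := tJ _ tau1'|by have /andP[] := tJ _ tau1|].
    by move=> s ss; have /andP[] : 0 <= dotp x (D k.+1 s) <= C0 by
      apply: Hx; move: ss (tJ _ tau1) (tJ _ tau1'); slra.
  by move: du dl' d16 hp; slra.
have sJ s : tau <= s <= tau' -> al <= s <= be by move: (tJ _ tau1) (tJ _ tau1'); slra.
have lip s : tau <= s <= tau' -> dotp x (D k tau') - dotp x (D k s) <= C0 * (tau' - s).
  move=> ss; have /andP[s1 s2] := ss.
  have := @mvt_le R al be (fun s => dotp x (D k s)) (fun s => dotp x (D k.+1 s)) C0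
    tau' s (tJ _ tau1') (sJ _ ss).
  move=> H; apply: (le_trans (ler_norm _)); rewrite -[in leRHS](ger0_norm (_ : 0 <= tau' - s)) ?subr_ge0//.
  apply: H => u uJ _; first exact: is_derive_dotp.
  by have /andP[y0 y1] := Hx _ uJ; rewrite ger0_norm.
(* With slope at most [C0], the pairing cannot fall below [d' / 2] within time [d' / (2 * C0)]
   before [tau']. Moreover [c >= tau], because the pairing at [tau] is at most [d' / 8]. *)
pose d' := height k r h'; pose c := tau' - d' / (2 * C0).
have dC : 0 < d' / (2 * C0) by rewrite divr_gt0// mulr_gt0.
have c1 : tau <= c.
  have := lip tau; rewrite lexx (ltW tt) => /(_ isT) L.
  have : d' / 2 <= C0 * (tau' - tau) by move: L du dl' d16 hp; rewrite -/d'; slra.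
  rewrite -ler_pdivrMl// /c => {}L.
  have E : C0^-1 * (d' / 2) = d' / (2 * C0) by field; rewrite gt_eqF.
  by move: L; rewrite E; set q := d' / _; slra.
have c2 : c <= tau' by rewrite /c; move: dC; set q := d' / _; slra.
have cD s : c <= s <= tau' -> d' / 2 <= dotp x (D k s).
  move=> /andP[s1 s2]; have := lip s; rewrite s2 (le_trans c1 s1) => /(_ isT) L.
  have : C0 * (tau' - s) <= C0 * (d' / (2 * C0)).
    by rewrite ler_pM2l//; move: s1; rewrite /c; set q := d' / _; slra.
  have -> : C0 * (d' / (2 * C0)) = d' / 2 by field; rewrite gt_eqF.
  by move: L dl'; rewrite -/d'; slra.
have kk : k.-1.+1 = k by rewrite prednK// (leq_trans _ k2).
have k1 : (0 < k.-1 < k)%N by rewrite -ltnS kk k2/= leqnn.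
have /andP[tal tbe] := tJ _ tau1; have /andP[tal' tbe'] := tJ _ tau1'.
have I1 : d' / 2 * (d' / (2 * C0)) <= dotp x (D k.-1 tau') - dotp x (D k.-1 c).
  have := @dotp_D_ge x k.-1 c tau' (d' / 2) (le_trans tal c1) c2 tbe'.
  rewrite kk => /(_ cD); rewrite {1}/c subKr//.
have I2 : 0 <= dotp x (D k.-1 c) - dotp x (D k.-1 tau).
  have := @dotp_D_ge x k.-1 tau c 0 tal c1 (le_trans c2 tbe').
  rewrite kk mul0r; apply => s /andP[s1 s2].
  have := @dotp_D_ge x k tau s 0 tal s1 (le_trans s2 (le_trans c2 tbe')).
  rewrite mul0r subr_ge0 => H; apply: (le_trans (le_trans (ltW hp) dl)); apply: H => u /andP[u1 u2].
  by have /andP[] : 0 <= dotp x (D k.+1 u) <= C0 by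
    apply: Hx; apply: sJ; rewrite u1/= (le_trans u2)// (le_trans s2).
have := Y _ k1; have := Y' _ k1.
have : 2 / (r * h ^+ k.-1) <= 2 / (r * h' ^+ k.-1).
  rewrite ler_pM2l// lef_pV2 ?posrE ?mulr_gt0 ?exprn_gt0// ler_pM2l//.
  by rewrite lerXn2r// nnegrE ltW.
have : 4 / (r * h' ^+ k.-1) < d' / 2 * (d' / (2 * C0)).
  have -> : d' / 2 * (d' / (2 * C0)) = window k ^+ 2 / (4 * C0 * (r * h' ^+ k.+1)) / (r * h' ^+ k.-1).
    rewrite /d' /height -[in h' ^+ k]kk -[in h' ^+ k.+1]kk !exprS; field.
    by rewrite (gt_eqF Cp) (gt_eqF r0) (gt_eqF h'0) expf_neq0 ?(gt_eqF h'0).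
  rewrite ltr_pM2r ?invr_gt0 ?mulr_gt0 ?exprn_gt0// ltr_pdivlMr ?mulr_gt0 ?exprn_gt0//.
  by have -> : 4 * (4 * C0 * (r * h' ^+ k.+1)) = 16 * C0 * (r * h' ^+ k.+1) by ring.
have -> : 4 / (r * h' ^+ k.-1) = 2 * (2 / (r * h' ^+ k.-1)) by ring.
move: I1 I2; rewrite !ler_norml.
by set q := 2 / (r * h' ^+ _); set q' := 2 / _; set D2 := d' / 2 * _; slra.
Qed.

(** * Lower bounds at single scales and along chains of scales *)

Lemma gain_gt0 : 0 < gain.
Proof.
have /andP[m0 _] := m01; have /andP[c0 _] := chi001.
by apply: divr_gt0 => //; apply: mulr_gt0.
Qed.

Lemma scale_const_gt0 k : 0 < scale_const k box.
Proof.
have /andP[w0 _] := window_bounds k; have /andP[b0 _] := box_bounds.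
have S0 : 0 < spacing k := lt_le_trans ltr01 (spacing_ge1 k).
apply: mulr_gt0; last by rewrite divr_gt0 ?subr_gt0 ?mulr_gt0.
rewrite /volume divr1; apply: mulr_gt0; first exact: exprn_gt0.
apply: exprn_gt0; apply: divr_gt0 => //.
by rewrite mulr_gt0// ltr_wpDl// mulr_ge0// (le_trans ler01).
Qed.

Lemma single_scale k r h p (z : R -> n.-tuple R) : (2 <= k <= K)%N -> 0 < r -> 1 <= p ->
  good_scale k r h z ->
  (((gain `^ p * scale_const k box * h `^ (p - q_ k) / r ^+ k) `^ p^-1)%:E
    <= Gq `[a, b] gamma chi p%:E r)%E.
Proof.
move=> kK r0 p1 good.
have := @multi_scale k r p 1 (fun=> h) (fun=> z) kK r0 p1 (fun _ _ => good).
rewrite big_ord_recl big_ord0 addr0; apply => i j tau tau' x /andP[ij].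
by rewrite ltnS leqn0 => /eqP j0; rewrite j0 in ij.
Qed.

Lemma good_infty k r h (z : R -> n.-tuple R) : (2 <= k <= K)%N -> 0 < r ->
  good_scale k r h z -> ((gain * h)%:E <= Gq `[a, b] gamma chi +oo r)%E.
Proof.
move=> kK r0 [h1 h2 h3 h4 _].
exact: (@scale_infty k r h box z kK r0 box_bounds).
Qed.

(** With [h = W r^(-1/k)] the exponent [((q - q_k) / k + k) / q] is exactly the [k]-th term of
    [sigma]. *)
Lemma pure_bound k : (2 <= k <= K)%N -> exists c r0, [/\ 0 < c, 1 <= r0 & forall r, r0 < r ->
  (forall q : R, 2 < q -> ((c * r `^ (- sigma_term q%:E k))%:E <= Gq `[a, b] gamma chi q%:E r)%E) /\
  ((c * r `^ (- (1 / k%:R)))%:E <= Gq `[a, b] gamma chi +oo r)%E].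
Proof.
move=> kK; have /andP[k2 kK'] := kK.
have /andP[w0 _] := window_bounds k; have /andP[b0 _] := box_bounds.
have Cp : 0 < C0 := lt_le_trans ltr01 C01.
have k0 : 0 < k%:R :> R by rewrite ltr0n (leq_trans _ k2).
have kn : k%:R != 0 :> R by rewrite gt_eqF.
pose hP := Num.min (hmax k box) (ds / C0).
have hP0 : 0 < hP by rewrite lt_min hmax_gt0//= divr_gt0.
(* This choice makes [ds * (r * h ^+ k) = window k] hold exactly. *)
pose W := (window k / ds) `^ k%:R^-1.
have wd : 0 < window k / ds by exact: divr_gt0.
have W0 : 0 < W by rewrite powR_gt0.
have [c [c0 cW Hc]] := power_bound k%:R^-1 (q_ k) gain_gt0 (scale_const_gt0 k) W0.
have hPW : 0 < hP / W by exact: divr_gt0.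
have ki0 : 0 < k%:R^-1 :> R by rewrite invr_gt0.
have [r0 [r01 Hr]] := powR_large hPW ki0.
exists c, r0; split => // r rr.
have r1 : 1 < r := le_lt_trans r01 rr.
have rp : 0 < r := lt_trans ltr01 r1.
pose h := W * r `^ (- k%:R^-1).
have h0 : 0 < h by rewrite mulr_gt0// powR_gt0.
have hP' : h <= hP.
  have rk0 : 0 < r `^ k%:R^-1 by rewrite powR_gt0.
  have := Hr _ rr; rewrite /h powRN -ler_pdivlMr ?invr_gt0// invrK.
  by rewrite mulrAC ler_pdivlMr// mul1r (mulrC hP).
have [z good] : exists z : R -> n.-tuple R, good_scale k r h z.
  apply: good_pure => //.
  - by rewrite h0/= (le_trans hP')// ge_min lexx.
  - by rewrite (le_trans hP')// ge_min lexx orbT.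
  rewrite /h exprMn -!powR_mulrn ?powR_ge0 ?(ltW W0)// -!powRrM mulNr mulVf//.
  rewrite powRr1 ?(ltW wd)// powRN powRr1 ?(ltW rp)//.
  by set w := window k; field; rewrite !gt_eqF.
split; last first.
  apply: le_trans (good_infty kK rp good); rewrite lee_fin /h div1r mulrA.
  by rewrite ler_wpM2r// powR_ge0.
move=> q q2; have q1 : 1 <= q by move: q2; slra.
apply: le_trans (single_scale kK rp q1 good); rewrite lee_fin.
apply: le_trans (Hc q r k q1 rp).
rewrite le_eqVlt; apply/orP; left; apply/eqP; congr (_ * _ `^ (- _)).
have qn : q != 0 by rewrite gt_eqF// (le_lt_trans _ q2).
rewrite /sigma_term inver (negbTE qn)/= /q_; field.
by rewrite kn qn.
Qed.

(** At [q = q_k] the power of [h] disappears, so every admissible scale contributes the same amount.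
    The scales [H / 4^i] are admissible for [i <= A ln r], and [log_cross] makes their slabs
    disjoint. *)
Lemma log_scale_bound k : (2 <= k < K)%N -> exists c r0, [/\ 0 < c, 1 <= r0 & forall r, r0 < r ->
  ((c * r `^ (- (k%:R / q_ k)) * ln r `^ (1 / q_ k))%:E <= Gq `[a, b] gamma chi (q_ k)%:E r)%E].
Proof.
move=> kK; have /andP[k2 kK'] := kK.
have kK2 : (2 <= k <= K)%N by rewrite k2 ltnW.
have /andP[w0 w1] := window_bounds k; have /andP[b0 _] := box_bounds.
have Cp : 0 < C0 := lt_le_trans ltr01 C01.
have k0 : 0 < k%:R :> R by rewrite ltr0n (leq_trans _ k2).
have q1 : 1 <= q_ k :> R.
  by rewrite -q_sum ler1n.
have q0 : 0 < q_ k :> R := lt_le_trans ltr01 q1.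
(* Largest scales satisfy [r H^(k+1) = kap]. Then [C0 * kap <= 2 * window k] as in [good_log], and
   [16 * C0 * kap] is half of [window k ^+ 2], as in [log_cross]. *)
pose kap := window k ^+ 2 / (32 * C0).
have kap0 : 0 < kap by rewrite divr_gt0 ?exprn_gt0// mulr_gt0.
(* At the largest scale [r H^k] grows like [r^(1/(k+1))]. With this [A] the descent divides it by at
   most [r^(1/(2(k+1)))], so the smallest scale still meets the lower condition of [good_log]. *)
pose A : R := (4 * k%:R * k.+1%:R)^-1.
have A0 : 0 < A by rewrite invr_gt0 !mulr_gt0.
have [c [c0 Hc]] := log_bound k gain_gt0 (scale_const_gt0 k) A0 q0.
pose E := kap `^ k.+1%:R^-1.
have E0 : 0 < E by rewrite powR_gt0.
have k10 : 0 < k.+1%:R^-1 :> R by rewrite invr_gt0.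
have [r1 [r11 Hr1]] := powR_large (divr_gt0 (hmax_gt0 k b0) E0) k10.
have dE : 0 < ds * E ^+ k / window k.
  by apply: divr_gt0 => //; rewrite mulr_gt0// exprn_gt0.
have k20 : 0 < (2 * k.+1%:R)^-1 :> R by rewrite invr_gt0 mulr_gt0.
have [r2 [r21 Hr2]] := powR_large dE k20.
exists c, (Num.max r1 r2); split => //; first by rewrite le_max r11.
move=> r; rewrite gt_max => /andP[rr1 rr2].
have r1' : 1 < r := le_lt_trans r11 rr1.
have rp : 0 < r := lt_trans ltr01 r1'.
have l0 : 0 <= ln r by rewrite ln_ge0// ltW.
pose L := (Num.truncn (A * ln r)).+1.
pose H := E * r `^ (- k.+1%:R^-1).
have H0 : 0 < H by rewrite mulr_gt0// powR_gt0.
have Hm : H <= hmax k box.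
  have rk0 : 0 < r `^ k.+1%:R^-1 by rewrite powR_gt0.
  have := Hr1 _ rr1; rewrite /H powRN; set hm := hmax k box.
  rewrite -ler_pdivlMr ?invr_gt0// invrK.
  by rewrite mulrAC ler_pdivlMr// mul1r (mulrC hm).
have rH1 : r * H ^+ k.+1 = kap.
  rewrite /H exprMn -!powR_mulrn ?powR_ge0 ?(ltW E0)// -!powRrM mulNr mulVf ?gt_eqF//.
  by rewrite powRr1 ?(ltW kap0)// powRN powRr1 ?(ltW rp)// mulrCA mulfV ?mulr1// gt_eqF.
have rH : r * H ^+ k = E ^+ k * r `^ k.+1%:R^-1.
  rewrite /H exprMn mulrCA; congr (_ * _).
  rewrite -powR_mulrn ?powR_ge0// -powRrM -{1}(powRr1 (ltW rp)) -powRD ?(gt_eqF rp) ?implybT//.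
  by congr (_ `^ _); rewrite -natr1; field; rewrite ?natr1.
pose h (i : nat) : R := H / 4 ^+ i.
have h0 i : 0 < h i by rewrite divr_gt0// exprn_gt0.
have hH i : h i <= H by rewrite ler_pdivrMr ?exprn_gt0// ler_peMr ?(ltW H0)// exprn_ege1// ler1n.
have rh1 i : r * h i ^+ k.+1 <= kap.
  by rewrite -rH1 ler_pM2l// lerXn2r// nnegrE ltW.
have /boolp.choice[z Hz] : forall i, exists v : R -> n.-tuple R, (i < L)%N ->
    good_scale k r (h i) v /\ forall tau x t, al' <= tau <= be' ->
    slab k r (h i) tau (v tau) box x -> al <= t <= be ->
    0 <= dotp x (D k.+1 t) <= C0 /\ `|dotp x (D k t)| <= C0.
  move=> i; have [iL|_] := ltnP i L; last by exists (fun=> nseq_tuple n 0).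
  have [|||z Hz] := @good_log k r (h i) kK rp; last by exists z.
  - by rewrite h0 (le_trans (hH i)).
  - have iA : i%:R <= A * ln r.
      have Al : 0 <= A * ln r by rewrite mulr_ge0// ltW.
      by have /andP[T _] := truncn_itv Al; rewrite (le_trans _ T)// ler_nat.
    have := dyadic k (ltW r1') iA.
    have -> : 2 * (A * k%:R) = (2 * k.+1%:R)^-1.
      by rewrite /A; field; rewrite ?natr1 !gt_eqF.
    move=> D4; have := Hr2 _ rr2 => D5.
    rewrite expr_div_n -exprM [X in ds * X]mulrA rH mulrA ler_pdivlMr ?exprn_gt0//.
    apply: (@le_trans _ _ (window k * r `^ (2 * k.+1%:R)^-1)); first by rewrite ler_pM2l.
    have -> : r `^ k.+1%:R^-1 = r `^ (2 * k.+1%:R)^-1 * r `^ (2 * k.+1%:R)^-1.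
      rewrite -powRD ?(gt_eqF rp) ?implybT//; congr (_ `^ _).
      by field; rewrite ?natr1 ?gt_eqF.
    rewrite [leRHS]mulrA [leRHS]mulrA ler_pM2r ?powR_gt0//.
    rewrite -(ler_pM2l w0) mulr1 in D5; apply: (le_trans D5).
    rewrite le_eqVlt; apply/orP; left; apply/eqP; move: w0.
    by set w := window k => w0; field; rewrite !gt_eqF.
  - apply: (@le_trans _ _ (C0 * kap)); first by rewrite ler_pM2l.
    have -> : C0 * kap = window k * (window k / 32).
      by rewrite /kap; set w := window k; field; rewrite gt_eqF.
    rewrite mulrC ler_pM2r// ler_pdivrMr//.
    by move: w1; set w := window k; slra.
have := @multi_scale k r (q_ k) L h z kK2 rp q1 (fun i iL => (Hz i iL).1).
have -> : \sum_(i < L) h i `^ (q_ k - q_ k) = L%:R.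
  under eq_bigr do rewrite subrr powRr0.
  by rewrite sumr_const card_ord.
move=> M; apply: le_trans (M _); first rewrite lee_fin.
  apply: Hc; first exact: ltW.
  by have := truncnS_gt (A * ln r); rewrite -/L => /ltW.
move=> i j tau tau' x /andP[ij jL] t1 t1' X X'.
apply: (@log_cross k r (h i) (h j) _ _ tau tau' x kK rp (h0 j) _ _ t1 t1' _ X X').
- have -> : h i = h j * 4 ^+ (j - i).
    rewrite /h -{1}(subnK (ltnW ij)) exprD; field.
    by rewrite !expf_neq0.
  by rewrite ler_pM2l// ler_eXnr ?subn_gt0// ler1n.
- apply: (@le_lt_trans _ _ (16 * C0 * kap)); first by rewrite ler_pM2l// mulr_gt0.
  have -> : 16 * C0 * kap = window k ^+ 2 / 2.
    by rewrite /kap; set w := window k; field; rewrite gt_eqF.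
  have : 0 < window k ^+ 2 by exact: exprn_gt0.
  by set w2 := window k ^+ 2; slra.
move=> t tJ; have iL := ltn_trans ij jL.
by have [] := (Hz i iL).2 tau x t t1 X tJ.
Qed.

(** * Curves whose next derivative vanishes *)

Variable z0 : n.-tuple R.
Hypothesis z0_orth : forall j t, (0 < j <= K)%N -> al <= t <= be -> dotp z0 (D j t) = 0.
Hypothesis z0_le : forall i, `|tnth z0 i| <= 1 / (4 * n%:R).
Hypothesis z0_ge : exists i, 1 / (4 * n%:R) <= `|tnth z0 i|.
Hypothesis flat : forall t i, al <= t <= be -> tnth (D K.+1 t) i = 0.

Local Ltac slra ::= clear -gamma_cont chi_meas chi01 C01 DD DC D0 chi_supp chi_ge
  order m01 chi001 Ce1 n0 J2 short1 short2 K KJ omega0 frame ds0 dsCe mE short3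
  z0_orth z0_le z0_ge flat; lra.

Lemma dotp_flat x t : al <= t <= be -> dotp x (D K.+1 t) = 0.
Proof. by move=> tJ; rewrite /dotp big1// => i _; rewrite flat// mulr0. Qed.

Lemma flat_const x t tau : al <= t <= be -> al <= tau <= be ->
  dotp x (D K t) = dotp x (D K tau).
Proof.
move=> tJ tauJ.
have D1 s : al <= s <= be -> `|s - tau| <= `|t - tau| ->
    is_derive s 1 (fun s => dotp x (D K s)) (dotp x (D K.+1 s)).
  by move=> sJ _; exact: is_derive_dotp.
have D2 s : al <= s <= be -> `|s - tau| <= `|t - tau| -> `|dotp x (D K.+1 s)| <= 0.
  by move=> sJ _; rewrite dotp_flat// normr0.
by have := mvt_le tJ tauJ D1 D2; rewrite mul0r normr_le0 subr_eq0 => /eqP.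
Qed.

(** The fixed vector [z0] keeps the norm of the centers bounded below without affecting any pairing,
    so the height may be as small as desired. The pairing of order [K] is constant in time, and that
    of order [K.+1] is zero. *)
Lemma good_flat r h : 0 < r -> 0 < h <= hmax K box ->
  window K <= ds * (r * h ^+ K) -> exists z : R -> n.-tuple R, good_scale K r h z.
Proof.
move=> r0 hh rhk; have /andP[h0 _] := hh; have /andP[K2 KJ'] := KJ.
have n0' : 0 < n%:R :> R by rewrite ltr0n.
have nn : n%:R != 0 :> R by rewrite gt_eqF.
have [ord1 ord2 ord3 ord4] := order.
have hd := height_ds r0 h0 rhk; have hp := height_gt0 K r0 h0.
have /andP[w0 _] := window_bounds K.
have rhp : 0 < r * h ^+ K by rewrite mulr_gt0// exprn_gt0.
have [|z Hz] := @frame_fun (fun j => if j == K then 3 / 2 * height K r h else 0) (3 / 2 * ds).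
  move=> j; case: (j == K); rewrite ler_norml;
    by move: ds0 hd hp; set q := height K r h; slra.
have tJ tau : al' <= tau <= be' -> al <= tau <= be by move: ord2 ord3; slra.
(* A common unit: some coordinate of [z0] is [32 u] in absolute value, the correction is at most
   [3 u] and the box at most [u / 4], so that coordinate of [x] stays above [16 u]. *)
pose u : R := 1 / (128 * n%:R).
have u0 : 0 < u by rewrite divr_gt0// mulr_gt0.
have E1 : 1 / (4 * n%:R) = 32 * u by rewrite /u; field.
have E2 : 3 / (128 * n%:R) = 3 * u by rewrite /u; field.
have zz tau i : al <= tau <= be -> `|tnth (z tau) i| <= 3 * u.
  move=> tauJ; have [z1 _] := Hz _ tauJ; rewrite -E2.
  exact: le_trans (z1 i) (frame_size (lexx _)).
pose z' tau := tadd z0 (z tau).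
have x1 tau x : al' <= tau <= be' -> (forall i, `|tnth x i - tnth (z' tau) i| <= 2 * box) ->
    forall i, `|tnth x i| <= 1 / n%:R.
  move=> tau' xz; apply: (near_bounds xz (M := 35 * u)) => [i|]; last first.
    have -> : 1 / (2 * n%:R) = 64 * u by rewrite /u; field.
    by move: u0; slra.
  rewrite tnth_mktuple (le_trans (ler_normD _ _))//.
  have := z0_le i; rewrite E1; have := zz _ i (tJ _ tau').
  by set p := `|tnth z0 i|; set q := `|_|; slra.
have dz tau j : al <= tau <= be -> (0 < j <= K)%N ->
    dotp (z' tau) (D j tau) = if j == K then 3 / 2 * height K r h else 0.
  by move=> tauJ jK; have [_ H] := Hz _ tauJ; rewrite dotp_tadd z0_orth// add0r H.
exists z'; split => //.
- by rewrite (le_trans rhk)// ler_piMl ?ds_le1// ltW.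
- move=> tau x tau' xz; have X1 := x1 _ _ tau' xz; split.
    rewrite unit_bound// andbT; have [i zi] := z0_ge.
    apply: (@low_bound_coord x i); have := xz i; rewrite tnth_mktuple => X.
    have B := box_le; have Z := zz _ i (tJ _ tau').
    have E3 : 1 / (8 * n%:R) = 16 * u by rewrite /u; field.
    have E4 : 1 / (8 * 64 * n%:R) = u / 4 by rewrite /u; field.
    rewrite E3; rewrite E1 in zi; rewrite E4 in B.
    have := ler_normD (tnth x i) (- (tnth x i - (tnth z0 i + tnth (z tau) i)) - tnth (z tau) i).
    have -> : tnth x i + (- (tnth x i - (tnth z0 i + tnth (z tau) i)) - tnth (z tau) i) = tnth z0 i by ring.
    have := ler_normB (- (tnth x i - (tnth z0 i + tnth (z tau) i))) (tnth (z tau) i).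
    rewrite normrN; move: X B Z zi u0.
    set p1 := `|tnth z0 i|; set p2 := `|tnth (z tau) i|; set p3 := `|tnth x i - _|.
    by set p4 := `|tnth x i|; set p5 := `|_|; set bb := box; slra.
  move=> t tt; rewrite dotp_flat// normr0; apply: divr_ge0.
    by apply: mulr_ge0 => //; exact: ltW.
  by apply: mulr_ge0; [|apply: exprn_ge0]; exact: ltW.
- move=> tau tauJ; rewrite dz ?eqxx// ?leqnn ?andbT ?(leq_trans _ K2)//; split => // j /andP[j0 jK].
  by rewrite dz// ?ltn_eqF// j0 ltnW.
move=> tau x t tau' [xz _] /andP[xk _] /andP[tt tb].
have tJ' : al <= t <= be by move: tb tt (tJ _ tau'); slra.
by rewrite (flat_const x tJ' (tJ _ tau')) (le_trans _ xk)// ler_pdivrMr// ler_peMr ?ler1n// ltW.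
Qed.

Lemma flat_bound : exists c r0, [/\ 0 < c, 1 <= r0 & forall r, r0 < r ->
  [/\ forall q : R, 2 < q -> ((c * r `^ (- (K%:R / q)))%:E <= Gq `[a, b] gamma chi q%:E r)%E,
    (c%:E <= Gq `[a, b] gamma chi +oo r)%E &
    ((c * r `^ (- (K%:R / q_ K)) * ln r `^ (1 / q_ K))%:E <= Gq `[a, b] gamma chi (q_ K)%:E r)%E]].
Proof.
have /andP[K2 KJ'] := KJ.
have KK : (2 <= K <= K)%N by rewrite K2 leqnn.
have /andP[w0 w1] := window_bounds K; have /andP[b0 _] := box_bounds.
have k0 : 0 < K%:R :> R by rewrite ltr0n (leq_trans _ K2).
have q1 : 1 <= q_ K :> R by rewrite -q_sum ler1n.
have q0 : 0 < q_ K :> R := lt_le_trans ltr01 q1.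
pose H := hmax K box; have H0 : 0 < H := hmax_gt0 K b0.
(* Taking [s = 0] keeps the scale independent of [r]; the only remaining power is [r^(-K/q)]. *)
have [c1 [c10 c1W Hc1]] := power_bound 0 (q_ K) gain_gt0 (scale_const_gt0 K) H0.
pose A : R := (4 * K%:R)^-1.
have A0 : 0 < A by rewrite invr_gt0 !mulr_gt0.
have [c2 [c20 Hc2]] := log_bound K gain_gt0 (scale_const_gt0 K) A0 q0.
have dH : 0 < ds * H ^+ K / window K.
  by apply: divr_gt0 => //; rewrite mulr_gt0// exprn_gt0.
have k20 : 0 < (2 : R)^-1 by rewrite invr_gt0.
have [r0 [r01 Hr]] := powR_large dH k20.
exists (Num.min c1 c2), r0; split => //; first by rewrite lt_min c10.
move=> r rr; have r1 : 1 < r := le_lt_trans r01 rr.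
have rp : 0 < r := lt_trans ltr01 r1.
have l0 : 0 <= ln r by rewrite ln_ge0// ltW.
have rS : r = r `^ 2^-1 * r `^ 2^-1.
  rewrite -powRD ?(gt_eqF rp) ?implybT//.
  by rewrite (_ : 2^-1 + 2^-1 = 1) ?powRr1 ?(ltW rp)//; field.
have S0 : 0 < r `^ 2^-1 by rewrite powR_gt0.
have wH : window K * r `^ 2^-1 <= ds * (r * H ^+ K).
  rewrite [in leRHS]rS; have D5 := Hr _ rr.
  rewrite -(ler_pM2l w0) mulr1 -(ler_pM2r S0) in D5; apply: (le_trans D5).
  rewrite le_eqVlt; apply/orP; left; apply/eqP; move: w0.
  by set w := window K => w0; field; rewrite !gt_eqF.
have S1 : 1 <= r `^ 2^-1.
  have : r `^ 0 <= r `^ 2^-1 by apply: ler_powR; rewrite ltW.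
  by rewrite powRr0.
have [z good] : exists z : R -> n.-tuple R, good_scale K r H z.
  apply: good_flat => //; first by rewrite H0 lexx.
  by apply: le_trans wH; rewrite -[leLHS]mulr1 ler_pM2l.
have cmin c : c = c1 \/ c = c2 -> Num.min c1 c2 <= c.
  by case=> ->; rewrite ge_min lexx ?orbT.
split.
- move=> q q2; have q1' : 1 <= q by move: q2; slra.
  apply: le_trans (single_scale KK rp q1' good); rewrite lee_fin.
  have := Hc1 q r K q1' rp; rewrite oppr0 powRr0 mulr1 mul0r add0r.
  apply: le_trans; apply: ler_wpM2r; first exact: powR_ge0.
  by apply: cmin; left.
- apply: le_trans (good_infty KK rp good); rewrite lee_fin.
  by apply: le_trans c1W; apply: cmin; left.
pose L := (Num.truncn (A * ln r)).+1.
pose h (i : nat) : R := H / 4 ^+ i.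
have h0 i : 0 < h i by rewrite divr_gt0// exprn_gt0.
have hH i : h i <= H by rewrite ler_pdivrMr ?exprn_gt0// ler_peMr ?(ltW H0)// exprn_ege1// ler1n.
have /boolp.choice[zs Hz] : forall i, exists v : R -> n.-tuple R, (i < L)%N ->
    good_scale K r (h i) v.
  move=> i; have [iL|_] := ltnP i L; last by exists (fun=> nseq_tuple n 0).
  have [||v Hv] := @good_flat r (h i) rp; last by exists v.
    by rewrite h0 hH.
  have iA : i%:R <= A * ln r.
    have Al : 0 <= A * ln r by rewrite mulr_ge0// ltW.
    by have /andP[T _] := truncn_itv Al; rewrite (le_trans _ T)// ler_nat.
  have := dyadic K (ltW r1) iA.
  have -> : 2 * (A * K%:R) = 2^-1 by rewrite /A; field; rewrite !gt_eqF.
  move=> D4; rewrite expr_div_n -exprM !mulrA ler_pdivlMr ?exprn_gt0//.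
  by rewrite -mulrA (le_trans _ wH)// ler_pM2l.
have := @multi_scale K r (q_ K) L h zs KK rp q1 Hz.
have -> : \sum_(i < L) h i `^ (q_ K - q_ K) = L%:R.
  under eq_bigr do rewrite subrr powRr0.
  by rewrite sumr_const card_ord.
move=> M; apply: le_trans (M _); first rewrite lee_fin.
  have := Hc2 r L (ltW r1); have /ltW AL := truncnS_gt (A * ln r); move=> /(_ AL).
  apply: le_trans; apply: ler_wpM2r; first exact: powR_ge0.
  by apply: ler_wpM2r; [exact: powR_ge0|apply: cmin; right].
move=> i j tau tau' x /andP[ij jL] t1 t1' [_ _ /andP[_ X]] [_ _ /andP[X' _]].
have [ord1 ord2 ord3 ord4] := order.
have hh : h j * 4 <= h i.
  have -> : h i = h j * 4 ^+ (j - i).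
    rewrite /h -{1}(subnK (ltnW ij)) exprD; field.
    by rewrite !expf_neq0.
  by rewrite ler_pM2l// ler_eXnr ?subn_gt0// ler1n.
have d16 := height_ratio K2 rp (h0 j) hh.
have hp := height_gt0 K rp (h0 i).
(* As this pairing does not depend on the center, it would have to lie both below two heights of the
   coarse scale and above the height of the fine one, which is at least 16 times larger. *)
have E : dotp x (D K tau) = dotp x (D K tau').
  by apply: flat_const; move: ord2 ord3 t1 t1'; slra.
by move: X X' d16 hp; rewrite E; set q := height K r (h i); slra.
Qed.

End scale.

(** * A smooth bump *)

Section bump.
Context {R : realType}.
Implicit Types (x t : R) (f : R -> R).

Lemma der_quadratic_zero f (C : R) : (forall y, `|f y| <= C * y ^+ 2) -> is_derive (0 : R) 1 f 0.
Proof.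
move=> fC; have f0 : f 0 = 0.
  by apply/eqP; rewrite -normr_le0 (le_trans (fC 0))// expr0n mulr0.
have H : (fun h : R => h^-1 *: ((f \o shift 0) (h *: (1 : R^o)) - f 0)) @ 0^' --> (0 : R^o).
  apply/cvgr0Pnorm_le => e e0; near=> h.
  have h0 : h != 0 by near: h; exact: nbhs_dnbhs_neq.
  rewrite f0 subr0 /= addr0 [h *: 1]mulr1 [_ *: _]/(_ * _) normrM normfV.
  rewrite -ler_pdivlMl ?invr_gt0 ?normr_gt0// invrK (le_trans (fC h))//.
  rewrite -real_normK ?num_real// expr2 mulrA mulrC ler_wpM2l//.
  apply: (@le_trans _ _ ((`|C| + 1) * `|h|)).
    by rewrite ler_wpM2r// (le_trans (ler_norm _))// lerDl.
  have C0 : 0 < `|C| + 1 by rewrite ltr_wpDl.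
  rewrite -ler_pdivlMl//; near: h; apply: (@cvgr0_norm_le _ _ _ _ _ (fun h : R => h)).
    exact: cvg_within.
  by rewrite mulr_gt0// invr_gt0.
by split; [apply/cvg_ex; exists 0|exact: cvg_lim H].
Unshelve. all: by end_near. Qed.

(** The functions [x^(-n) e^(-1/x)], extended by zero. The derivative of one of them is a
    combination of the next two, so the family handles derivatives of all orders of [e^(-1/x)] at
    once. *)
Definition flat_exp (n : nat) x : R :=
  if 0 < x then x ^- n * expR (- x^-1) else 0.

(** One term of the exponential series, [e^(1/y) >= y^-(n+2) / (n+2)!], is enough. A quadratic bound
    yields derivative zero at the origin. *)
Lemma flat_exp_bound n y : `|flat_exp n y| <= n.+2`!%:R * y ^+ 2.
Proof.
rewrite /flat_exp; case: ifPn => [y0|_]; last by rewrite normr0 mulr_ge0// sqr_ge0.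
rewrite ger0_norm; last by rewrite mulr_ge0 ?expR_ge0// invr_ge0 exprn_ge0// ltW.
have yi : 0 <= y^-1 by rewrite invr_ge0 ltW.
have yn : y != 0 by rewrite gt_eqF.
have F0 : 0 < n.+2`!%:R :> R by rewrite ltr0n fact_gt0.
have H : y^-1 ^+ n.+2 / n.+2`!%:R <= expR y^-1.
  by apply: le_trans (expR_ge1Dxn n.+1 yi); rewrite lerDr.
rewrite expRN ler_pdivrMl ?exprn_gt0// -[leLHS]mul1r ler_pdivrMr ?expR_gt0//.
have P0 : 0 <= y ^+ n * (n.+2`!%:R * y ^+ 2).
  by rewrite !mulr_ge0 ?exprn_ge0// ltW.
apply: le_trans (ler_wpM2l P0 H); rewrite le_eqVlt; apply/orP; left; apply/eqP.
rewrite exprVn -addn2 exprD; set F := _%:R in F0 *; field.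
by rewrite yn expf_neq0// gt_eqF.
Qed.

Lemma der_flat_exp n x : is_derive x 1 (flat_exp n) (- n%:R * flat_exp n.+1 x + flat_exp n.+2 x).
Proof.
have [x0|x0|->] := ltgtP x 0.
- rewrite {2 3}/flat_exp ltNge (ltW x0)/= mulr0 addr0.
  have N : \near x, (fun=> 0 : R) x = flat_exp n x.
    near=> y; rewrite /flat_exp ltNge ifF//; apply/negbTE; rewrite negbK; apply: ltW; near: y.
    exact: lt_nbhsl.
  exact: (near_eq_is_derive N (der_cst 0 x)).
- rewrite {2 3}/flat_exp x0.
  have N : \near x, (fun y => y ^- n * expR (- y^-1)) x = flat_exp n x.
    by near=> y; rewrite /flat_exp ifT//; near: y; exact: lt_nbhsr.
  apply: (near_eq_is_derive N).
  have xn : x != 0 by rewrite gt_eqF.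
  have D1 : is_derive x 1 (fun y => expR (- y^-1)) (expR (- x^-1) * x ^- 2).
    have D0 := der_opp (@der_inv _ (fun y => y) x 1 xn (der_id x)).
    have := @der_comp _ expR (fun y => - y^-1) x _ _ (is_derive_expR (- x^-1)) D0.
    by have -> : expR (- x^-1) * - (- 1 / x ^+ 2) = expR (- x^-1) * x ^- 2 by field.
  apply: der_eq; eexists; first by der; rewrite expf_neq0.
  case: n {N} => [|n]; first by rewrite /=; field; rewrite xn.
  by rewrite /= !exprS; field; rewrite expf_neq0.
have -> : - n%:R * flat_exp n.+1 0 + flat_exp n.+2 0 = 0.
  by rewrite /flat_exp ltxx mulr0 addr0.
exact: (der_quadratic_zero (flat_exp_bound n)).
Unshelve. all: by end_near. Qed.

Lemma flat_exp_ge0 n x : 0 <= flat_exp n x.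
Proof.
rewrite /flat_exp; case: ifP => // x0.
by rewrite mulr_ge0 ?expR_ge0// invr_ge0 exprn_ge0// ltW.
Qed.

Lemma flat_exp_le1 x : flat_exp 0 x <= 1.
Proof.
rewrite /flat_exp; case: ifP => // x0.
by rewrite expr0 invr1 mul1r -expR0 ler_expR oppr_le0 invr_ge0 ltW.
Qed.

Lemma flat_exp_gt0 x : (0 < flat_exp 0 x) = (0 < x).
Proof.
rewrite /flat_exp; case: ifP; last by rewrite ltxx.
by rewrite expr0 invr1 mul1r expR_gt0.
Qed.

Lemma flat_exp_mono x y : x <= y -> flat_exp 0 x <= flat_exp 0 y.
Proof.
move=> xy; rewrite {1}/flat_exp; case: ifPn => [x0|_]; last exact: flat_exp_ge0.
rewrite /flat_exp (lt_le_trans x0 xy) !expr0 invr1 !mul1r ler_expR lerN2.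
by rewrite lef_pV2 ?posrE ?(lt_le_trans x0 xy).
Qed.

(* Smoothness of the bump needs only a class of functions stable under derivation. *)
Inductive bump_sum (u v : R) : (R -> R) -> Prop :=
| BumpTerm n m : bump_sum u v (fun t => flat_exp n (t - u) * flat_exp m (v - t))
| BumpAdd f g : bump_sum u v f -> bump_sum u v g -> bump_sum u v (fun t => f t + g t)
| BumpScale c f : bump_sum u v f -> bump_sum u v (fun t => c * f t).

Lemma bump_sum_derive u v f : bump_sum u v f ->
  exists f', bump_sum u v f' /\ forall t, is_derive t 1 f (f' t).
Proof.
elim=> [n m|{}f g _ [f' [F dF]] _ [g' [G dG]]|c {}f _ [f' [F dF]]].
- pose T i j := fun t => flat_exp i (t - u) * flat_exp j (v - t).
  exists (fun t => (- n%:R * T n.+1 m t + T n.+2 m t) + (m%:R * T n m.+1 t + -1 * T n m.+2 t)).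
  split.
    by do 2?[apply: BumpAdd]; do ?[apply: BumpScale]; apply: BumpTerm.
  move=> t.
  have D1 : is_derive t 1 (fun t => flat_exp n (t - u))
      ((- n%:R * flat_exp n.+1 (t - u) + flat_exp n.+2 (t - u)) * (1 + 0)).
    have D0 : is_derive t 1 (fun t => t - u) (1 + 0) by der.
    exact: (@der_comp _ (flat_exp n) (fun t => t - u) _ _ _ (der_flat_exp n (t - u)) D0).
  have D2 : is_derive t 1 (fun t => flat_exp m (v - t))
      ((- m%:R * flat_exp m.+1 (v - t) + flat_exp m.+2 (v - t)) * (0 + - 1)).
    have D0 : is_derive t 1 (fun t => v - t) (0 + - 1) by der.
    exact: (@der_comp _ (flat_exp m) (fun t => v - t) _ _ _ (der_flat_exp m (v - t)) D0).
  apply: der_eq; eexists; first exact: der_mul D1 D2.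
  by rewrite /T; ring.
- exists (fun t => f' t + g' t); split; first exact: BumpAdd.
  by move=> t; exact: der_add.
- exists (fun t => c * f' t); split; first exact: BumpScale.
  move=> t; apply: der_eq; eexists; first exact: der_mul (der_cst c t) (dF t).
  by rewrite /=; ring.
Qed.

Lemma bump_sum_smooth u v f : bump_sum u v f -> smooth f.
Proof.
move=> Hf k; have : bump_sum u v (derive1n k f).
  elim: k => [//|k IH]; have [g [Hg dg]] := bump_sum_derive IH.
  rewrite derive1nS (_ : derive1 _ = g)//; apply/funext => t.
  by rewrite derive1E; apply: derive_val.
move=> H t; have [g [_ dg]] := bump_sum_derive H; by have [] := dg t.
Qed.

Lemma bump_exists (a b al be al' be' : R) : a < al -> al < al' -> al' <= be' -> be' < be -> be < b ->
  exists chi : R -> R, exists chi0, [/\ smooth chi, supp chi `<=` `]a, b[,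
    measurable_fun setT chi, forall t, 0 <= chi t <= 1 &
    [/\ 0 < chi0 <= 1, forall t, chi t != 0 -> al <= t <= be &
        forall t, al' <= t <= be' -> chi0 <= chi t]].
Proof.
move=> aal ala' abe' be'b beb.
pose chi t := flat_exp 0 (t - al) * flat_exp 0 (be - t).
have Hchi : bump_sum al be chi by exact: BumpTerm.
have chiJ t : chi t != 0 -> al <= t <= be.
  rewrite mulf_eq0 negb_or !neq_lt !ltNge !flat_exp_ge0/= -!ltNge !flat_exp_gt0 !subr_gt0.
  by move=> /andP[? ?]; rewrite !ltW.
have c0 : 0 < flat_exp 0 (al' - al) by rewrite flat_exp_gt0 subr_gt0.
have c1 : 0 < flat_exp 0 (be - be') by rewrite flat_exp_gt0 subr_gt0.
exists chi, (flat_exp 0 (al' - al) * flat_exp 0 (be - be')); split.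
- exact: bump_sum_smooth Hchi.
- have cl : closed `[al, be]%classic by exact: itv_closed.
  apply: (@subset_trans _ `[al, be]%classic).
    rewrite [X in _ `<=` X](closure_id _).1//; apply: closureS => t /= /chiJ.
    by rewrite in_itv.
  by move=> t /=; rewrite !in_itv/= => /andP[t1 t2]; rewrite (lt_le_trans aal)//= (le_lt_trans t2).
- have [g [_ dg]] := bump_sum_derive Hchi.
  by apply: continuous_measurable_fun => t; exact: (derive_continuous (dg t)).
- by move=> t; rewrite mulr_ge0 ?flat_exp_ge0//= mulr_ile1 ?flat_exp_ge0 ?flat_exp_le1.
split => //.
- by rewrite mulr_gt0//= mulr_ile1 ?flat_exp_ge0 ?flat_exp_le1.
move=> t /andP[t1 t2]; rewrite ler_pM ?flat_exp_ge0// flat_exp_mono// ?lerD2r//.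
by rewrite lerD2l lerN2.
Qed.

End bump.

(** * Derivatives within an interval and frames along the curve *)

Section within.
Context {R : realType}.
Variables (a b : R) (f : R -> R).
Hypothesis fS : smooth_within `[a, b] f.
Notation g := (fun k => deriven_within `[a, b] k f).

Lemma within_quotient k t e : a <= t <= b -> 0 < e -> \forall s \near t,
  s != t -> a <= s <= b -> `|g k.+1 t - (g k s - g k t) / (s - t)| <= e.
Proof.
move=> tab e0; have tA : `[a, b]%classic t by rewrite /= in_itv.
have /cvgrPdist_le/(_ _ e0) H0 := @fS k t tA.
have H : \forall s \near t, s != t -> `[a, b]%classic s ->
    `|g k.+1 t - (g k s - g k t) / (s - t)| <= e by exact: H0.
by apply: filterS H => s H st sab; apply: H => //; rewrite /= in_itv.
Qed.

Lemma within_derive k t : a < t < b -> is_derive t 1 (g k) (g k.+1 t).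
Proof.
move=> /andP[at_ tb].
have H : (fun h : R => h^-1 *: ((g k \o shift t) (h *: (1 : R^o)) - g k t)) @ 0^' -->
    (g k.+1 t : R^o).
  apply/cvgrPdist_le => e e0.
  have tab : a <= t <= b by rewrite !ltW.
  have /nbhs_ballP[d /= d0 Hd] : \forall s \near t, s != t ->
      `|g k.+1 t - (g k s - g k t) / (s - t)| <= e.
    have tI : a < t < b by rewrite at_.
    apply: filterS2 (within_quotient k tab e0) (ivl_ball tI) => s H /andP[s1 s2] st.
    by apply: H => //; rewrite !ltW.
  near=> h.
  have h0 : h != 0 by near: h; exact: nbhs_dnbhs_neq.
  have -> : h^-1 *: ((g k \o shift t) (h *: (1 : R^o)) - g k t) =
      (g k (h + t) - g k t) / (h + t - t).
    by rewrite [h *: _]mulr1 addrK [LHS]mulrC.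
  apply: Hd; last by rewrite -subr_eq0 addrK.
  rewrite /ball/= opprD addrCA subrr addr0 normrN.
  near: h; apply: (@cvgr0_norm_lt _ _ _ _ _ (fun h : R => h)) => //.
  exact: cvg_within.
by split; [apply/cvg_ex; exists (g k.+1 t)|exact: cvg_lim H].
Unshelve. all: by end_near. Qed.

Lemma within_cont k t e : a <= t <= b -> 0 < e -> \forall s \near t,
  a <= s <= b -> `|g k t - g k s| <= e.
Proof.
move=> tab e0; have := within_quotient k tab ltr01.
pose C := `|g k.+1 t| + 1.
have C0 : 0 < C by rewrite ltr_wpDl.
have Hb : \forall s \near t, `|t - s| < e / C.
  by apply/nbhs_ballP; exists (e / C) => //=; exact: divr_gt0.
move=> Hq; apply: filterS2 Hb Hq => s sd H sab.
have [->|st] := eqVneq s t; first by rewrite subrr normr0 ltW.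
have {}H := H st sab.
have sn : s - t != 0 by rewrite subr_eq0.
have -> : g k t - g k s = - ((g k s - g k t) / (s - t) * (s - t)) by rewrite divfK// opprB.
rewrite normrN normrM; apply: (@le_trans _ _ (C * (e / C))); last by rewrite mulrCA mulfV ?mulr1// gt_eqF.
apply: ler_pM => //; last by rewrite distrC ltW.
rewrite -[X in `|X|](subKr (g k.+1 t)) (le_trans (ler_normB _ _))//.
by rewrite lerD2l.
Qed.

Lemma within_continuous k : {within `[a, b], continuous (g k)}.
Proof.
apply/subspace_continuousP => t; rewrite /= in_itv/= => tab.
apply/cvgrPdist_le => e e0; have := within_cont k tab e0.
move=> H0; have : \forall s \near t, `[a, b]%classic s -> `|g k t - g k s| <= e.
  by apply: filterS H0 => s H; rewrite /= in_itv/=; exact: H.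
by [].
Qed.

End within.

(** * Linear algebra: dual frames and orthogonal vectors *)

Section frames.
Context {R : realType}.

(** Summing [|u_i| <= M + S / (2 K)] over [i] gives [S <= K M + S / 2]. With [M = 0] this is
    injectivity of [1 + E], and in general a bound for its inverse. *)
Lemma l1_contraction (K : nat) (E : 'I_K -> 'I_K -> R) (u c : 'I_K -> R) (M : R) :
  (forall i j, `|E i j| <= 1 / (2 * K%:R)) -> (forall i, `|c i| <= M) ->
  (forall i, u i + \sum_j E i j * u j = c i) -> \sum_i `|u i| <= 2 * (K%:R * M).
Proof.
move=> EK cM uc; have [K0|K0] := posnP K.
  by move: E u c EK cM uc; rewrite K0 => E u c _ _ _; rewrite big_ord0 mul0r mulr0.
have Kp : 0 < K%:R :> R by rewrite ltr0n.
set S := \sum_i _.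
have ui i : `|u i| <= M + 1 / (2 * K%:R) * S.
  have -> : u i = c i - \sum_j E i j * u j by rewrite -uc addrK.
  rewrite (le_trans (ler_normB _ _))// lerD// (le_trans (ler_norm_sum _ _ _))//.
  by rewrite mulr_sumr ler_sum// => j _; rewrite normrM ler_wpM2r.
have : S <= \sum_(i < K) (M + 1 / (2 * K%:R) * S) by apply: ler_sum => i _.
rewrite sumr_const card_ord -[_ *+ K]mulr_natl mulrDr.
have -> : K%:R * (1 / (2 * K%:R) * S) = S / 2 by field; rewrite gt_eqF.
by set q := K%:R * M; lra.
Qed.

(** If [W] is a right inverse of [A0], then [A W = 1 + E] with [E] small for all nearby [A], so
    [W (A W)^-1 c] solves the system with a bound independent of [A]. *)
Lemma perturbed_solve (K n : nat) (A0 : 'M[R]_(K, n)) : row_free A0 ->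
  exists Ce eta, [/\ 1 <= Ce, 0 < eta & forall A : 'M[R]_(K, n),
    (forall i j, `|A i j - A0 i j| <= eta) ->
    forall (c : 'I_K -> R) M, 0 <= M -> (forall i, `|c i| <= M) ->
    exists z : n.-tuple R, (forall i, `|tnth z i| <= Ce * M) /\
      forall i, \sum_j A i j * tnth z j = c i].
Proof.
move=> /row_freeP[W AW].
pose w : R := 1 + \sum_i \sum_j `|W i j|.
have Wij i j : `|W i j| <= w.
  apply: (@le_trans _ _ (\sum_l `|W i l|)); first by rewrite (bigD1 j)//= lerDl sumr_ge0.
  rewrite /w (bigD1 i)//= addrCA lerDl addr_ge0// sumr_ge0// => k _.
  by rewrite sumr_ge0.
have w1 : 1 <= w by rewrite lerDl sumr_ge0// => i _; rewrite sumr_ge0.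
have w0 : 0 < w := lt_le_trans ltr01 w1.
(* The successors keep [eta] meaningful and positive when [K] or [n] is 0. *)
pose eta : R := 1 / (2 * K.+1%:R) / (n.+1%:R * w).
have eta0 : 0 < eta by rewrite !divr_gt0 ?mulr_gt0.
exists (1 + w * (2 * K%:R)), eta; split => //.
  by rewrite lerDl mulr_ge0 ?(ltW w0)// mulr_ge0.
move=> A HA c M M0 cM.
pose E := (A - A0) *m W.
have EK i j : `|E i j| <= 1 / (2 * K%:R).
  have Kp : 0 < K%:R :> R by rewrite ltr0n (leq_ltn_trans _ (ltn_ord i)).
  rewrite mxE (le_trans (ler_norm_sum _ _ _))//.
  apply: (@le_trans _ _ (\sum_(k < n) eta * w)).
    by apply: ler_sum => k _; rewrite normrM ler_pM// !mxE HA.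
  rewrite sumr_const card_ord -[_ *+ n]mulr_natl.
  apply: (@le_trans _ _ (n.+1%:R * (eta * w))).
    by apply: ler_wpM2r; [apply: ltW; exact: mulr_gt0|rewrite ler_nat].
  have -> : n.+1%:R * (eta * w) = 1 / (2 * K.+1%:R).
    by rewrite /eta; field; rewrite ?(gt_eqF w0) -?natr1 !gt_eqF.
  by rewrite ler_pM2l// lef_pV2 ?posrE ?mulr_gt0// ler_pM2l// ler_nat.
have AWE : A *m W = 1%:M + E by rewrite /E mulmxBl AW addrC subrK.
(* A kernel vector of the transpose satisfies the contraction system with zero right-hand side,
   hence vanishes. *)
have uB : A *m W \in unitmx.
  rewrite -unitmx_tr -row_free_unit -kermx_eq0; apply/eqP/row_matrixP => i; rewrite row0.
  set v := row i _.
  have vB : v *m (A *m W)^T = 0 by apply/sub_kermxP; exact: row_sub.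
  have := @l1_contraction K E (fun j => v 0 j) (fun=> 0) 0 EK.
  move=> /(_ _ _) H; have {}H : \sum_i `|v 0 i| <= 2 * (K%:R * 0).
    apply: H => [j|j]; first by rewrite normr0.
    have key : (v *m (A *m W)^T) 0 j = v 0 j + \sum_l E j l * v 0 l.
      rewrite AWE linearD/= trmx1 mulmxDr mulmx1 mxE [X in _ + X]mxE.
      by congr (_ + _); apply: eq_bigr => l _; rewrite [E^T _ _]mxE mulrC.
    by rewrite -key vB mxE.
  apply/rowP => j; rewrite [RHS]mxE; apply/eqP; rewrite -normr_le0.
  apply: le_trans (_ : \sum_i `|v 0 i| <= _); last by rewrite !mulr0 in H.
  by rewrite (bigD1 j)//= lerDl sumr_ge0.
pose cv : 'cV[R]_K := \col_i c i.
pose u := invmx (A *m W) *m cv.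
have Bu : A *m W *m u = cv by rewrite mulKVmx.
have uc i : u i 0 + \sum_j E i j * u j 0 = c i.
  have := congr1 (fun X : 'cV_K => X i 0) Bu.
  by rewrite AWE mulmxDl mul1mx mxE [X in _ + X]mxE [RHS]mxE.
have uM := @l1_contraction K E (fun j => u j 0) c M EK cM uc.
exists [tuple (W *m u) i 0 | i < n]; split => i.
  rewrite tnth_mktuple mxE (le_trans (ler_norm_sum _ _ _))//.
  apply: (@le_trans _ _ (w * \sum_j `|u j 0|)).
    by rewrite mulr_sumr ler_sum// => j _; rewrite normrM ler_wpM2r.
  apply: (@le_trans _ _ (w * (2 * (K%:R * M)))); first by rewrite ler_pM2l.
  have -> : (1 + w * (2 * K%:R)) * M = M + w * (2 * (K%:R * M)) by ring.
  by rewrite lerDr.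
have -> : c i = (cv : 'cV_K) i 0 by rewrite mxE.
rewrite -Bu -mulmxA [RHS]mxE; apply: eq_bigr => j _.
by rewrite tnth_mktuple.
Qed.

Lemma kernel_vector (K n : nat) (A : 'M[R]_(K, n)) : (K < n)%N ->
  exists z : n.-tuple R, [/\ forall i, \sum_j A i j * tnth z j = 0,
    forall i, `|tnth z i| <= 1 / (4 * n%:R) &
    exists i, 1 / (4 * n%:R) <= `|tnth z i|].
Proof.
move=> Kn; have n0 : 0 < n%:R :> R by rewrite ltr0n (leq_ltn_trans _ Kn).
have : kermx A^T != 0.
  rewrite kermx_eq0 /row_free mxrank_tr neq_ltn.
  by rewrite (leq_ltn_trans (rank_leq_row A)).
move=> /rowV0Pn[v /sub_kermxP vA v0].
have [i vi] : exists i, v 0 i != 0.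
  apply/existsP; apply: contraNT v0; rewrite negb_exists => /forallP H.
  by apply/eqP/rowP => i; rewrite [RHS]mxE; apply/eqP; have := H i; rewrite negbK.
have [m _ mP] := @Order.TotalTheory.arg_maxP _ _ 'I_n i predT (fun j => `|v 0 j|) isT.
have vm : 0 < `|v 0 m| by rewrite (lt_le_trans _ (mP i isT))// normr_gt0.
pose c := 1 / (4 * n%:R) / `|v 0 m|.
have c0 : 0 < c by rewrite !divr_gt0// mulr_gt0.
exists [tuple c * v 0 j | j < n]; split.
- move=> k; have := congr1 (fun X : 'rV_K => X 0 k) vA; rewrite !mxE => E.
  transitivity (c * (\sum_j v 0 j * A^T j k)); last by rewrite E mulr0.
  by rewrite mulr_sumr; apply: eq_bigr => j _; rewrite tnth_mktuple mxE; ring.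
- move=> j; rewrite tnth_mktuple normrM gtr0_norm// /c mulrAC ler_pdivrMr//.
  by rewrite ler_pM2l ?divr_gt0 ?mulr_gt0//; exact: mP.
- by exists m; rewrite tnth_mktuple normrM gtr0_norm// /c divfK// gt_eqF.
Qed.

End frames.

(** * The exponents and the lower bounds *)

Section exponents.
Context {R : realType}.

(** Since [t0] may be an endpoint of [[a, b]], the interval is placed beside [t0], inside the open
    interval: closeness to [t0] is enough for the frame to persist. *)
Lemma subinterval (a b t0 eps : R) : a < b -> a <= t0 <= b -> 0 < eps ->
  exists al be, [/\ a < al, al < be, be < b, be - al <= eps &
    forall t, al <= t <= be -> `|t0 - t| < eps].
Proof.
move=> ab /andP[at0 t0b] e0.
have [t0b'|bt0] := ltP t0 b.
  pose s := Num.min eps (b - t0) / 4.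
  have s0 : 0 < s by rewrite divr_gt0// lt_min e0 subr_gt0.
  have s1 : s <= eps / 4 by rewrite ler_pM2r// ge_min lexx.
  have s2 : s <= (b - t0) / 4 by rewrite ler_pM2r// ge_min lexx orbT.
  exists (t0 + s), (t0 + 2 * s); split; try lra.
  by move=> t tI; rewrite ltr_norml; lra.
have tb : t0 = b by apply/eqP; rewrite eq_le t0b.
pose s := Num.min eps (b - a) / 4.
have s0 : 0 < s by rewrite divr_gt0// lt_min e0 subr_gt0.
have s1 : s <= eps / 4 by rewrite ler_pM2r// ge_min lexx.
have s2 : s <= (b - a) / 4 by rewrite ler_pM2r// ge_min lexx orbT.
exists (b - 2 * s), (b - s); split; try lra.
by move=> t tI; rewrite tb ltr_norml; lra.
Qed.

Lemma uniform_const (N : nat) (P : nat -> R -> R -> Prop) :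
  (forall k c c' r, 0 < c' <= c -> 1 <= r -> P k c r -> P k c' r) ->
  (forall k, (k < N)%N -> exists c r0, [/\ 0 < c, 1 <= r0 & forall r, r0 < r -> P k c r]) ->
  exists c r0, [/\ 0 < c, 1 <= r0 & forall r, r0 < r -> forall k, (k < N)%N -> P k c r].
Proof.
move=> mono; elim: N => [|N IH] H; first by exists 1, 1.
have [|c1 [r1 [c10 r11 H1]]] := IH; first by move=> k kN; apply: H; exact: ltnW.
have [c2 [r2 [c20 r21 H2]]] := H N (ltnSn N).
exists (Num.min c1 c2), (Num.max r1 r2); split.
- by rewrite lt_min c10.
- by rewrite le_max r11.
move=> r; rewrite gt_max => /andP[rr1 rr2] k.
have r1' : 1 <= r by rewrite ltW// (le_lt_trans r11).
rewrite ltnS leq_eqVlt => /predU1P[->|kN].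
  by apply: (mono _ c2) (H2 _ rr2) => //; rewrite lt_min c10 c20 ge_min lexx orbT.
by apply: (mono _ c1) (H1 _ rr1 _ kN) => //; rewrite lt_min c10 c20 ge_min lexx.
Qed.

Lemma min_sigma_term_eq (K : nat) (q : \bar R) : (2 <= K)%N ->
  exists k, (2 <= k <= K)%N /\ min_sigma_term K q = sigma_term q k.
Proof.
move=> K2; rewrite /min_sigma_term big_nat.
elim/big_ind: _ => [|x y [i [iK ->]] [j [jK ->]]|i /andP[i2 iK]].
- by exists 2%N; rewrite K2.
- by rewrite /Num.min; case: ifP => _; [exists i|exists j].
- by exists i; rewrite i2 -ltnS.
Qed.

Lemma q_ge4 (k : nat) : (2 <= k)%N -> (4 : R) <= q_ k.
Proof.
move=> k2; have : (2 : R) <= k%:R by rewrite ler_nat.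
by rewrite /q_ => K2; nra.
Qed.

(* The difference is a positive multiple of [(k - j)^2 + (k - j)], which is
   nonnegative because [k - j] is an integer. *)
Lemma sigma_term_critical (k j : nat) : (2 <= k)%N -> (2 <= j)%N ->
  k%:R / q_ k <= sigma_term (q_ k)%:E j :> R.
Proof.
move=> k2 j2; have q4 := q_ge4 k2; have q0 : 0 < q_ k :> R by lra.
have j0 : 0 < j%:R :> R by rewrite ltr0n (leq_trans _ j2).
rewrite /sigma_term inver gt_eqF//= -subr_ge0.
have -> : 1 / j%:R + (j%:R ^+ 2 - j%:R - 2) / (2 * j%:R) * (q_ k)^-1 - k%:R / q_ k
  = ((k%:R - j%:R) ^+ 2 + (k%:R - j%:R)) / (2 * j%:R * q_ k) :> R.
  have kk : k%:R ^+ 2 + k%:R + 2 != 0 :> R.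
    by rewrite gt_eqF// ltr_wpDl// addr_ge0// exprn_ge0.
  by rewrite /q_; field; rewrite ?kk (gt_eqF j0).
apply: divr_ge0; last by rewrite !mulr_ge0// ltW.
have [jk|kj] := leqP j k.
  have : (j%:R : R) <= k%:R by rewrite ler_nat.
  by move=> JK; nra.
have : (k%:R : R) + 1 <= j%:R by rewrite natr1 ler_nat.
by move=> JK; nra.
Qed.

(** For [r >= 1] this inequality lets the bound with exponent [k / q_k] imply the one with [sigma].
    The extra term [K / q_k] is harmless because [k <= K]. *)
Lemma sigma_critical (d K k : nat) : (2 <= k <= K)%N ->
  k%:R / q_ k <= sigma d K (q_ k)%:E :> R.
Proof.
move=> /andP[k2 kK]; have K2 := leq_trans k2 kK.
have q4 := q_ge4 k2; have q0 : 0 < q_ k :> R by lra.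
rewrite /sigma; case: eqP => [<-|_].
  by have [j [/andP[j2 _] ->]] := min_sigma_term_eq (q_ k)%:E K2; exact: sigma_term_critical.
rewrite le_min; apply/andP; split.
  have -> : fine ((q_ k)%:E^-1)%E = (q_ k)^-1 :> R by rewrite inver gt_eqF.
  by apply: ler_wpM2r; [rewrite invr_ge0 ltW|rewrite ler_nat].
by have [j [/andP[j2 _] ->]] := min_sigma_term_eq (q_ k)%:E K2; exact: sigma_term_critical.
Qed.

(** Below [q_K] the term [K / q] exceeds the [K]-th term of the minimum, by [(q_K - q) / (K q)]. It
    is therefore never the smallest one, and the curved scales alone suffice. *)
Lemma sigma_subcritical (d K : nat) (q : R) : (2 <= K)%N -> 2 < q < q_ K ->
  exists k, (2 <= k <= K)%N /\ sigma_term q%:E k <= sigma d K q%:E.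
Proof.
move=> K2 /andP[q2 qK]; have q0 : 0 < q by lra.
have K0 : 0 < K%:R :> R by rewrite ltr0n (leq_trans _ K2).
have [k [kK E]] := min_sigma_term_eq q%:E K2.
rewrite /sigma; case: eqP => [<-|_]; first by exists k; rewrite E.
have [H|H] := leP (min_sigma_term K q%:E) (K%:R * fine (q%:E^-1)%E).
  by exists k; rewrite E.
exists K; rewrite K2 leqnn; split => //.
rewrite /sigma_term inver gt_eqF//= -subr_ge0.
have -> : K%:R * q^-1 - (1 / K%:R + (K%:R ^+ 2 - K%:R - 2) / (2 * K%:R) * q^-1) =
  (q_ K - q) / (K%:R * q).
  by rewrite /q_; field; rewrite !gt_eqF.
by rewrite divr_ge0 ?subr_ge0 ?mulr_ge0 ?(ltW K0) ?(ltW q0)// ltW.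
Qed.

Lemma powR_sigma_le (r s s1 c u : R) (G : \bar R) : 1 <= r -> 0 <= c -> 0 <= u -> s <= s1 ->
  ((c * r `^ (- s) * u)%:E <= G)%E -> ((c * r `^ (- s1) * u)%:E <= G)%E.
Proof.
move=> r1 c0 u0 ss; apply: le_trans; rewrite lee_fin ler_wpM2r// ler_wpM2l//.
by apply: ler_powR => //; rewrite lerN2.
Qed.

End exponents.

Section core.
Context {R : realType}.

(** The order of the choices prevents circularity: [Ce] and [C0] come from the behavior at [t0],
    then [ds] and [m], then the length of [[al, be]], and last [chi] with [chi0], on which [cutoff]
    and all later constants depend. *)
Lemma core_bounds (d K : nat) (a b t0 : R) (gamma : R -> d.-tuple R) :
  (0 < d)%N -> a < b -> smooth_curve `[a, b] gamma -> (2 <= K <= d)%N -> a <= t0 <= b ->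
  row_free (\matrix_(j < K) curve_deriven `[a, b] j.+1 gamma t0) ->
  exists chi : R -> R, [/\ smooth chi, supp chi `<=` `]a, b[ &
    [/\ forall k, (2 <= k <= K)%N -> exists c r0, [/\ 0 < c, 1 <= r0 & forall r, r0 < r ->
        (forall q : R, 2 < q ->
          ((c * r `^ (- sigma_term q%:E k))%:E <= Gq `[a, b] gamma chi q%:E r)%E) /\
        ((c * r `^ (- (1 / k%:R)))%:E <= Gq `[a, b] gamma chi +oo r)%E],
      forall k, (2 <= k < K)%N -> exists c r0, [/\ 0 < c, 1 <= r0 & forall r, r0 < r ->
        ((c * r `^ (- (k%:R / q_ k)) * ln r `^ (1 / q_ k))%:E
          <= Gq `[a, b] gamma chi (q_ k)%:E r)%E] &
      (K < d)%N -> (forall t, t \in `[a, b] -> curve_deriven `[a, b] K.+1 gamma t = 0) ->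
      exists c r0, [/\ 0 < c, 1 <= r0 & forall r, r0 < r ->
        [/\ forall q : R, 2 < q ->
            ((c * r `^ (- (K%:R / q)))%:E <= Gq `[a, b] gamma chi q%:E r)%E,
          (c%:E <= Gq `[a, b] gamma chi +oo r)%E &
          ((c * r `^ (- (K%:R / q_ K)) * ln r `^ (1 / q_ K))%:E
            <= Gq `[a, b] gamma chi (q_ K)%:E r)%E]]]].
Proof.
move=> d0 ab sm /andP[K2 Kd] tab free.
pose D (j : nat) t : d.-tuple R :=
  [tuple deriven_within `[a, b] j (fun s => tnth (gamma s) i) t | i < d].
have DE j t i : tnth (D j t) i = deriven_within `[a, b] j (fun s => tnth (gamma s) i) t.
  by rewrite tnth_mktuple.
have Dder j t i : a < t < b -> is_derive t 1 (fun s => tnth (D j s) i) (tnth (D j.+1 t) i).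
  move=> tI; have := within_derive (sm i) j tI.
  by rewrite -(DE j.+1) (_ : deriven_within _ j _ = fun s => tnth (D j s) i)//;
    apply/funext => s; rewrite DE.
have [Ce0 [eta [Ce01 eta0 Hsolve]]] := perturbed_solve free.
have [eps eps0 Heps] : exists2 eps, 0 < eps & forall t, `|t0 - t| < eps -> a <= t <= b ->
    forall (j : 'I_K.+2) i, `|tnth (D j t0) i - tnth (D j t) i| <= Num.min eta 1.
  have m0 : 0 < Num.min eta 1 by rewrite lt_min eta0 ltr01.
  pose P (i : 'I_d) (j : 'I_K.+2) t := a <= t <= b ->
    `|tnth (D j t0) i - tnth (D j t) i| <= Num.min eta 1.
  have H1 j i : \forall t \near t0, P i j t.
    by apply: filterS (within_cont (sm i) j tab m0) => t H /H; rewrite !DE.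
  have H2 j := @filter_forall R 'I_d (fun i => P i j) (nbhs t0) (nbhs_filter t0) (H1 j).
  have := @filter_forall R 'I_K.+2 (fun j t => forall i, P i j t) (nbhs t0) (nbhs_filter t0) H2.
  move=> /nbhs_ballP[e /= e0 He]; exists e => // t te tI j i.
  exact: (He t te j i tI).
pose C0 : R := 1 + \sum_(j < K.+2) \sum_i (`|tnth (D j t0) i|).
have C01 : 1 <= C0 by rewrite lerDl sumr_ge0// => j _; rewrite sumr_ge0.
have Cp : 0 < C0 := lt_le_trans ltr01 C01.
have DC' t : `|t0 - t| < eps -> a <= t <= b -> forall j i, (j <= K.+1)%N -> `|tnth (D j t) i| <= C0.
  move=> te tI j i jK; have /(_ i) := Heps t te tI (Ordinal (jK : (j < K.+2)%N)).
  move=> /= X; have {}X : `|tnth (D j t0) i - tnth (D j t) i| <= 1.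
    by rewrite (le_trans X)// ge_min lexx orbT.
  have -> : tnth (D j t) i = - (tnth (D j t0) i - tnth (D j t) i) + tnth (D j t0) i by ring.
  rewrite (le_trans (ler_normD _ _))// normrN lerD//.
  rewrite (bigD1 (Ordinal (jK : (j < K.+2)%N)))//= (bigD1 i)//= -addrA lerDl.
  by rewrite addr_ge0 ?sumr_ge0// => l _; rewrite sumr_ge0.
pose Ce := Ce0.
have Cep : 0 < Ce := lt_le_trans ltr01 Ce01.
have n0 : 0 < d%:R :> R by rewrite ltr0n.
pose ds : R := 1 / (64 * d%:R * Ce).
have ds0 : 0 < ds by rewrite divr_gt0// !mulr_gt0.
have dsCe : ds * Ce <= 1 / (64 * d%:R).
  by rewrite le_eqVlt; apply/orP; left; apply/eqP; rewrite /ds; field; rewrite !gt_eqF.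
pose m : R := (ds / (8 * (d%:R * C0))) ^+ 2.
have nC1 : 1 <= d%:R * C0 by rewrite -[leLHS]mulr1 ler_pM// ler1n.
have nC0 : 0 < d%:R * C0 by exact: mulr_gt0.
have m01 : 0 < m <= 1.
  have ds1 : ds <= 1.
    have n64 : 1 <= 64 * d%:R :> R by rewrite -natrM ler1n muln_gt0.
    rewrite /ds ler_pdivrMr ?mul1r ?mulr_gt0//.
    by rewrite -[leLHS]mulr1 ler_pM.
  have q0 : 0 < ds / (8 * (d%:R * C0)) by apply: divr_gt0 => //; apply: mulr_gt0.
  rewrite exprn_gt0//= exprn_ile1 ?(ltW q0)// ler_pdivrMr ?mul1r; last exact: mulr_gt0.
  move: ds1 nC1; clear; set q := d%:R * C0; lra.
have /andP[m0 m1] := m01.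
have dir0 : 0 < @dir_size R d Ce.
  by rewrite /dir_size mulr_gt0// addr_gt0// mulr_gt0.
(* The length allowed by the frame near [t0] and by the three shortness conditions. *)
pose lam : R := Num.min eps (Num.min (1 / 2 / (d%:R * (Ce * C0)))
  (Num.min (m / (32 * @dir_size R d Ce) / (d%:R * (1 * C0))) (ds / 4 / (d%:R * C0)))).
have CeC : 0 < d%:R * (Ce * C0) by apply: mulr_gt0 => //; exact: mulr_gt0.
have oneC : 0 < d%:R * (1 * C0) by rewrite mul1r.
have lam0 : 0 < lam.
  have l1 : 0 < 1 / 2 / (d%:R * (Ce * C0)) by apply: divr_gt0.
  have l2 : 0 < m / (32 * @dir_size R d Ce) / (d%:R * (1 * C0)).
    by apply: divr_gt0 => //; apply: divr_gt0 => //; exact: mulr_gt0.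
  have l3 : 0 < ds / 4 / (d%:R * C0) by apply: divr_gt0 => //; exact: divr_gt0.
  by rewrite !lt_min eps0 l1 l2 l3.
have [al [be [aal albe beb blam Hb]]] := subinterval ab tab lam0.
have short (x y : R) : 0 < y -> lam <= x / y -> (be - al) * y <= x.
  by move=> y0 lxy; rewrite -ler_pdivlMr// (le_trans blam).
have short1 : (be - al) * (d%:R * (Ce * C0)) <= 1 / 2.
  by apply: short => //; rewrite !ge_min lexx ?orbT.
have short2 : (be - al) * (d%:R * (1 * C0)) <= m / (32 * @dir_size R d Ce).
  by apply: short => //; rewrite !ge_min lexx ?orbT.
have short3 : (be - al) * (d%:R * C0) <= ds / 4.
  by apply: short => //; rewrite !ge_min lexx ?orbT.
have JI t : al <= t <= be -> a < t < b.
  by move=> /andP[t1 t2]; rewrite (lt_le_trans aal)//= (le_lt_trans t2).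
have JI' t : al <= t <= be -> a <= t <= b by move=> /JI/andP[? ?]; rewrite !ltW.
have Jeps t : al <= t <= be -> `|t0 - t| < eps.
  by move=> /Hb/lt_le_trans; apply; rewrite ge_min lexx.
pose al' := al + (be - al) / 3; pose be' := be - (be - al) / 3.
have ala' : al < al' by rewrite ltrDl divr_gt0// subr_gt0.
have be'be : be' < be by rewrite ltrBlDr ltrDl divr_gt0// subr_gt0.
have omega0 : al' < be' by rewrite /al' /be'; move: albe; clear; lra.
have [chi [chi0 [smchi suppchi chi_meas chi01 [chi001 chi_supp chi_ge]]]] :=
  bump_exists aal ala' (ltW omega0) be'be beb.
exists chi; split => //.
have gamma_cont i : {within `[a, b], continuous (fun t => tnth (gamma t) i)}.
  by have := @within_continuous R a b _ (sm i) 0%N.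
have DD j t i : al <= t <= be -> is_derive t 1 (fun s => tnth (D j s) i) (tnth (D j.+1 t) i).
  by move=> /JI; exact: Dder.
have DC j t i : (j <= K.+1)%N -> al <= t <= be -> `|tnth (D j t) i| <= C0.
  by move=> jK tJ; apply: DC' => //; [exact: Jeps|exact: JI'].
have D0 t : al <= t <= be -> gamma t = D 0 t.
  by move=> _; apply: eq_from_tnth => i; rewrite DE.
have order : [/\ a <= al, al <= al', be' <= be & be <= b] by rewrite !ltW.
have KJ : (2 <= K < K.+1)%N by rewrite K2 ltnSn.
have dotpE z j t : dotp z (D j t) =
    \sum_i curve_deriven `[a, b] j gamma t 0 i * tnth z i.
  by apply: eq_bigr => i _; rewrite DE mxE mulrC.
have frame t (c : nat -> R) M : al <= t <= be -> (forall j, `|c j| <= M) ->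
    exists z : d.-tuple R, (forall i, `|tnth z i| <= Ce * M) /\
    forall j, (0 < j <= K)%N -> dotp z (D j t) = c j.
  move=> tJ cM; have M0 : 0 <= M := le_trans (normr_ge0 _) (cM 0%N).
  have [|z [z1 z2]] := Hsolve (\matrix_(j < K) curve_deriven `[a, b] j.+1 gamma t) _
    (fun j => c j.+1) M M0 (fun j => cM j.+1).
    move=> j i; rewrite !mxE -!DE distrC.
    have jK : (j.+1 < K.+2)%N by rewrite !ltnS ltnW.
    have := Heps t (Jeps _ tJ) (JI' _ tJ) (Ordinal jK) i.
    by move=> /le_trans; apply; rewrite ge_min lexx.
  exists z; split => // -[//|j] /= jK; have := z2 (Ordinal jK) => <-.
  by rewrite dotpE; apply: eq_bigr => i _; rewrite !mxE.
split.
- move=> k kK; exact: (pure_bound gamma_cont chi_meas chi01 C01 DD DC D0 chi_supp chi_ge order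
    m01 chi001 Ce01 d0 (leqW K2) short1 short2 KJ omega0 frame ds0 dsCe erefl short3 kK).
- move=> k kK; exact: (log_scale_bound gamma_cont chi_meas chi01 C01 DD DC D0 chi_supp chi_ge order
    m01 chi001 Ce01 d0 (leqW K2) short1 short2 KJ omega0 frame ds0 dsCe erefl short3 kK).
move=> Kd' flat0.
have flat t i : al <= t <= be -> tnth (D K.+1 t) i = 0.
  move=> tJ; have tI : t \in `[a, b] by rewrite in_itv/= JI'.
  by have := congr1 (fun X : 'rV_d => X 0 i) (flat0 t tI); rewrite !mxE DE.
have [z0 [z1 z2 z3]] := kernel_vector
  (\matrix_(j < K) curve_deriven `[a, b] j.+1 gamma al) Kd'.
have alJ : al <= al <= be by rewrite lexx ltW.
(* Descending induction on the order: if the pairing of order [j.+1] vanishes identically, the one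
   of order [j] is constant, and it is zero at [al] by the choice of [z0]. *)
have z0_orth j t : (0 < j <= K)%N -> al <= t <= be -> dotp z0 (D j t) = 0.
  suff H l : (l <= K)%N -> forall t, al <= t <= be -> dotp z0 (D (K.+1 - l)%N t) = 0.
    move=> /andP[j0 jK] tJ; have := H (K.+1 - j)%N.
    rewrite subKn; last exact: leqW.
    by apply => //; rewrite leq_subLR -addn1 addnC leq_add2r.
  elim: l => [_ s sJ|l IH lK s sJ].
    by rewrite subn0 /dotp big1// => i _; rewrite flat// mulr0.
  have E : (K.+1 - l = (K.+1 - l.+1).+1)%N by rewrite subnSK// ltnW.
  have D1 u : al <= u <= be -> `|u - al| <= `|s - al| ->
      is_derive u 1 (fun u => dotp z0 (D (K.+1 - l.+1)%N u)) (dotp z0 (D (K.+1 - l)%N u)).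
    by move=> uJ _; rewrite E; exact: (is_derive_dotp DD).
  have D2 u : al <= u <= be -> `|u - al| <= `|s - al| -> `|dotp z0 (D (K.+1 - l)%N u)| <= 0.
    by move=> uJ _; rewrite IH ?normr0// ltnW.
  have := mvt_le sJ alJ D1 D2; rewrite mul0r normr_le0 subr_eq0 => /eqP ->.
  have jK : (K - l.+1 < K)%N by rewrite ltn_subrL (leq_trans _ K2).
  have jE : (K.+1 - l.+1 = (K - l.+1).+1)%N by rewrite subSS subnSK.
  rewrite jE -[RHS](z1 (Ordinal jK)) dotpE.
  by apply: eq_bigr => i _; rewrite !mxE.
exact: (flat_bound gamma_cont chi_meas chi01 C01 DD DC D0 chi_supp chi_ge order
    m01 chi001 Ce01 d0 (leqW K2) short1 short2 KJ omega0 frame ds0 dsCe erefl z0_orth z2 z3 flat).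
Qed.

End core.

Theorem theorem1p3 (R : realType) (d K : nat) (a b t0 : R)
    (gamma : R -> d.-tuple R)
    (hd : (3 <= d)%N) (hab : a < b)
    (hgamma : immersed_curve `[a, b] gamma)
    (hK : (2 <= K <= d)%N) (ht0 : a <= t0 <= b)
    (hfree : row_free (\matrix_(j < K) curve_deriven `[a, b] j.+1 gamma t0)) :
  exists chi : R -> R,
    [/\ smooth chi, supp chi `<=` `]a, b[ &
    exists c R0 : R, [/\ 0 < c, 1 <= R0 & forall r : R, R0 < r ->
      [/\
        (K < d)%N ->
          (forall q : R, 2 < q < q_ K ->
            ((c * r `^ (- sigma d K q%:E))%:E <= Gq `[a, b] gamma chi q%:E r)%E) /\
          (forall k : nat, (2 <= k <= K.-1)%N ->
            ((c * r `^ (- sigma d K (q_ k)%:E) * ln r `^ (1 / q_ k))%:E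
               <= Gq `[a, b] gamma chi (q_ k)%:E r)%E),
        K = d ->
          (forall q : \bar R, (2%:E < q)%E ->
            ((c * r `^ (- sigma d d q))%:E <= Gq `[a, b] gamma chi q r)%E) /\
          (forall k : nat, (2 <= k <= d.-1)%N ->
            ((c * r `^ (- sigma d d (q_ k)%:E) * ln r `^ (1 / q_ k))%:E
               <= Gq `[a, b] gamma chi (q_ k)%:E r)%E) &
        (K < d)%N ->
        (forall t, t \in `[a, b] -> curve_deriven `[a, b] K.+1 gamma t = 0) ->
          (forall q : \bar R, (2%:E < q)%E ->
            ((c * r `^ (- sigma d K q))%:E <= Gq `[a, b] gamma chi q r)%E) /\
          (forall k : nat, (2 <= k <= K)%N ->
            ((c * r `^ (- sigma d K (q_ k)%:E) * ln r `^ (1 / q_ k))%:E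
               <= Gq `[a, b] gamma chi (q_ k)%:E r)%E)]]].
Proof.
have /andP[K2 Kd] := hK; have d0 : (0 < d)%N by apply: leq_trans hd.
have [sm _] := hgamma.
have [chi [smchi suppchi [B1 B2 B3]]] := core_bounds d0 hab sm hK ht0 hfree.
exists chi; split => //.
have mono (c c' s u : R) (G : \bar R) r : 0 < c' <= c -> 0 <= u ->
    ((c * r `^ s * u)%:E <= G)%E -> ((c' * r `^ s * u)%:E <= G)%E.
  move=> /andP[c0 cc] u0; apply: le_trans; rewrite lee_fin ler_wpM2r// ler_wpM2r//.
  exact: powR_ge0.
have mono1 (c c' s : R) (G : \bar R) r : 0 < c' <= c ->
    ((c * r `^ s)%:E <= G)%E -> ((c' * r `^ s)%:E <= G)%E.
  by move=> cc; have := @mono c c' s 1 G r cc ler01; rewrite !mulr1.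
have [||c1 [r1 [c10 r11 H1]]] := @uniform_const R K.+1 (fun k c r => (2 <= k)%N ->
  (forall q : R, 2 < q ->
    ((c * r `^ (- sigma_term q%:E k))%:E <= Gq `[a, b] gamma chi q%:E r)%E) /\
  ((c * r `^ (- (1 / k%:R)))%:E <= Gq `[a, b] gamma chi +oo r)%E).
- move=> k c c' r cc r1 H /H[X Y]; split; last exact: mono1 Y.
  by move=> q /X; exact: mono1.
- move=> k; rewrite ltnS => kK; have [k2|k2] := leqP 2 k; last by exists 1, 1.
  by have [|c [r0 [? ? H]]] := B1 k; [rewrite k2|exists c, r0; split => // r /H].
have [||c2 [r2 [c20 r21 H2]]] := @uniform_const R K (fun k c r => (2 <= k)%N ->
  ((c * r `^ (- (k%:R / q_ k)) * ln r `^ (1 / q_ k))%:E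
     <= Gq `[a, b] gamma chi (q_ k)%:E r)%E).
- by move=> k c c' r cc r1' H /H; apply: mono => //; exact: powR_ge0.
- move=> k kK; have [k2|k2] := leqP 2 k; last by exists 1, 1.
  by have [|c [r0 [? ? H]]] := B2 k; [rewrite k2|exists c, r0; split => // r /H].
pose flat := (K < d)%N /\ (forall t, t \in `[a, b] -> curve_deriven `[a, b] K.+1 gamma t = 0).
have [c3 [r3 [c30 r31 H3]]] : exists c r0 : R, [/\ 0 < c, 1 <= r0 & forall r, r0 < r -> flat ->
    [/\ forall q : R, 2 < q ->
        ((c * r `^ (- (K%:R / q)))%:E <= Gq `[a, b] gamma chi q%:E r)%E,
      (c%:E <= Gq `[a, b] gamma chi +oo r)%E &
      ((c * r `^ (- (K%:R / q_ K)) * ln r `^ (1 / q_ K))%:E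
        <= Gq `[a, b] gamma chi (q_ K)%:E r)%E]].
  (* The constants must be fixed before the flatness hypothesis is introduced, hence this classical
     case distinction. *)
  have [[f1 f2]|nf] := pselect flat; last by exists 1, 1; split => // r _ /nf.
  by have [c [r0 [? ? H]]] := B3 f1 f2; exists c, r0; split => // r /H.
exists (Num.min c1 (Num.min c2 c3)), (Num.max r1 (Num.max r2 r3)); split.
- by rewrite !lt_min c10 c20.
- by rewrite le_max r11.
set c := Num.min _ _; move=> r; rewrite !gt_max => /and3P[rr1 rr2 rr3].
have cc0 : 0 < c by rewrite !lt_min c10 c20.
have cc1 : 0 < c <= c1 by rewrite cc0 ge_min lexx.
have cc2 : 0 < c <= c2 by rewrite cc0 !ge_min lexx ?orbT.
have cc3 : 0 < c <= c3 by rewrite cc0 !ge_min lexx ?orbT.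
have rge1 : 1 <= r by rewrite ltW// (le_lt_trans r11).
have pure (q : R) k : 2 < q -> (2 <= k <= K)%N ->
    ((c * r `^ (- sigma_term q%:E k))%:E <= Gq `[a, b] gamma chi q%:E r)%E.
  by move=> q2 /andP[k2 kK]; have [X _] := H1 r rr1 k kK k2; exact: mono1 (X q q2).
have pureoo k : (2 <= k <= K)%N ->
    ((c * r `^ (- (1 / k%:R)))%:E <= Gq `[a, b] gamma chi +oo r)%E.
  by move=> /andP[k2 kK]; have [_ X] := H1 r rr1 k kK k2; exact: mono1 X.
have sigoo k : sigma_term +oo%E k = 1 / k%:R :> R.
  by rewrite /sigma_term [X in fine X](_ : _ = 0%E)//= mulr0 addr0.
have critical k : (2 <= k < K)%N ->
    ((c * r `^ (- sigma d K (q_ k)%:E) * ln r `^ (1 / q_ k))%:E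
       <= Gq `[a, b] gamma chi (q_ k)%:E r)%E.
  move=> /andP[k2 kK]; apply: (powR_sigma_le rge1 (ltW cc0) (powR_ge0 _ _)).
    by apply: sigma_critical; rewrite k2 ltnW.
  by apply: (mono _ _ _ _ _ _ cc2); [exact: powR_ge0|exact: H2].
split.
- move=> Kd'; split => [q q2K|k /andP[k2 kK]].
    have [k [kK sk]] := sigma_subcritical d K2 q2K.
    have /andP[q2 _] := q2K.
    have := @powR_sigma_le R r _ _ c 1 _ rge1 (ltW cc0) ler01 sk.
    by rewrite !mulr1; apply; exact: pure.
  by apply: critical; rewrite k2 -(ltn_predK K2) ltnS.
- move=> KdE; split => [q q2|k /andP[k2 kK]]; last first.
    have := critical k; rewrite KdE; apply.
    by rewrite k2 -(ltn_predK (leq_trans (ltnW hd) (leqnn d))) ltnS.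
  rewrite /sigma eqxx; have [k [kK ->]] := min_sigma_term_eq q (ltnW hd).
  rewrite -KdE in kK.
  case: q q2 => [q||//]; first by rewrite lte_fin => q2; exact: pure.
  by move=> _; rewrite sigoo; exact: pureoo.
move=> Kd' f; have [F1 F2 F3] := H3 r rr3 (conj Kd' f).
split => [q q2|k /andP[k2]].
  (* If [K / q] is the minimum, the bound with a fixed scale applies; at [q = +oo] it is the
     constant [c]. Otherwise some pure scale realizes the minimum. *)
  rewrite /sigma (ltn_eqF Kd') /Num.min; case: ifP => _.
    case: q q2 => [q||//].
      rewrite lte_fin => q2; rewrite inver gt_eqF ?(lt_trans _ q2)//=.
      exact: mono1 (F1 q q2).
    move=> _; rewrite [X in fine X](_ : _ = 0%E)//= mulr0 oppr0.
    by apply: (@mono1 c3) => //; rewrite powRr0 mulr1.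
  have [k [kK ->]] := min_sigma_term_eq q K2.
  case: q q2 => [q||//]; first by rewrite lte_fin => q2; exact: pure.
  by move=> _; rewrite sigoo; exact: pureoo.
rewrite leq_eqVlt => /predU1P[->|kK]; last by apply: critical; rewrite k2.
apply: (powR_sigma_le rge1 (ltW cc0) (powR_ge0 _ _)).
  by apply: sigma_critical; rewrite K2 leqnn.
by apply: (mono _ _ _ _ _ _ cc3); [exact: powR_ge0|].
Qed.
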